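(* Let $(\Phi_{\mathbf c},\Phi_{\mathbf s})$ be a well-formed program of the polymorphic client-server calculus with main term $M$ such that $\vdash\langle M;\epsilon\mid\epsilon\rangle:T\,A$ for some type $A$, and in which every type abstraction has the form $\Lambda\alpha.\mathsf{unit}\,V'$. If $\langle M\mid\epsilon\rangle\longrightarrow^*\langle\mathsf{unit}\,V\mid\epsilon\rangle$ in the polymorphic client-server calculus, then $\langle[\![M]\!]_{\mathbf c}\mid loop\,()\rangle\longrightarrow^*\langle[\![\mathsf{unit}\,V]\!]_{\mathbf c}\mid loop\,()\rangle$ in the untyped client-server calculus, with respect to the compiled function maps $([\![\Phi_{\mathbf c}]\!]_{\mathbf c},[\![\Phi_{\mathbf s}]\!]_{\mathbf s})$.
   Context: **A. Polymorphic client-server calculus.** Location constants $a,b::=\mathbf c\mid\mathbf s$; $Loc::=a\mid l$ with $l$ a location variable. Types: $A,B,C::=base\mid A\xrightarrow{Loc}B\mid Clo(A)\mid A\times B\mid\alpha\mid\forall\alpha.A\mid\forall l.A\mid T\,A$. Values: $V,W::=x\mid(V,W)\mid clo(\overline W,F)\mid\Lambda\alpha.V\mid\mathsf{unit}\,V\mid\mathsf{do}\,x\leftarrow M\,\mathsf{in}\,N\mid\mathsf{req}(V,W)\mid\mathsf{call}(V,W)\mid\mathsf{gen}(Loc,V,W)$. Terms: $L,M,N::=V\mid\mathsf{let}\,x=M\,\mathsf{in}\,N\mid\pi_i(V)\mid V(W)\mid V[A]\mid V[Loc]$. Code names $F::=F_{name}[\overline{Loc}\,\overline A]$; code $\overline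 l\,\overline\alpha.\overline z.OpenCode$ with $OpenCode::=\lambda x.M\mid\Lambda l.V$; code types $\overline l\,\overline\alpha.\overline B.A$; function maps are finite sets of bindings $F_{name}:Ty=Code$; programs are pairs $(\Phi_{\mathbf c},\Phi_{\mathbf s})$. $\{\cdot/\cdot\}$ is capture-avoiding substitution. $relocatable(A)$ holds if $A$ is a type variable, $base$, $Clo(B)$ or $\forall\alpha.B$, or $A=A_1\times A_2$ with both $A_i$ relocatable; not otherwise. Typing $\Gamma\vdash_{Loc}M:A$, with $\Gamma$ a list of $x:A$, $\alpha$, $l$ declaring all free variables: - (Var) $\Gamma(x)=A$ gives $\Gamma\vdash_{Loc}x:A$. (Let) $\Gamma\vdash_{Loc}M:A$, $\Gamma,x:A\vdash_{Loc}N:B$ give $\Gamma\vdash_{Loc}\mathsf{let}\,x=M\,\mathsf{in}\,N:B$. - (Clo) $\vdash F:\overline B.A$ and $\Gamma\vdash_{Loc}W_i:B_i$ for all $i$ give $\Gamma\vdash_{Loc}clo(\overline W,F):Clo(A)$. - (Proj) $\Gamma\vdash_{Loc}V:A_1\times A_2$ gives $\Gamma\vdash_{Loc}\pi_i(V):A_i$. (Pair) $\Gamma\vdash_{Loc}V:A$, $\Gamma\vdash_{Loc}W:B$ give $\Gamma\vdash_{Loc}(V,W):A\times B$. - (Tabs) $\Gamma,\alpha\vdash_{Loc_0}V:A$ for all $Loc_0$ gives $\Gamma\vdash_{Loc}\Lambda\alpha.V:\forall\alpha.A$. (Tapp) $\Gamma\vdash_{Loc}V:\forall\alpha.A$, $relocatable(B)$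 give $\Gamma\vdash_{Loc}V[B]:A\{B/\alpha\}$. (Lapp) $\Gamma\vdash_{Loc}V:Clo(\forall l.A)$ gives $\Gamma\vdash_{Loc}V[Loc']:A\{Loc'/l\}$. - (Unit) $\Gamma\vdash_{Loc}V:A$, $relocatable(A)$ give $\Gamma\vdash_{Loc}\mathsf{unit}\,V:T\,A$. (Bind) $\Gamma\vdash_{Loc}M:T\,A$, $\Gamma,x:A\vdash_{Loc}N:T\,B$ give $\Gamma\vdash_{Loc}\mathsf{do}\,x\leftarrow M\,\mathsf{in}\,N:T\,B$. - (App) $\Gamma\vdash_{Loc}V:Clo(A\xrightarrow{Loc}B)$, $\Gamma\vdash_{Loc}W:A$ give $\Gamma\vdash_{Loc}V(W):B$. - (Gen) $\Gamma\vdash_{Loc}V:Clo(A\xrightarrow{Loc'}T\,B)$, $\Gamma\vdash_{Loc}W:A$, $relocatable(A)$ give $\Gamma\vdash_{Loc}\mathsf{gen}(Loc',V,W):T\,B$. - (Req) the same premises with $Loc=\mathbf c$, $Loc'=\mathbf s$ give $\Gamma\vdash_{\mathbf c}\mathsf{req}(V,W):T\,B$. (Call) with $Loc=\mathbf s$, $Loc'=\mathbf c$ they give $\Gamma\vdash_{\mathbf s}\mathsf{call}(V,W):T\,B$. - With disjoint maps $\Phi_{\mathbf c}^\circ,\Phi_{\mathbf s}^\circ,\Phi_{common}$ (below), for typing let $\Phi_{Loc}=\Phi_a^\circ$ if $Loc=a$ and $\Phi_{common}$ if $Loc$ is a variable; $\theta=\{\overline{Loc}\,\overline A/\overline l\,\overline\alpha\}$.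 (F-Abs) If $(F_{name}:\overline l\,\overline\alpha.\overline B.D\xrightarrow{Loc'}C=\overline l\,\overline\alpha.\overline z.\lambda x.M)\in\Phi_{Loc'}$, $\overline l,\overline\alpha,\overline{z:B},x:D\vdash_{Loc'}M:C$, and all $A_i$, $B_j$ are relocatable, then $\vdash F_{name}[\overline{Loc}\,\overline A]:\overline{B\theta}.(D\xrightarrow{Loc'}C)\theta$. (F-LAbs) If $(F_{name}:\overline l\,\overline\alpha.\overline B.\forall l.D=\overline l\,\overline\alpha.\overline z.\Lambda l.V)\in\Phi_{common}$, $\overline l,\overline\alpha,\overline{z:B},l\vdash_{Loc_0}V:D$ for all $Loc_0$, and all $A_i$, $B_j$ are relocatable, then $\vdash F_{name}[\overline{Loc}\,\overline A]:\overline{B\theta}.(\forall l.D)\theta$. The program is well-formed if there are pairwise disjoint $\Phi_{\mathbf c}^\circ,\Phi_{\mathbf s}^\circ,\Phi_{common}$ with distinct function names, $\Phi_{\mathbf c}=\Phi_{\mathbf c}^\circ\uplus\Phi_{common}$, $\Phi_{\mathbf s}=\Phi_{\mathbf s}^\circ\uplus\Phi_{common}$, such that each binding $F_{name}:\overline l\,\overline\alpha.\overline B.A=\overline l\,\overline\alpha.\overline z.OpenCode$, with $\Gamma=\{\overline l,\overline\alpha,\overline{z:B}\}$, satisfies either $A=A_1\xrightarrow{Loc}A_2$, $OpenCode=\lambda x.M$, $\Gamma,x:A_1\vdash_{Loc}M:A_2$, binding in $\Phi_{Loc}$ (typing notation); or $A=\forall l.A_1$, $OpenCode=\Lambda l.V$,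 $\Gamma,l\vdash_{Loc}V:A_1$ for all $Loc$, binding in $\Phi_{common}$. Contexts: $E[\,]::=E_{let}[\,]\mid\mathsf{do}\,x\leftarrow E[\,]\,\mathsf{in}\,M$; $E_{let}[\,]::=[\,]\mid\mathsf{let}\,x=E_{let}[\,]\,\mathsf{in}\,M$. Stacks $\Delta::=\epsilon\mid E[\,];\Delta$. Configurations $\langle M;\Delta_{\mathbf c}\mid\Delta_{\mathbf s}\rangle$ or $\langle\Delta_{\mathbf c}\mid M;\Delta_{\mathbf s}\rangle$; $\langle M\mid\epsilon\rangle$ means $\langle M;\epsilon\mid\epsilon\rangle$. $\vdash\langle M;\epsilon\mid\epsilon\rangle:T\,A$ means $\emptyset\vdash_{\mathbf c}M:T\,A$. $\Sigma_{\mathbf c}[\,]=\langle E[\,];\Delta_{\mathbf c}\mid\Delta_{\mathbf s}\rangle$, $\Sigma_{\mathbf s}[\,]=\langle\Delta_{\mathbf c}\mid E[\,];\Delta_{\mathbf s}\rangle$. If $\Phi_a$ (the program's map at $a$) binds $F_{name}$ to $\overline l\,\overline\alpha.\overline z.OpenCode$, then $\Phi_a(F_{name}[\overline{Loc}\,\overline A])=\overline z.(OpenCode\{\overline{Loc}\,\overline A/\overline l\,\overline\alpha\})$. Local steps $\longrightarrow^a$: $\mathsf{let}\,x=V\,\mathsf{in}\,M\to M\{V/x\}$; $\mathsf{do}\,x\leftarrow\mathsf{unit}\,V\,\mathsf{in}\,M\to M\{V/x\}$; $\pi_i(V_1,V_2)\to V_i$; $(\Lambda\alpha.V)[A]\to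 V\{A/\alpha\}$; $clo(\overline W,F)(V)\to M\{\overline W/\overline z\}\{V/x\}$ if $\Phi_a(F)=\overline z.\lambda x.M$; $clo(\overline W,F)[b]\to V\{\overline W/\overline z\}\{b/l\}$ if $\Phi_a(F)=\overline z.\Lambda l.V$. If $M\longrightarrow^aM'$ then $\Sigma_a[M]\longrightarrow\Sigma_a[M']$. Communication steps: - $\langle E[\mathsf{req}(V,W)];\Delta_{\mathbf c}\mid\Delta_{\mathbf s}\rangle\to\langle E[\,];\Delta_{\mathbf c}\mid V(W);\Delta_{\mathbf s}\rangle$; $\langle\Delta_{\mathbf c}\mid E[\mathsf{call}(V,W)];\Delta_{\mathbf s}\rangle\to\langle V(W);\Delta_{\mathbf c}\mid E[\,];\Delta_{\mathbf s}\rangle$ - $\langle\mathsf{unit}\,V;\Delta_{\mathbf c}\mid E[\,];\Delta_{\mathbf s}\rangle\to\langle\Delta_{\mathbf c}\mid E[\mathsf{unit}\,V];\Delta_{\mathbf s}\rangle$; $\langle E[\,];\Delta_{\mathbf c}\mid\mathsf{unit}\,V;\Delta_{\mathbf s}\rangle\to\langle E[\mathsf{unit}\,V];\Delta_{\mathbf c}\mid\Delta_{\mathbf s}\rangle$; $\langle\epsilon\mid\mathsf{unit}\,V;\epsilon\rangle\to\langle\mathsf{unit}\,V;\epsilon\mid\epsilon\rangle$ - On the client, $E[\mathsf{gen}(\mathbf c,V,W)]\to E[V(W)]$, $E[\mathsf{gen}(\mathbf s,V,W)]\to E[\mathsf{req}(V,W)]$; on the server, $E[\mathsf{gen}(\mathbf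 c,V,W)]\to E[\mathsf{call}(V,W)]$, $E[\mathsf{gen}(\mathbf s,V,W)]\to E[V(W)]$ (stacks unchanged). **B. Untyped client-server calculus.** Values $v,w::=x\mid(v,w)\mid Con\,\overline v\mid\mathsf{unit}\,v\mid\mathsf{do}\,x\leftarrow m\,\mathsf{in}\,n$, with $Con$ ranging over data constructors (including $Client$, $Server$, $Closure$, $Apply$, $Ret$). Terms $m,n::=v\mid\mathsf{let}\,x=m\,\mathsf{in}\,n\mid\pi_i(v)\mid v(w)\mid p(\overline v)\mid\mathsf{case}\,v\,\mathsf{of}\,\overline{c\,\overline x\to m}$, with primitives $p::=send\mid receive$. $\mathsf{do}\,send\,v\,\mathsf{in}\,m$ (also written $\mathsf{do}\,send\,v;\,m$) abbreviates $\mathsf{do}\,x\leftarrow send\,v\,\mathsf{in}\,m$ with $x$ unused. Function maps bind names to codes $\overline z.\lambda x.m$. Configurations are $\langle m_{\mathbf c}\mid m_{\mathbf s}\rangle$. Contexts: $e[\,]::=e_{let}[\,]\mid\mathsf{do}\,x\leftarrow e[\,]\,\mathsf{in}\,m$; $e_{let}[\,]::=[\,]\mid\mathsf{let}\,x=e_{let}[\,]\,\mathsf{in}\,m$. Configuration contexts $\sigma[\,]::=\langle e_1[\,]\mid e_2[\mathsf{do}\,x\leftarrow receive\,\mathsf{in}\,m]\rangle$ or $\langle e_1[\mathsf{do}\,x\leftarrow receive\,\mathsf{in}\,m]\mid e_2[\,]\rangle$. Steps: - Local: if $m\to m'$ then $\sigma[m]\to\sigma[m']$, with $\mathsf{let}\,x=v\,\mathsf{in}\,m\to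 m\{v/x\}$; $\mathsf{do}\,x\leftarrow\mathsf{unit}\,v\,\mathsf{in}\,m\to m\{v/x\}$; $\pi_i(v_1,v_2)\to v_i$; $(Closure\,\overline w\,f)(v)\to m_f\{\overline w/\overline z\}\{v/x\}$ if the function map of the location where the step takes place binds $f$ to $\overline z.\lambda x.m_f$; $\mathsf{case}\,c_i\,\overline v\,\mathsf{of}\,\overline{c\,\overline x\to m}\to m_i\{\overline v/\overline x\}$. - Communication: $\langle e_1[\mathsf{do}\,send\,v\,\mathsf{in}\,m_1]\mid e_2[\mathsf{do}\,x\leftarrow receive\,\mathsf{in}\,m_2]\rangle\to\langle e_1[m_1]\mid e_2[m_2\{v/x\}]\rangle$ and $\langle e_1[\mathsf{do}\,x\leftarrow receive\,\mathsf{in}\,m_1]\mid e_2[\mathsf{do}\,send\,v\,\mathsf{in}\,m_2]\rangle\to\langle e_1[m_1\{v/x\}]\mid e_2[m_2]\rangle$. Trampoline function, present at each location: $loop\,()$ has body $\mathsf{do}\,x\leftarrow receive\,\mathsf{in}\,\mathsf{case}\,x\,\mathsf{of}\,\{Apply\,f\,arg\to\mathsf{do}\,z\leftarrow f(arg)\,\mathsf{in}\,\mathsf{do}\,send\,(Ret\,z)\,\mathsf{in}\,loop\,();\ Ret\,y\to\mathsf{unit}\,y\}$; $loop\,()$ is treated specially and may be unfolded immediately (is identified with its body). **C. Compilation.** Locations: $[\![l]\!]=x_l$ (a term variable associated with $l$), $[\![\mathbf c]\!]=Client$, $[\![\mathbf s]\!]=Server$. Function maps: $[\![\{\overline{F_{name}:Ty=Code}\}]\!]_a=\{\overline{F_{name}=[\![Code]\!]_a}\}$;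 $[\![\overline l\,\overline\alpha.\overline z.OpenCode]\!]_a=\overline{x_l}\,\overline z.[\![OpenCode]\!]_a$; $[\![\lambda x.M]\!]_a=\lambda x.[\![M]\!]_a$; $[\![\Lambda l.V]\!]_a=\lambda x_l.[\![V]\!]_a$. Terms and values: - $[\![x]\!]_a=x$; $[\![(V,W)]\!]_a=([\![V]\!]_a,[\![W]\!]_a)$; $[\![\pi_i(V)]\!]_a=\pi_i([\![V]\!]_a)$; $[\![clo(\overline W,F_{name}[\overline{Loc}\,\overline A])]\!]_a=Closure\,(\overline{[\![Loc]\!]}\,\overline{[\![W]\!]_a})\,F_{name}$. - $[\![\Lambda\alpha.\mathsf{unit}\,V]\!]_a=[\![V]\!]_a$; $[\![V[A]]\!]_a=\mathsf{unit}\,[\![V]\!]_a$; $[\![\mathsf{unit}\,V]\!]_a=\mathsf{unit}\,[\![V]\!]_a$. - $[\![\mathsf{do}\,x\leftarrow M\,\mathsf{in}\,N]\!]_a=\mathsf{do}\,x\leftarrow[\![M]\!]_a\,\mathsf{in}\,[\![N]\!]_a$; $[\![\mathsf{let}\,x=M\,\mathsf{in}\,N]\!]_a=\mathsf{let}\,x=[\![M]\!]_a\,\mathsf{in}\,[\![N]\!]_a$. - $[\![\mathsf{req}(V,W)]\!]_a=[\![\mathsf{call}(V,W)]\!]_a=\mathsf{do}\,send\,(Apply\,[\![V]\!]_a\,[\![W]\!]_a)\,\mathsf{in}\,loop\,()$. - $[\![\mathsf{gen}(Loc,V,W)]\!]_{\mathbf c}=\mathsf{case}\,[\![Loc]\!]\,\mathsf{of}\,\{Client\to[\![V(W)]\!]_{\mathbf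 c};\,Server\to[\![\mathsf{req}(V,W)]\!]_{\mathbf c}\}$; $[\![\mathsf{gen}(Loc,V,W)]\!]_{\mathbf s}=\mathsf{case}\,[\![Loc]\!]\,\mathsf{of}\,\{Client\to[\![\mathsf{call}(V,W)]\!]_{\mathbf s};\,Server\to[\![V(W)]\!]_{\mathbf s}\}$. - $[\![V(W)]\!]_a=[\![V]\!]_a([\![W]\!]_a)$; $[\![V[Loc]]\!]_a=[\![V]\!]_a([\![Loc]\!])$.
   Formalization: The untyped calculus is extended so that a two-branch case {Client → m; Server → n} over a value counts as a value; otherwise the translation of the value gen(Loc,V,W) is no value, and e.g. the translation of F(gen(c,G,H)) with F = λx.x would be ill-formed and stuck. *)

(* Defs.v *)
From Stdlib Require Import List Relations Permutation.
Import ListNotations.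

(* All binders are de Bruijn indices.  The polymorphic calculus has three
   separate index spaces (term, type and location variables); the untyped
   calculus has one.  A block of binders y_0 ... y_(k-1) bound at once is
   numbered from the left: y_i has index i. *)

Definition scons {X : Type} (x : X) (s : nat -> X) (n : nat) : X :=
  match n with 0 => x | S m => s m end.

(* Index i goes to the i-th element of xs, the remaining indices to s. *)
Definition sapp {X : Type} (xs : list X) (s : nat -> X) : nat -> X :=
  fold_right scons s xs.

Definition up_ren (r : nat -> nat) : nat -> nat := scons 0 (fun n => S (r n)).

Inductive location := client | server.

Inductive side := pr1 | pr2.

Definition fname := nat.

Module Poly.

Inductive loc :=
| LConst (a : location)
| LVar (l : nat).

Coercion LConst : location >-> loc.

Inductive ty :=
| TBase
| TArr (A : ty) (l : loc) (B : ty)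
| TClo (A : ty)
| TProd (A B : ty)
| TVar (n : nat)
| TAll (A : ty)
| TLAll (A : ty)
| TMon (A : ty).

(* F_name[Locs As] *)
Inductive cname := CName (f : fname) (Ls : list loc) (As : list ty).

Inductive val :=
| Var (n : nat)
| Pair (V W : val)
| Clo (Ws : list val) (F : cname)
| TLam (V : val)
| Unit (V : val)
| Do (M N : tm)
| Req (V W : val)
| Call (V W : val)
| Gen (l : loc) (V W : val)
with tm :=
| Val (V : val)
| Let (M N : tm)
| Proj (i : side) (V : val)
| App (V W : val)
| TApp (V : val) (A : ty)
| LApp (V : val) (l : loc).

Coercion Val : val >-> tm.

Inductive opencode :=
| Lam (M : tm)
| LLam (V : val).

(* ls alphas. zs. OpenCode; only the lengths of the binder blocks matter.  In
   [Lam M] the parameter x is term index 0 and z_i is term index 1 + i; in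
   [LLam V] the bound l is location index 0 and the j-th outer location
   variable is location index 1 + j. *)
Record code := Code {
  code_locs : nat;
  code_tys : nat;
  code_env : nat;
  code_body : opencode }.

(* ls alphas. Bs. A *)
Record codety := CodeTy {
  cty_locs : nat;
  cty_tys : nat;
  cty_env : list ty;
  cty_res : ty }.

Record binding := Bind {
  b_name : fname;
  b_ty : codety;
  b_code : code }.

Definition funmap := list binding.

Definition ren_loc (rl : nat -> nat) (l : loc) : loc :=
  match l with LConst a => LConst a | LVar n => LVar (rl n) end.

Definition subst_loc (sl : nat -> loc) (l : loc) : loc :=
  match l with LConst a => LConst a | LVar n => sl n end.

Fixpoint ren_ty (rl rt : nat -> nat) (A : ty) : ty :=
  match A with
  | TBase => TBase
  | TArr A l B => TArr (ren_ty rl rt A) (ren_loc rl l) (ren_ty rl rt B)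
  | TClo A => TClo (ren_ty rl rt A)
  | TProd A B => TProd (ren_ty rl rt A) (ren_ty rl rt B)
  | TVar n => TVar (rt n)
  | TAll A => TAll (ren_ty rl (up_ren rt) A)
  | TLAll A => TLAll (ren_ty (up_ren rl) rt A)
  | TMon A => TMon (ren_ty rl rt A)
  end.

Definition up_loc (sl : nat -> loc) : nat -> loc :=
  scons (LVar 0) (fun n => ren_loc S (sl n)).

Definition up_ty (st : nat -> ty) : nat -> ty :=
  scons (TVar 0) (fun n => ren_ty (fun l => l) S (st n)).

Definition shift_loc_ty (A : ty) : ty := ren_ty S (fun n => n) A.

Fixpoint subst_ty (sl : nat -> loc) (st : nat -> ty) (A : ty) : ty :=
  match A with
  | TBase => TBase
  | TArr A l B => TArr (subst_ty sl st A) (subst_loc sl l) (subst_ty sl st B)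
  | TClo A => TClo (subst_ty sl st A)
  | TProd A B => TProd (subst_ty sl st A) (subst_ty sl st B)
  | TVar n => st n
  | TAll A => TAll (subst_ty sl (up_ty st) A)
  | TLAll A => TLAll (subst_ty (up_loc sl) (fun n => shift_loc_ty (st n)) A)
  | TMon A => TMon (subst_ty sl st A)
  end.

Definition ren_cname (rl rt : nat -> nat) (F : cname) : cname :=
  match F with
  | CName f Ls As => CName f (map (ren_loc rl) Ls) (map (ren_ty rl rt) As)
  end.

Definition subst_cname (sl : nat -> loc) (st : nat -> ty) (F : cname) : cname :=
  match F with
  | CName f Ls As => CName f (map (subst_loc sl) Ls) (map (subst_ty sl st) As)
  end.

Fixpoint ren_val (rl rt r : nat -> nat) (V : val) : val :=
  match V with
  | Var n => Var (r n)
  | Pair V W => Pair (ren_val rl rt r V) (ren_val rl rt r W)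
  | Clo Ws F => Clo (map (ren_val rl rt r) Ws) (ren_cname rl rt F)
  | TLam V => TLam (ren_val rl (up_ren rt) r V)
  | Unit V => Unit (ren_val rl rt r V)
  | Do M N => Do (ren_tm rl rt r M) (ren_tm rl rt (up_ren r) N)
  | Req V W => Req (ren_val rl rt r V) (ren_val rl rt r W)
  | Call V W => Call (ren_val rl rt r V) (ren_val rl rt r W)
  | Gen l V W => Gen (ren_loc rl l) (ren_val rl rt r V) (ren_val rl rt r W)
  end
with ren_tm (rl rt r : nat -> nat) (M : tm) : tm :=
  match M with
  | Val V => Val (ren_val rl rt r V)
  | Let M N => Let (ren_tm rl rt r M) (ren_tm rl rt (up_ren r) N)
  | Proj i V => Proj i (ren_val rl rt r V)
  | App V W => App (ren_val rl rt r V) (ren_val rl rt r W)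
  | TApp V A => TApp (ren_val rl rt r V) (ren_ty rl rt A)
  | LApp V l => LApp (ren_val rl rt r V) (ren_loc rl l)
  end.

Definition up_tm (s : nat -> val) : nat -> val :=
  scons (Var 0) (fun n => ren_val (fun l => l) (fun a => a) S (s n)).

Definition shift_ty_val (V : val) : val :=
  ren_val (fun l => l) S (fun x => x) V.

Fixpoint subst_val (sl : nat -> loc) (st : nat -> ty) (s : nat -> val)
    (V : val) : val :=
  match V with
  | Var n => s n
  | Pair V W => Pair (subst_val sl st s V) (subst_val sl st s W)
  | Clo Ws F => Clo (map (subst_val sl st s) Ws) (subst_cname sl st F)
  | TLam V => TLam (subst_val sl (up_ty st) (fun n => shift_ty_val (s n)) V)
  | Unit V => Unit (subst_val sl st s V)
  | Do M N => Do (subst_tm sl st s M) (subst_tm sl st (up_tm s) N)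
  | Req V W => Req (subst_val sl st s V) (subst_val sl st s W)
  | Call V W => Call (subst_val sl st s V) (subst_val sl st s W)
  | Gen l V W =>
      Gen (subst_loc sl l) (subst_val sl st s V) (subst_val sl st s W)
  end
with subst_tm (sl : nat -> loc) (st : nat -> ty) (s : nat -> val)
    (M : tm) : tm :=
  match M with
  | Val V => Val (subst_val sl st s V)
  | Let M N => Let (subst_tm sl st s M) (subst_tm sl st (up_tm s) N)
  | Proj i V => Proj i (subst_val sl st s V)
  | App V W => App (subst_val sl st s V) (subst_val sl st s W)
  | TApp V A => TApp (subst_val sl st s V) (subst_ty sl st A)
  | LApp V l => LApp (subst_val sl st s V) (subst_loc sl l)
  end.

Definition subst_opencode (sl : nat -> loc) (st : nat -> ty)
    (c : opencode) : opencode :=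
  match c with
  | Lam M => Lam (subst_tm sl st Var M)
  | LLam V =>
      LLam (subst_val (up_loc sl) (fun n => shift_loc_ty (st n)) Var V)
  end.

Fixpoint relocatable (A : ty) : Prop :=
  match A with
  | TVar _ | TBase | TClo _ | TAll _ => True
  | TProd A1 A2 => relocatable A1 /\ relocatable A2
  | TArr _ _ _ | TLAll _ | TMon _ => False
  end.

(* Gamma, with its location and type variables given by their number. *)
Record ctx := Ctx {
  ctx_locs : nat;
  ctx_tys : nat;
  ctx_vars : list ty }.

Definition empty_ctx : ctx := Ctx 0 0 [].

Definition add_var (A : ty) (G : ctx) : ctx :=
  Ctx (ctx_locs G) (ctx_tys G) (A :: ctx_vars G).

Definition add_ty (G : ctx) : ctx :=
  Ctx (ctx_locs G) (S (ctx_tys G)) (map (ren_ty (fun l => l) S) (ctx_vars G)).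

Definition add_loc (G : ctx) : ctx :=
  Ctx (S (ctx_locs G)) (ctx_tys G) (map shift_loc_ty (ctx_vars G)).

Definition wf_loc (nl : nat) (l : loc) : Prop :=
  match l with LConst _ => True | LVar n => n < nl end.

Fixpoint wf_ty (nl nt : nat) (A : ty) : Prop :=
  match A with
  | TBase => True
  | TArr A l B => wf_ty nl nt A /\ wf_loc nl l /\ wf_ty nl nt B
  | TClo A | TMon A => wf_ty nl nt A
  | TProd A B => wf_ty nl nt A /\ wf_ty nl nt B
  | TVar n => n < nt
  | TAll A => wf_ty nl (S nt) A
  | TLAll A => wf_ty (S nl) nt A
  end.

Definition wf_codety (T : codety) : Prop :=
  Forall (wf_ty (cty_locs T) (cty_tys T)) (cty_env T) /\
  wf_ty (cty_locs T) (cty_tys T) (cty_res T).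

(* The three maps Phi_c°, Phi_s° and Phi_common. *)
Record split := Split {
  own_client : funmap;
  own_server : funmap;
  common : funmap }.

Definition map_at (P : split) (l : loc) : funmap :=
  match l with
  | LConst client => own_client P
  | LConst server => own_server P
  | LVar _ => common P
  end.

(* [wf_loc], [wf_ty] and [wf_codety] premises express that the context of a
   judgement declares all free type and location variables of its subject.
   [code_typing P F Bs A] is the judgement |- F : Bs.A, and [typings] relates
   two lists pointwise. *)
Inductive typing (P : split) : ctx -> loc -> tm -> ty -> Prop :=
| ty_var G l n A :
    nth_error (ctx_vars G) n = Some A ->
    typing P G l (Var n) A
| ty_let G l M N A B :
    typing P G l M A ->
    typing P (add_var A G) l N B ->
    typing P G l (Let M N) B
| ty_clo G l Ws f Ls As Bs A :
    Forall (wf_loc (ctx_locs G)) Ls ->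
    Forall (wf_ty (ctx_locs G) (ctx_tys G)) As ->
    code_typing P (CName f Ls As) Bs A ->
    typings P G l Ws Bs ->
    typing P G l (Clo Ws (CName f Ls As)) (TClo A)
| ty_proj1 G l V A1 A2 :
    typing P G l (Val V) (TProd A1 A2) ->
    typing P G l (Proj pr1 V) A1
| ty_proj2 G l V A1 A2 :
    typing P G l (Val V) (TProd A1 A2) ->
    typing P G l (Proj pr2 V) A2
| ty_pair G l V W A B :
    typing P G l (Val V) A ->
    typing P G l (Val W) B ->
    typing P G l (Pair V W) (TProd A B)
| ty_tabs G l V A :
    (forall l0, wf_loc (ctx_locs G) l0 -> typing P (add_ty G) l0 (Val V) A) ->
    typing P G l (TLam V) (TAll A)
| ty_tapp G l V A B :
    typing P G l (Val V) (TAll A) ->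
    wf_ty (ctx_locs G) (ctx_tys G) B ->
    relocatable B ->
    typing P G l (TApp V B) (subst_ty LVar (scons B TVar) A)
| ty_lapp G l V A l' :
    typing P G l (Val V) (TClo (TLAll A)) ->
    wf_loc (ctx_locs G) l' ->
    typing P G l (LApp V l') (subst_ty (scons l' LVar) TVar A)
| ty_unit G l V A :
    typing P G l (Val V) A ->
    relocatable A ->
    typing P G l (Unit V) (TMon A)
| ty_bind G l M N A B :
    typing P G l M (TMon A) ->
    typing P (add_var A G) l N (TMon B) ->
    typing P G l (Do M N) (TMon B)
| ty_app G l V W A B :
    typing P G l (Val V) (TClo (TArr A l B)) ->
    typing P G l (Val W) A ->
    typing P G l (App V W) B
| ty_gen G l l' V W A B :
    wf_loc (ctx_locs G) l' ->
    typing P G l (Val V) (TClo (TArr A l' (TMon B))) ->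
    typing P G l (Val W) A ->
    relocatable A ->
    typing P G l (Gen l' V W) (TMon B)
| ty_req G V W A B :
    typing P G client (Val V) (TClo (TArr A server (TMon B))) ->
    typing P G client (Val W) A ->
    relocatable A ->
    typing P G client (Req V W) (TMon B)
| ty_call G V W A B :
    typing P G server (Val V) (TClo (TArr A client (TMon B))) ->
    typing P G server (Val W) A ->
    relocatable A ->
    typing P G server (Call V W) (TMon B)
with typings (P : split) : ctx -> loc -> list val -> list ty -> Prop :=
| tys_nil G l :
    typings P G l [] []
| tys_cons G l W Ws B Bs :
    typing P G l (Val W) B ->
    typings P G l Ws Bs ->
    typings P G l (W :: Ws) (B :: Bs)
with code_typing (P : split) : cname -> list ty -> ty -> Prop :=
| ty_fabs f nl nt Bs D l' C M Ls As :
    In (Bind f (CodeTy nl nt Bs (TArr D l' C))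
               (Code nl nt (length Bs) (Lam M))) (map_at P l') ->
    wf_codety (CodeTy nl nt Bs (TArr D l' C)) ->
    typing P (add_var D (Ctx nl nt Bs)) l' M C ->
    length Ls = nl ->
    length As = nt ->
    Forall relocatable As ->
    Forall relocatable Bs ->
    code_typing P (CName f Ls As)
      (map (subst_ty (sapp Ls LVar) (sapp As TVar)) Bs)
      (subst_ty (sapp Ls LVar) (sapp As TVar) (TArr D l' C))
| ty_flabs f nl nt Bs D V Ls As :
    In (Bind f (CodeTy nl nt Bs (TLAll D))
               (Code nl nt (length Bs) (LLam V))) (common P) ->
    wf_codety (CodeTy nl nt Bs (TLAll D)) ->
    (forall l0, wf_loc (S nl) l0 ->
       typing P (add_loc (Ctx nl nt Bs)) l0 (Val V) D) ->
    length Ls = nl ->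
    length As = nt ->
    Forall relocatable As ->
    Forall relocatable Bs ->
    code_typing P (CName f Ls As)
      (map (subst_ty (sapp Ls LVar) (sapp As TVar)) Bs)
      (subst_ty (sapp Ls LVar) (sapp As TVar) (TLAll D)).

Inductive wf_binding (P : split) : binding -> Prop :=
| wf_bind_abs f nl nt Bs A1 l A2 M :
    wf_codety (CodeTy nl nt Bs (TArr A1 l A2)) ->
    typing P (add_var A1 (Ctx nl nt Bs)) l M A2 ->
    In (Bind f (CodeTy nl nt Bs (TArr A1 l A2))
               (Code nl nt (length Bs) (Lam M))) (map_at P l) ->
    wf_binding P (Bind f (CodeTy nl nt Bs (TArr A1 l A2))
                         (Code nl nt (length Bs) (Lam M)))
| wf_bind_labs f nl nt Bs A1 V :
    wf_codety (CodeTy nl nt Bs (TLAll A1)) ->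
    (forall l, wf_loc (S nl) l ->
       typing P (add_loc (Ctx nl nt Bs)) l (Val V) A1) ->
    In (Bind f (CodeTy nl nt Bs (TLAll A1))
               (Code nl nt (length Bs) (LLam V))) (common P) ->
    wf_binding P (Bind f (CodeTy nl nt Bs (TLAll A1))
                         (Code nl nt (length Bs) (LLam V))).

Record program := Program {
  phi_client : funmap;
  phi_server : funmap }.

Definition phi (Phi : program) (a : location) : funmap :=
  match a with client => phi_client Phi | server => phi_server Phi end.

(* The split P witnesses that the program Phi is well-formed. *)
Record well_formed (P : split) (Phi : program) : Prop := {
  wf_distinct :
    NoDup (map b_name (own_client P ++ own_server P ++ common P));
  wf_client : Permutation (phi_client Phi) (own_client P ++ common P);
  wf_server : Permutation (phi_server Phi) (own_server P ++ common P);
  wf_bindings :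
    forall b, In b (own_client P ++ own_server P ++ common P) ->
      wf_binding P b }.

Inductive elet :=
| EHole
| ELet (e : elet) (M : tm).

Inductive ectx :=
| ELetCtx (e : elet)
| EDo (e : ectx) (M : tm).

Fixpoint plug_let (e : elet) (M : tm) : tm :=
  match e with
  | EHole => M
  | ELet e N => Let (plug_let e M) N
  end.

Fixpoint plug (E : ectx) (M : tm) : tm :=
  match E with
  | ELetCtx e => plug_let e M
  | EDo E N => Do (plug E M) N
  end.

Definition stack := list ectx.

(* [AtClient M Dc Ds] is <M; Dc | Ds> and [AtServer Dc M Ds] is <Dc | M; Ds>. *)
Inductive config :=
| AtClient (M : tm) (Dc Ds : stack)
| AtServer (Dc : stack) (M : tm) (Ds : stack).

(* Phi_a(F) = zs.c, where zs has length nz *)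
Inductive fetch (Phi_a : funmap) : cname -> nat -> opencode -> Prop :=
| fetch_intro f T nl nt nz c Ls As :
    In (Bind f T (Code nl nt nz c)) Phi_a ->
    length Ls = nl ->
    length As = nt ->
    fetch Phi_a (CName f Ls As) nz
      (subst_opencode (sapp Ls LVar) (sapp As TVar) c).

Inductive local_step (Phi_a : funmap) : tm -> tm -> Prop :=
| ls_let V M :
    local_step Phi_a (Let (Val V) M) (subst_tm LVar TVar (scons V Var) M)
| ls_do V M :
    local_step Phi_a (Do (Unit V) M) (subst_tm LVar TVar (scons V Var) M)
| ls_proj1 V1 V2 :
    local_step Phi_a (Proj pr1 (Pair V1 V2)) V1
| ls_proj2 V1 V2 :
    local_step Phi_a (Proj pr2 (Pair V1 V2)) V2
| ls_tapp V A :
    local_step Phi_a (TApp (TLam V) A) (subst_val LVar (scons A TVar) Var V)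
| ls_app Ws F V M :
    fetch Phi_a F (length Ws) (Lam M) ->
    local_step Phi_a (App (Clo Ws F) V)
      (subst_tm LVar TVar (scons V (sapp Ws Var)) M)
| ls_lapp Ws F (b : location) V :
    fetch Phi_a F (length Ws) (LLam V) ->
    local_step Phi_a (LApp (Clo Ws F) b)
      (subst_val (scons (LConst b) LVar) TVar (sapp Ws Var) V).

Inductive step (Phi : program) : config -> config -> Prop :=
| st_local_client E M M' Dc Ds :
    local_step (phi_client Phi) M M' ->
    step Phi (AtClient (plug E M) Dc Ds) (AtClient (plug E M') Dc Ds)
| st_local_server E M M' Dc Ds :
    local_step (phi_server Phi) M M' ->
    step Phi (AtServer Dc (plug E M) Ds) (AtServer Dc (plug E M') Ds)
| st_req E V W Dc Ds :
    step Phi (AtClient (plug E (Req V W)) Dc Ds)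
             (AtServer (E :: Dc) (App V W) Ds)
| st_call E V W Dc Ds :
    step Phi (AtServer Dc (plug E (Call V W)) Ds)
             (AtClient (App V W) Dc (E :: Ds))
| st_unit_client V E Dc Ds :
    step Phi (AtClient (Unit V) Dc (E :: Ds))
             (AtServer Dc (plug E (Unit V)) Ds)
| st_unit_server V E Dc Ds :
    step Phi (AtServer (E :: Dc) (Unit V) Ds)
             (AtClient (plug E (Unit V)) Dc Ds)
| st_unit_end V :
    step Phi (AtServer [] (Unit V) []) (AtClient (Unit V) [] [])
| st_gen_client_client E V W Dc Ds :
    step Phi (AtClient (plug E (Gen client V W)) Dc Ds)
             (AtClient (plug E (App V W)) Dc Ds)
| st_gen_client_server E V W Dc Ds :
    step Phi (AtClient (plug E (Gen server V W)) Dc Ds)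
             (AtClient (plug E (Req V W)) Dc Ds)
| st_gen_server_client E V W Dc Ds :
    step Phi (AtServer Dc (plug E (Gen client V W)) Ds)
             (AtServer Dc (plug E (Call V W)) Ds)
| st_gen_server_server E V W Dc Ds :
    step Phi (AtServer Dc (plug E (Gen server V W)) Ds)
             (AtServer Dc (plug E (App V W)) Ds).

Definition steps (Phi : program) : config -> config -> Prop :=
  clos_refl_trans config (step Phi).

(* Every type abstraction has the form /\alpha. unit V'. *)
Fixpoint tabs_unit_val (V : val) : Prop :=
  match V with
  | Var _ => True
  | Pair V W | Req V W | Call V W | Gen _ V W =>
      tabs_unit_val V /\ tabs_unit_val W
  | Clo Ws _ => fold_right (fun W Q => tabs_unit_val W /\ Q) True Ws
  | TLam V => match V with Unit V' => tabs_unit_val V' | _ => False end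
  | Unit V => tabs_unit_val V
  | Do M N => tabs_unit_tm M /\ tabs_unit_tm N
  end
with tabs_unit_tm (M : tm) : Prop :=
  match M with
  | Val V => tabs_unit_val V
  | Let M N => tabs_unit_tm M /\ tabs_unit_tm N
  | Proj _ V | TApp V _ | LApp V _ => tabs_unit_val V
  | App V W => tabs_unit_val V /\ tabs_unit_val W
  end.

Definition tabs_unit_binding (b : binding) : Prop :=
  match code_body (b_code b) with
  | Lam M => tabs_unit_tm M
  | LLam V => tabs_unit_val V
  end.

Definition tabs_unit_program (Phi : program) : Prop :=
  Forall tabs_unit_binding (phi_client Phi) /\
  Forall tabs_unit_binding (phi_server Phi).

End Poly.

Module Untyped.

(* [Closure f] applied to ws is the value Closure ws f. *)
Inductive con :=
| Client
| Server
| Closure (f : fname)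
| Apply
| Ret
| OtherCon (k : nat).

Inductive prim := send | receive.

(* One syntactic sort for values and terms; [value] below singles out the
   values.  An alternative (c, k, m) of a case binds k variables in m. *)
Inductive tm :=
| Var (n : nat)
| Pair (v w : tm)
| Con (c : con) (vs : list tm)
| Unit (v : tm)
| Do (m n : tm)
| Let (m n : tm)
| Proj (i : side) (v : tm)
| App (v w : tm)
| Prim (p : prim) (vs : list tm)
| Case (v : tm) (alts : list (con * nat * tm))
| Loop.  (* loop () *)

Fixpoint up_ren_n (k : nat) (r : nat -> nat) : nat -> nat :=
  match k with 0 => r | S k => up_ren (up_ren_n k r) end.

Fixpoint ren (r : nat -> nat) (m : tm) : tm :=
  match m with
  | Var n => Var (r n)
  | Pair v w => Pair (ren r v) (ren r w)
  | Con c vs => Con c (map (ren r) vs)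
  | Unit v => Unit (ren r v)
  | Do m n => Do (ren r m) (ren (up_ren r) n)
  | Let m n => Let (ren r m) (ren (up_ren r) n)
  | Proj i v => Proj i (ren r v)
  | App v w => App (ren r v) (ren r w)
  | Prim p vs => Prim p (map (ren r) vs)
  | Case v alts =>
      Case (ren r v)
        (map (fun '(c, k, m) => (c, k, ren (up_ren_n k r) m)) alts)
  | Loop => Loop
  end.

Definition up (s : nat -> tm) : nat -> tm :=
  scons (Var 0) (fun n => ren S (s n)).

Fixpoint up_n (k : nat) (s : nat -> tm) : nat -> tm :=
  match k with 0 => s | S k => up (up_n k s) end.

Fixpoint subst (s : nat -> tm) (m : tm) : tm :=
  match m with
  | Var n => s n
  | Pair v w => Pair (subst s v) (subst s w)
  | Con c vs => Con c (map (subst s) vs)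
  | Unit v => Unit (subst s v)
  | Do m n => Do (subst s m) (subst (up s) n)
  | Let m n => Let (subst s m) (subst (up s) n)
  | Proj i v => Proj i (subst s v)
  | App v w => App (subst s v) (subst s w)
  | Prim p vs => Prim p (map (subst s) vs)
  | Case v alts =>
      Case (subst s v)
        (map (fun '(c, k, m) => (c, k, subst (up_n k s) m)) alts)
  | Loop => Loop
  end.

(* The translation of gen is a case over a location that stands for a value
   and occurs where the grammar requires one (in pairs, as an argument, bound
   by a let).  Hence [value_loc_case]; no other case is a value. *)
Inductive value : tm -> Prop :=
| value_var n : value (Var n)
| value_pair v w : value v -> value w -> value (Pair v w)
| value_con c vs : Forall value vs -> value (Con c vs)
| value_unit v : value v -> value (Unit v)
| value_do m n : value (Do m n)
| value_loc_case v m n :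
    value v -> value (Case v [(Client, 0, m); (Server, 0, n)]).

Definition do_send (v m : tm) : tm := Do (Prim send [v]) (ren S m).

Definition do_receive (m : tm) : tm := Do (Prim receive []) m.

(* do x <- receive in case x of
     { Apply f arg -> do z <- f(arg) in do send (Ret z) in loop ();
       Ret y -> unit y } *)
Definition loop_body : tm :=
  do_receive
    (Case (Var 0)
       [(Apply, 2, Do (App (Var 0) (Var 1)) (do_send (Con Ret [Var 0]) Loop));
        (Ret, 1, Unit (Var 0))]).

(* The identification of loop () with its body, at any position: the two
   closed terms are substituted for the same variable of an arbitrary m. *)
Inductive unfold_loop : tm -> tm -> Prop :=
| unfold_loop_intro m :
    unfold_loop (subst (scons Loop Var) m) (subst (scons loop_body Var) m).

Definition loop_eq : tm -> tm -> Prop := clos_refl_sym_trans tm unfold_loop.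

(* z_1 ... z_k . \x. m, with x at index 0 and z_i at index i *)
Record code := Code {
  code_env : nat;
  code_body : tm }.

Definition funmap := list (fname * code).

Record program := Program {
  phi_client : funmap;
  phi_server : funmap }.

Inductive local_step (phi_a : funmap) : tm -> tm -> Prop :=
| ls_let v m :
    value v ->
    local_step phi_a (Let v m) (subst (scons v Var) m)
| ls_do v m :
    value v ->
    local_step phi_a (Do (Unit v) m) (subst (scons v Var) m)
| ls_proj1 v1 v2 :
    value v1 -> value v2 ->
    local_step phi_a (Proj pr1 (Pair v1 v2)) v1
| ls_proj2 v1 v2 :
    value v1 -> value v2 ->
    local_step phi_a (Proj pr2 (Pair v1 v2)) v2
| ls_app ws f v m :
    Forall value ws -> value v ->
    In (f, Code (length ws) m) phi_a ->
    local_step phi_a (App (Con (Closure f) ws) v)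
      (subst (scons v (sapp ws Var)) m)
| ls_case c vs alts m :
    Forall value vs ->
    In (c, length vs, m) alts ->
    local_step phi_a (Case (Con c vs) alts) (subst (sapp vs Var) m).

Inductive elet :=
| EHole
| ELet (e : elet) (m : tm).

Inductive ectx :=
| ELetCtx (e : elet)
| EDo (e : ectx) (m : tm).

Fixpoint plug_let (e : elet) (m : tm) : tm :=
  match e with
  | EHole => m
  | ELet e n => Let (plug_let e m) n
  end.

Fixpoint plug (e : ectx) (m : tm) : tm :=
  match e with
  | ELetCtx e => plug_let e m
  | EDo e n => Do (plug e m) n
  end.

(* <m_c | m_s> *)
Record config := Config {
  at_client : tm;
  at_server : tm }.

Inductive raw_step (phi : program) : config -> config -> Prop :=
| st_local_client e1 e2 n m m' :
    local_step (phi_client phi) m m' ->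
    raw_step phi (Config (plug e1 m) (plug e2 (do_receive n)))
                 (Config (plug e1 m') (plug e2 (do_receive n)))
| st_local_server e1 e2 n m m' :
    local_step (phi_server phi) m m' ->
    raw_step phi (Config (plug e1 (do_receive n)) (plug e2 m))
                 (Config (plug e1 (do_receive n)) (plug e2 m'))
| st_to_server e1 e2 v m1 m2 :
    value v ->
    raw_step phi (Config (plug e1 (do_send v m1)) (plug e2 (do_receive m2)))
                 (Config (plug e1 m1) (plug e2 (subst (scons v Var) m2)))
| st_to_client e1 e2 v m1 m2 :
    value v ->
    raw_step phi (Config (plug e1 (do_receive m1)) (plug e2 (do_send v m2)))
                 (Config (plug e1 (subst (scons v Var) m1)) (plug e2 m2)).

Definition config_eq (k k' : config) : Prop :=
  loop_eq (at_client k) (at_client k') /\ loop_eq (at_server k) (at_server k').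

Definition step (phi : program) (k k' : config) : Prop :=
  exists k0 k0', config_eq k k0 /\ raw_step phi k0 k0' /\ config_eq k0' k'.

Definition steps (phi : program) : config -> config -> Prop :=
  clos_refl_trans config (step phi).

End Untyped.

(* Compilation.  [rl] gives the target index of the term variable x_l of each
   location variable l, [r] that of each term variable. *)
Definition comp_loc (rl : nat -> nat) (l : Poly.loc) : Untyped.tm :=
  match l with
  | Poly.LConst client => Untyped.Con Untyped.Client []
  | Poly.LConst server => Untyped.Con Untyped.Server []
  | Poly.LVar n => Untyped.Var (rl n)
  end.

Definition comp_remote (v w : Untyped.tm) : Untyped.tm :=
  Untyped.do_send (Untyped.Con Untyped.Apply [v; w]) Untyped.Loop.

Definition comp_gen (a : location) (l v w : Untyped.tm) : Untyped.tm :=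
  match a with
  | client =>
      Untyped.Case l [(Untyped.Client, 0, Untyped.App v w);
                      (Untyped.Server, 0, comp_remote v w)]
  | server =>
      Untyped.Case l [(Untyped.Client, 0, comp_remote v w);
                      (Untyped.Server, 0, Untyped.App v w)]
  end.

(* Compilation is meant only for [TLam V] with V of the form [Unit V']; the
   default branch makes the function total. *)
Fixpoint comp_val (a : location) (rl r : nat -> nat) (V : Poly.val)
    : Untyped.tm :=
  match V with
  | Poly.Var n => Untyped.Var (r n)
  | Poly.Pair V W => Untyped.Pair (comp_val a rl r V) (comp_val a rl r W)
  | Poly.Clo Ws (Poly.CName f Ls _) =>
      Untyped.Con (Untyped.Closure f)
        (map (comp_loc rl) Ls ++ map (comp_val a rl r) Ws)
  | Poly.TLam V =>
      match V with
      | Poly.Unit V' => comp_val a rl r V'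
      | _ => comp_val a rl r V
      end
  | Poly.Unit V => Untyped.Unit (comp_val a rl r V)
  | Poly.Do M N =>
      Untyped.Do (comp_tm a rl r M)
                 (comp_tm a (fun l => S (rl l)) (up_ren r) N)
  | Poly.Req V W | Poly.Call V W =>
      comp_remote (comp_val a rl r V) (comp_val a rl r W)
  | Poly.Gen l V W =>
      comp_gen a (comp_loc rl l) (comp_val a rl r V) (comp_val a rl r W)
  end
with comp_tm (a : location) (rl r : nat -> nat) (M : Poly.tm) : Untyped.tm :=
  match M with
  | Poly.Val V => comp_val a rl r V
  | Poly.Let M N =>
      Untyped.Let (comp_tm a rl r M)
                  (comp_tm a (fun l => S (rl l)) (up_ren r) N)
  | Poly.Proj i V => Untyped.Proj i (comp_val a rl r V)
  | Poly.App V W => Untyped.App (comp_val a rl r V) (comp_val a rl r W)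
  | Poly.TApp V _ => Untyped.Unit (comp_val a rl r V)
  | Poly.LApp V l => Untyped.App (comp_val a rl r V) (comp_loc rl l)
  end.

(* The nl variables x_l precede the z's in the environment of the compiled
   code, and index 0 is the parameter (x, or x_l for a location abstraction). *)
Definition comp_code (a : location) (c : Poly.code) : Untyped.code :=
  let nl := Poly.code_locs c in
  Untyped.Code (nl + Poly.code_env c)
    match Poly.code_body c with
    | Poly.Lam M => comp_tm a S (scons 0 (fun i => S (nl + i))) M
    | Poly.LLam V => comp_val a (fun l => l) (fun i => S (nl + i)) V
    end.

Definition comp_funmap (a : location) (Phi : Poly.funmap) : Untyped.funmap :=
  map (fun b => (Poly.b_name b, comp_code a (Poly.b_code b))) Phi.

Definition comp_program (Phi : Poly.program) : Untyped.program :=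
  Untyped.Program (comp_funmap client (Poly.phi_client Phi))
                  (comp_funmap server (Poly.phi_server Phi)).

(* Used on terms without free variables, where the index maps are irrelevant. *)
Definition comp_closed (a : location) (M : Poly.tm) : Untyped.tm :=
  comp_tm a (fun l => l) (fun x => x) M.

(* Main.v *)
(* The stacks of a configuration are stored in the untyped threads: a thread
   waiting for a reply is [E[loop ()]], and a call it serves meanwhile runs as
   [E[do z <- [] in do send (Ret z); loop ()]].  Values that are sent have
   relocatable types, so by subject reduction they are typed at both locations
   and compile to the same term at both.

   A step-by-step simulation fails, however: [let x = req(V, W) in N] may send
   the request from below the [let], and a callback would then have to run
   inside [let x = do z <- [] in ...], which is not an evaluation context of the
   untyped calculus.  Since [req(V, W)] is a value, it may instead be
   substituted for [x] and run later, possibly repeatedly or never.  The result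
   is the same because no value of relocatable type contains it.  So a run is
   first turned into a big-step evaluation in which a [let] never runs a
   computation of type [T A], and only this evaluation is simulated. *)

Require Import Defs.
From Stdlib Require Import List Relations Permutation.
From Stdlib Require Import Lia FunctionalExtensionality.
Import ListNotations.

Import Poly.

(** The conversion goes backwards along the run: the final configuration trivially has a delayed
    evaluation, and each step pulls one back from its target to its source. The delicate steps are
    those that change a computation inside a context. If [E[req(V, W)]] has become [E[unit U]], then
    in the evaluation of the source the request itself flows through [E], where [unit U] flows in
    the evaluation of the target. Terms are therefore compared by [expands]: their values agree up
    to replacing computations by others that have at least the same results. An inclusion of results
    is enough, since only the existence of an evaluation has to be preserved.

    That the replacement is invisible rests on typing. Evaluation proper never looks inside a value
    of type [T A], and by the rule for [unit] every result of running one is relocatable, hence free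
    of replaced computations. *)

Lemma sapp_nth {X : Type} (xs : list X) s n x :
  nth_error xs n = Some x -> sapp xs s n = x.
Proof.
  revert n; induction xs as [|y xs IH]; intros [|n] H; simpl in *;
    try discriminate; [congruence | auto].
Qed.

Lemma sapp_add {X : Type} (xs : list X) s n : sapp xs s (length xs + n) = s n.
Proof. induction xs; simpl; auto. Qed.

Lemma sapp_map {X Y : Type} (f : X -> Y) xs s n :
  f (sapp xs s n) = sapp (map f xs) (fun i => f (s i)) n.
Proof. revert n; induction xs; intros [|n]; simpl; auto. Qed.

Lemma sapp_ext {X : Type} (xs : list X) s s' n :
  n < length xs -> sapp xs s n = sapp xs s' n.
Proof.
  revert n; induction xs; intros [|n] H; simpl in *; try lia; auto.
  apply IHxs; lia.
Qed.

Lemma Forall_sapp {X : Type} (Q : X -> Prop) xs s n :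
  Forall Q xs -> (n < length xs \/ Q (s (n - length xs))) -> Q (sapp xs s n).
Proof.
  intros H; revert n; induction H; intros [|n] Hn; simpl in *; auto.
  - destruct Hn; [lia | auto].
  - destruct Hn; [lia | auto].
  - apply IHForall. destruct Hn; [left; lia | auto].
Qed.

Lemma up_ren_id : up_ren (fun n => n) = (fun n => n).
Proof. apply functional_extensionality; intros [|n]; reflexivity. Qed.

Lemma up_ren_comp r r' :
  up_ren (fun n => r (r' n)) = fun n => up_ren r (up_ren r' n).
Proof. apply functional_extensionality; intros [|n]; reflexivity. Qed.

(** * Substitution in types *)

Lemma ren_loc_id l : ren_loc (fun n => n) l = l.
Proof. destruct l; reflexivity. Qed.

Lemma ren_loc_subst rl l : ren_loc rl l = subst_loc (fun n => LVar (rl n)) l.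
Proof. destruct l; reflexivity. Qed.

Lemma subst_loc_id l : subst_loc LVar l = l.
Proof. destruct l; reflexivity. Qed.

Lemma subst_loc_comp sl sl' l :
  subst_loc sl (subst_loc sl' l) = subst_loc (fun n => subst_loc sl (sl' n)) l.
Proof. destruct l; reflexivity. Qed.

Lemma up_loc_LVar rl : up_loc (fun n => LVar (rl n)) = fun n => LVar (up_ren rl n).
Proof. apply functional_extensionality; intros [|n]; reflexivity. Qed.

Lemma up_ty_TVar rt : up_ty (fun n => TVar (rt n)) = fun n => TVar (up_ren rt n).
Proof. apply functional_extensionality; intros [|n]; reflexivity. Qed.

Lemma ren_ty_subst A : forall rl rt,
  ren_ty rl rt A = subst_ty (fun n => LVar (rl n)) (fun n => TVar (rt n)) A.
Proof.
  induction A; intros; simpl; rewrite ?IHA, ?IHA1, ?IHA2, ?ren_loc_subst; auto;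
    rewrite ?up_loc_LVar, ?up_ty_TVar; reflexivity.
Qed.

Lemma ren_ty_comp A : forall rl rt rl' rt',
  ren_ty rl rt (ren_ty rl' rt' A) =
  ren_ty (fun n => rl (rl' n)) (fun n => rt (rt' n)) A.
Proof.
  induction A; intros; simpl; rewrite ?IHA, ?IHA1, ?IHA2; auto.
  - destruct l; reflexivity.
  - rewrite <- up_ren_comp; reflexivity.
  - rewrite <- up_ren_comp; reflexivity.
Qed.

Lemma subst_ren_ty A : forall sl st rl rt,
  subst_ty sl st (ren_ty rl rt A) =
  subst_ty (fun n => sl (rl n)) (fun n => st (rt n)) A.
Proof.
  induction A; intros; simpl; rewrite ?IHA, ?IHA1, ?IHA2; auto; f_equal.
  - destruct l; reflexivity.
  - f_equal. apply functional_extensionality; intros [|n]; reflexivity.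
  - f_equal. apply functional_extensionality; intros [|n]; reflexivity.
Qed.

Lemma ren_subst_ty A : forall rl rt sl st,
  ren_ty rl rt (subst_ty sl st A) =
  subst_ty (fun n => ren_loc rl (sl n)) (fun n => ren_ty rl rt (st n)) A.
Proof.
  induction A; intros; simpl; rewrite ?IHA, ?IHA1, ?IHA2; auto; f_equal.
  - destruct l; reflexivity.
  - f_equal. apply functional_extensionality; intros [|n]; simpl; auto.
    rewrite !ren_ty_comp; reflexivity.
  - f_equal; apply functional_extensionality.
    + intros [|n]; simpl; auto. destruct (sl n); reflexivity.
    + intros n. unfold shift_loc_ty. rewrite !ren_ty_comp; reflexivity.
Qed.

Lemma subst_ty_comp A : forall sl st sl' st',
  subst_ty sl st (subst_ty sl' st' A) =
  subst_ty (fun n => subst_loc sl (sl' n)) (fun n => subst_ty sl st (st' n)) A.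
Proof.
  induction A; intros; simpl; rewrite ?IHA, ?IHA1, ?IHA2; auto; f_equal.
  - apply subst_loc_comp.
  - f_equal. apply functional_extensionality; intros [|n]; simpl; auto.
    rewrite subst_ren_ty, ren_subst_ty; simpl. f_equal.
    apply functional_extensionality; intros; rewrite ren_loc_id; reflexivity.
  - f_equal; apply functional_extensionality.
    + intros [|n]; simpl; auto. destruct (sl' n); reflexivity.
    + intros n. unfold shift_loc_ty. rewrite subst_ren_ty, ren_subst_ty.
      reflexivity.
Qed.

Lemma subst_ty_id A : subst_ty LVar TVar A = A.
Proof.
  change (subst_ty (fun n => LVar n) (fun n => TVar n) A = A).
  rewrite <- (ren_ty_subst A (fun n => n) (fun n => n)).
  induction A; simpl; rewrite ?up_ren_id, ?ren_loc_id; congruence.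
Qed.

Lemma subst_ty_ext A : forall nl nt sl st sl' st',
  wf_ty nl nt A ->
  (forall n, n < nl -> sl n = sl' n) -> (forall n, n < nt -> st n = st' n) ->
  subst_ty sl st A = subst_ty sl' st' A.
Proof.
  induction A; intros * Hwf Hl Ht; simpl in *; auto; f_equal;
    try (eapply IHA || eapply IHA1 || eapply IHA2; eauto; intuition; fail).
  - destruct l; simpl in *; auto. apply Hl; tauto.
  - eapply IHA; eauto. intros [|n] Hn; simpl; auto. rewrite Ht by lia; auto.
  - eapply IHA; eauto.
    + intros [|n] Hn; simpl; auto. rewrite Hl by lia; auto.
    + intros n Hn. rewrite Ht by lia; auto.
Qed.

Lemma subst_ty_up_ren sl st A :
  subst_ty sl (up_ty st) (ren_ty (fun l => l) S A) =
  ren_ty (fun l => l) S (subst_ty sl st A).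
Proof.
  rewrite subst_ren_ty, ren_subst_ty. simpl. f_equal.
  apply functional_extensionality; intros; rewrite ren_loc_id; reflexivity.
Qed.

Lemma subst_ty_inst_ty sl st A B :
  subst_ty sl st (subst_ty LVar (scons B TVar) A) =
  subst_ty LVar (scons (subst_ty sl st B) TVar) (subst_ty sl (up_ty st) A).
Proof.
  rewrite !subst_ty_comp. f_equal; apply functional_extensionality.
  - intros n; rewrite subst_loc_id; reflexivity.
  - intros [|n]; simpl; auto. rewrite subst_ren_ty. simpl.
    symmetry; apply subst_ty_id.
Qed.

Lemma subst_ty_inst_loc sl st A l :
  subst_ty sl st (subst_ty (scons l LVar) TVar A) =
  subst_ty (scons (subst_loc sl l) LVar) TVar
    (subst_ty (up_loc sl) (fun n => shift_loc_ty (st n)) A).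
Proof.
  rewrite !subst_ty_comp. f_equal; apply functional_extensionality.
  - intros [|n]; simpl; auto. destruct (sl n); reflexivity.
  - intros n; simpl. unfold shift_loc_ty. rewrite subst_ren_ty. simpl.
    symmetry; apply subst_ty_id.
Qed.

(** On indices beyond the two blocks the sides differ: the left one applies [sl] and [st] there, the
    right one leaves a variable. Well-formedness of [A] excludes such indices. *)
Lemma subst_ty_code_inst sl st Ls As A :
  wf_ty (length Ls) (length As) A ->
  subst_ty sl st (subst_ty (sapp Ls LVar) (sapp As TVar) A) =
  subst_ty (sapp (map (subst_loc sl) Ls) LVar)
           (sapp (map (subst_ty sl st) As) TVar) A.
Proof.
  intros Hwf. rewrite subst_ty_comp. eapply subst_ty_ext; eauto; intros.
  - rewrite (sapp_map (subst_loc sl)). apply sapp_ext. rewrite length_map; auto.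
  - rewrite (sapp_map (subst_ty sl st)). apply sapp_ext.
    rewrite length_map; auto.
Qed.

Lemma wf_loc_subst nl nl' sl l :
  wf_loc nl l -> (forall n, n < nl -> wf_loc nl' (sl n)) ->
  wf_loc nl' (subst_loc sl l).
Proof. destruct l; simpl; auto. Qed.

Lemma wf_ty_ren A : forall nl nt nl' nt' rl rt,
  wf_ty nl nt A -> (forall n, n < nl -> rl n < nl') ->
  (forall n, n < nt -> rt n < nt') -> wf_ty nl' nt' (ren_ty rl rt A).
Proof.
  induction A; intros * Hwf Hl Ht; simpl in *; eauto.
  - intuition eauto. destruct l; simpl in *; auto.
  - intuition eauto.
  - eapply IHA; eauto. intros [|n] Hn; simpl; [lia|].
    specialize (Ht n); lia.
  - eapply IHA; eauto. intros [|n] Hn; simpl; [lia|].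
    specialize (Hl n); lia.
Qed.

Lemma wf_ty_subst A : forall nl nt nl' nt' sl st,
  wf_ty nl nt A -> (forall n, n < nl -> wf_loc nl' (sl n)) ->
  (forall n, n < nt -> wf_ty nl' nt' (st n)) -> wf_ty nl' nt' (subst_ty sl st A).
Proof.
  induction A; intros * Hwf Hl Ht; simpl in *; eauto.
  - intuition eauto. eapply wf_loc_subst; eauto.
  - intuition eauto.
  - eapply IHA; eauto. intros [|n] Hn; simpl; [lia|].
    eapply wf_ty_ren; [apply Ht; lia | auto | intros; lia].
  - eapply IHA; eauto.
    + intros [|n] Hn; simpl; [lia|]. specialize (Hl n).
      destruct (sl n); simpl in *; auto; lia.
    + intros n Hn. eapply wf_ty_ren; [apply Ht; lia | intros; lia | auto].
Qed.

Lemma relocatable_ren rl rt A : relocatable A -> relocatable (ren_ty rl rt A).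
Proof. induction A; simpl; tauto. Qed.

Lemma relocatable_subst sl st A :
  (forall n, relocatable (st n)) -> relocatable A ->
  relocatable (subst_ty sl st A).
Proof. induction A; simpl; auto; tauto. Qed.

Lemma relocatable_up_ty st :
  (forall n, relocatable (st n)) -> forall n, relocatable (up_ty st n).
Proof. intros H [|n]; simpl; auto. apply relocatable_ren; auto. Qed.

Lemma relocatable_sapp As :
  Forall relocatable As -> forall n, relocatable (sapp As TVar n).
Proof. intros H n. apply Forall_sapp; simpl; auto. Qed.

(** * Substitution in typing derivations *)

Section ValTmInd.
Variables (Q : val -> Prop) (R : tm -> Prop).
Hypotheses
  (HVar : forall n, Q (Var n))
  (HPair : forall V W, Q V -> Q W -> Q (Pair V W))
  (HClo : forall Ws F, Forall Q Ws -> Q (Clo Ws F))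
  (HTLam : forall V, Q V -> Q (TLam V))
  (HUnit : forall V, Q V -> Q (Unit V))
  (HDo : forall M N, R M -> R N -> Q (Do M N))
  (HReq : forall V W, Q V -> Q W -> Q (Req V W))
  (HCall : forall V W, Q V -> Q W -> Q (Call V W))
  (HGen : forall l V W, Q V -> Q W -> Q (Gen l V W))
  (HVal : forall V, Q V -> R (Val V))
  (HLet : forall M N, R M -> R N -> R (Let M N))
  (HProj : forall i V, Q V -> R (Proj i V))
  (HApp : forall V W, Q V -> Q W -> R (App V W))
  (HTApp : forall V A, Q V -> R (TApp V A))
  (HLApp : forall V l, Q V -> R (LApp V l)).

Fixpoint val_tm_ind_val (V : val) : Q V :=
  match V with
  | Var n => HVar n
  | Pair V W => HPair V W (val_tm_ind_val V) (val_tm_ind_val W)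
  | Clo Ws F =>
      HClo Ws F
        ((fix all (Ws : list val) : Forall Q Ws :=
            match Ws with
            | [] => Forall_nil Q
            | W :: Ws => Forall_cons W (val_tm_ind_val W) (all Ws)
            end) Ws)
  | TLam V => HTLam V (val_tm_ind_val V)
  | Unit V => HUnit V (val_tm_ind_val V)
  | Do M N => HDo M N (val_tm_ind_tm M) (val_tm_ind_tm N)
  | Req V W => HReq V W (val_tm_ind_val V) (val_tm_ind_val W)
  | Call V W => HCall V W (val_tm_ind_val V) (val_tm_ind_val W)
  | Gen l V W => HGen l V W (val_tm_ind_val V) (val_tm_ind_val W)
  end
with val_tm_ind_tm (M : tm) : R M :=
  match M with
  | Val V => HVal V (val_tm_ind_val V)
  | Let M N => HLet M N (val_tm_ind_tm M) (val_tm_ind_tm N)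
  | Proj i V => HProj i V (val_tm_ind_val V)
  | App V W => HApp V W (val_tm_ind_val V) (val_tm_ind_val W)
  | TApp V A => HTApp V A (val_tm_ind_val V)
  | LApp V l => HLApp V l (val_tm_ind_val V)
  end.

Lemma val_tm_ind : (forall V, Q V) /\ (forall M, R M).
Proof. split; [exact val_tm_ind_val | exact val_tm_ind_tm]. Qed.
End ValTmInd.

Scheme typing_mut := Minimality for typing Sort Prop
  with typings_mut := Minimality for typings Sort Prop
  with code_typing_mut := Minimality for code_typing Sort Prop.

(* Without induction hypothesis for [code_typing]: code is closed and hence not
   affected by the substitutions at hand. *)
Lemma typing_typings_ind (P : split) (Q : ctx -> loc -> tm -> ty -> Prop)
    (R : ctx -> loc -> list val -> list ty -> Prop) :
  (forall G l n A, nth_error (ctx_vars G) n = Some A -> Q G l (Var n) A) ->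
  (forall G l M N A B, typing P G l M A -> Q G l M A ->
     typing P (add_var A G) l N B -> Q (add_var A G) l N B ->
     Q G l (Let M N) B) ->
  (forall G l Ws f Ls As Bs A, Forall (wf_loc (ctx_locs G)) Ls ->
     Forall (wf_ty (ctx_locs G) (ctx_tys G)) As ->
     code_typing P (CName f Ls As) Bs A -> typings P G l Ws Bs ->
     R G l Ws Bs -> Q G l (Clo Ws (CName f Ls As)) (TClo A)) ->
  (forall G l i (V : val) A1 A2, typing P G l V (TProd A1 A2) ->
     Q G l V (TProd A1 A2) ->
     Q G l (Proj i V) (match i with pr1 => A1 | pr2 => A2 end)) ->
  (forall G l (V W : val) A B, typing P G l V A -> Q G l V A -> typing P G l W B ->
     Q G l W B -> Q G l (Pair V W) (TProd A B)) ->
  (forall G l (V : val) A,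
     (forall l0, wf_loc (ctx_locs G) l0 -> typing P (add_ty G) l0 V A) ->
     (forall l0, wf_loc (ctx_locs G) l0 -> Q (add_ty G) l0 V A) ->
     Q G l (TLam V) (TAll A)) ->
  (forall G l (V : val) A B, typing P G l V (TAll A) -> Q G l V (TAll A) ->
     wf_ty (ctx_locs G) (ctx_tys G) B -> relocatable B ->
     Q G l (TApp V B) (subst_ty LVar (scons B TVar) A)) ->
  (forall G l (V : val) A l', typing P G l V (TClo (TLAll A)) ->
     Q G l V (TClo (TLAll A)) -> wf_loc (ctx_locs G) l' ->
     Q G l (LApp V l') (subst_ty (scons l' LVar) TVar A)) ->
  (forall G l (V : val) A, typing P G l V A -> Q G l V A -> relocatable A ->
     Q G l (Unit V) (TMon A)) ->
  (forall G l M N A B, typing P G l M (TMon A) -> Q G l M (TMon A) ->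
     typing P (add_var A G) l N (TMon B) -> Q (add_var A G) l N (TMon B) ->
     Q G l (Do M N) (TMon B)) ->
  (forall G l (V W : val) A B, typing P G l V (TClo (TArr A l B)) ->
     Q G l V (TClo (TArr A l B)) -> typing P G l W A -> Q G l W A ->
     Q G l (App V W) B) ->
  (forall G l l' (V W : val) A B, wf_loc (ctx_locs G) l' ->
     typing P G l V (TClo (TArr A l' (TMon B))) ->
     Q G l V (TClo (TArr A l' (TMon B))) -> typing P G l W A -> Q G l W A ->
     relocatable A -> Q G l (Gen l' V W) (TMon B)) ->
  (forall G (V W : val) A B,
     typing P G client V (TClo (TArr A server (TMon B))) ->
     Q G client V (TClo (TArr A server (TMon B))) ->
     typing P G client W A -> Q G client W A -> relocatable A ->
     Q G client (Req V W) (TMon B)) ->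
  (forall G (V W : val) A B,
     typing P G server V (TClo (TArr A client (TMon B))) ->
     Q G server V (TClo (TArr A client (TMon B))) ->
     typing P G server W A -> Q G server W A -> relocatable A ->
     Q G server (Call V W) (TMon B)) ->
  (forall G l, R G l [] []) ->
  (forall G l (W : val) Ws B Bs, typing P G l W B -> Q G l W B ->
     typings P G l Ws Bs -> R G l Ws Bs -> R G l (W :: Ws) (B :: Bs)) ->
  forall G l M A, typing P G l M A -> Q G l M A.
Proof.
  intros. eapply (typing_mut P Q R (fun _ _ _ => True)); eauto.
  - intros G0 l0 V A1 A2. apply (H2 G0 l0 pr1 V A1 A2).
  - intros G0 l0 V A1 A2. apply (H2 G0 l0 pr2 V A1 A2).
Qed.

(** This makes every closure movable, whatever the type of its code: all values that it captures are
    relocatable. *)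
Lemma code_typing_relocatable P F Bs A :
  code_typing P F Bs A -> Forall relocatable Bs.
Proof.
  inversion 1; subst; apply Forall_map;
    (apply Forall_impl with (P := relocatable); [|assumption]);
    intros B; apply relocatable_subst, relocatable_sapp; assumption.
Qed.

(** Code is closed, so a substitution reaches only the arguments in its name. The type arguments
    have to stay relocatable, hence the condition on [st]. *)
Lemma code_typing_subst P sl st F Bs A :
  (forall n, relocatable (st n)) -> code_typing P F Bs A ->
  code_typing P (subst_cname sl st F) (map (subst_ty sl st) Bs)
    (subst_ty sl st A).
Proof.
  intros Hst H.
  assert (Henv : forall (Ls : list loc) (As Bs : list ty),
      Forall (wf_ty (length Ls) (length As)) Bs ->
      map (subst_ty sl st) (map (subst_ty (sapp Ls LVar) (sapp As TVar)) Bs) =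
      map (subst_ty (sapp (map (subst_loc sl) Ls) LVar)
                    (sapp (map (subst_ty sl st) As) TVar)) Bs).
  { intros Ls As Bs0 HBs. rewrite map_map. apply map_ext_Forall.
    eapply Forall_impl; [|exact HBs]. intros; apply subst_ty_code_inst; auto. }
  assert (Hrel : forall As, Forall relocatable As ->
      Forall relocatable (map (subst_ty sl st) As)).
  { intros As HAs. apply Forall_map. eapply Forall_impl; [|exact HAs].
    intros B; apply relocatable_subst; auto. }
  inversion H; subst.
  - destruct H1 as [HBs HA]; cbn -[wf_ty] in HBs, HA.
    rewrite Henv, subst_ty_code_inst by assumption. simpl subst_cname.
    apply ty_fabs with (M := M) (nl := length Ls) (nt := length As);
      rewrite ?length_map; auto. split; auto.
  - destruct H1 as [HBs HA]; cbn -[wf_ty] in HBs, HA.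
    rewrite Henv, subst_ty_code_inst by assumption. simpl subst_cname.
    apply ty_flabs with (V := V) (nl := length Ls) (nt := length As);
      rewrite ?length_map; auto. split; auto.
Qed.

Lemma ren_cname_subst rl rt F :
  ren_cname rl rt F = subst_cname (fun n => LVar (rl n)) (fun n => TVar (rt n)) F.
Proof.
  destruct F; simpl; f_equal; apply map_ext; intros.
  apply ren_ty_subst.
Qed.

(** Locations stay fixed: no value or term binds a location variable, [LLam] being a form of code,
    so substitution in values and terms never passes under such a binder. *)
Lemma typing_ren P G l M A :
  typing P G l M A -> forall G' rt r,
  ctx_locs G' = ctx_locs G ->
  (forall n, n < ctx_tys G -> rt n < ctx_tys G') ->
  (forall n B, nth_error (ctx_vars G) n = Some B ->
     nth_error (ctx_vars G') (r n) = Some (ren_ty (fun n => n) rt B)) ->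
  typing P G' l (ren_tm (fun n => n) rt r M) (ren_ty (fun n => n) rt A).
Proof.
  intros H.
  apply (typing_typings_ind P
    (fun G l M A => forall G' rt r, ctx_locs G' = ctx_locs G ->
       (forall n, n < ctx_tys G -> rt n < ctx_tys G') ->
       (forall n B, nth_error (ctx_vars G) n = Some B ->
         nth_error (ctx_vars G') (r n) = Some (ren_ty (fun n => n) rt B)) ->
       typing P G' l (ren_tm (fun n => n) rt r M) (ren_ty (fun n => n) rt A))
    (fun G l Ws Bs => forall G' rt r, ctx_locs G' = ctx_locs G ->
       (forall n, n < ctx_tys G -> rt n < ctx_tys G') ->
       (forall n B, nth_error (ctx_vars G) n = Some B ->
         nth_error (ctx_vars G') (r n) = Some (ren_ty (fun n => n) rt B)) ->
       typings P G' l (map (ren_val (fun n => n) rt r) Ws)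
         (map (ren_ty (fun n => n) rt) Bs))); try exact H; clear; simpl.
  - intros G l n A Hn G' rt r Hl Ht Hr. apply ty_var; auto.
  - intros G l M N A B _ IHM _ IHN G' rt r Hl Ht Hr. eapply ty_let; eauto.
    apply IHN; auto. intros [|n] C HC; simpl in *; auto. congruence.
  - intros G l Ws f Ls As Bs A HLs HAs HF _ IH G' rt r Hl Ht Hr.
    eapply (code_typing_subst P LVar (fun n => TVar (rt n))) in HF;
      [|simpl; auto].
    (* [LVar] is brought into the form of a renaming, so that [ren_ty_subst] and [ren_cname_subst]
       apply from right to left. *)
    change (subst_ty LVar) with (subst_ty (fun n => LVar ((fun n => n) n))) in HF.
    rewrite <- ren_ty_subst in HF.
    rewrite (map_ext _ _ (fun B => eq_sym (ren_ty_subst B (fun n => n) rt))) in HF.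
    change (subst_cname LVar) with (subst_cname (fun n => LVar ((fun n => n) n))) in HF.
    rewrite <- ren_cname_subst in HF. simpl in HF.
    eapply ty_clo; eauto.
    + rewrite (map_ext _ _ ren_loc_id), map_id, Hl; auto.
    + apply Forall_map. eapply Forall_impl; [|exact HAs]. intros B HB.
      rewrite Hl. eapply wf_ty_ren; eauto.
  - intros G l i V A1 A2 _ IH G' rt r Hl Ht Hr.
    destruct i; [eapply ty_proj1 | eapply ty_proj2]; eapply IH; eauto.
  - intros. apply ty_pair; eauto.
  - intros G l V A _ IH G' rt r Hl Ht Hr. apply ty_tabs. rewrite Hl.
    intros l0 Hl0. apply (IH l0 Hl0); simpl; auto.
    + intros [|n] Hn; simpl; [lia|]. specialize (Ht n); lia.
    + intros n B. rewrite !nth_error_map. intros HB.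
      destruct (nth_error (ctx_vars G) n) as [C|] eqn:HC; inversion HB; subst.
      rewrite (Hr _ _ HC); simpl. rewrite !ren_ty_comp; reflexivity.
  - intros G l V A B _ IH HB HBr G' rt r Hl Ht Hr.
    rewrite (ren_ty_subst (subst_ty _ _ A)), subst_ty_inst_ty, up_ty_TVar.
    rewrite <- !ren_ty_subst. apply ty_tapp.
    + apply (IH G'); auto.
    + rewrite Hl. eapply wf_ty_ren; eauto.
    + apply relocatable_ren; auto.
  - intros G l V A l' _ IH Hl' G' rt r Hl Ht Hr.
    rewrite (ren_ty_subst (subst_ty _ _ A)), subst_ty_inst_loc, up_loc_LVar.
    unfold shift_loc_ty. simpl. rewrite <- ren_ty_subst, <- ren_loc_subst.
    apply ty_lapp.
    + apply (IH G'); auto.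
    + rewrite ren_loc_id, Hl; auto.
  - intros. apply ty_unit; eauto. apply relocatable_ren; auto.
  - intros G l M N A B _ IHM _ IHN G' rt r Hl Ht Hr. eapply ty_bind; eauto.
    apply IHN; auto. intros [|n] C HC; simpl in *; auto. congruence.
  - intros G l V W A B _ IHV _ IHW G' rt r Hl Ht Hr. eapply ty_app; eauto.
    specialize (IHV G' rt r Hl Ht Hr). rewrite ren_loc_id in IHV. eauto.
  - intros G l l' V W A B Hl' _ IHV _ IHW HA G' rt r Hl Ht Hr.
    eapply ty_gen; [| apply IHV | apply IHW | apply relocatable_ren]; auto.
    rewrite ren_loc_id, Hl; auto.
  - intros G V W A B _ IHV _ IHW HA G' rt r Hl Ht Hr.
    eapply ty_req; [apply IHV | apply IHW | apply relocatable_ren]; auto.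
  - intros G V W A B _ IHV _ IHW HA G' rt r Hl Ht Hr.
    eapply ty_call; [apply IHV | apply IHW | apply relocatable_ren]; auto.
  - intros. apply tys_nil.
  - intros. apply tys_cons; eauto.
Qed.

(** * Stability of the form of type abstractions under substitution *)

Lemma tabs_unit_Clo Ws F :
  tabs_unit_val (Clo Ws F) <-> Forall tabs_unit_val Ws.
Proof.
  simpl. induction Ws as [|W Ws IH]; simpl; [now intuition|].
  rewrite Forall_cons_iff, IH. tauto.
Qed.

Lemma tabs_unit_TLam V :
  tabs_unit_val (TLam V) -> exists V', V = Unit V' /\ tabs_unit_val V'.
Proof. destruct V; simpl; try contradiction. eauto. Qed.

Lemma tabs_unit_ren :
  (forall V rl rt r, tabs_unit_val V -> tabs_unit_val (ren_val rl rt r V)) /\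
  (forall M rl rt r, tabs_unit_tm M -> tabs_unit_tm (ren_tm rl rt r M)).
Proof.
  apply val_tm_ind; try (simpl; intuition eauto; fail).
  - intros Ws F IH rl rt r HV. rewrite tabs_unit_Clo in HV.
    apply tabs_unit_Clo, Forall_map. rewrite Forall_forall in *. eauto.
  - intros V IH rl rt r HV. apply tabs_unit_TLam in HV as (V' & -> & HV').
    exact (IH rl (up_ren rt) r HV').
Qed.

Lemma tabs_unit_up_tm s :
  (forall n, tabs_unit_val (s n)) -> forall n, tabs_unit_val (up_tm s n).
Proof. intros H [|n]; simpl; auto. apply tabs_unit_ren; auto. Qed.

Lemma tabs_unit_subst :
  (forall V sl st s, (forall n, tabs_unit_val (s n)) ->
     tabs_unit_val V -> tabs_unit_val (subst_val sl st s V)) /\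
  (forall M sl st s, (forall n, tabs_unit_val (s n)) ->
     tabs_unit_tm M -> tabs_unit_tm (subst_tm sl st s M)).
Proof.
  apply val_tm_ind;
    try (simpl; intros; intuition eauto using tabs_unit_up_tm; fail).
  - intros Ws F IH sl st s Hs HV. rewrite tabs_unit_Clo in HV.
    apply tabs_unit_Clo, Forall_map. rewrite Forall_forall in *. eauto.
  - intros V IH sl st s Hs HV. apply tabs_unit_TLam in HV as (V' & -> & HV').
    apply (IH sl (up_ty st) (fun n => shift_ty_val (s n))); auto.
    intros n. apply tabs_unit_ren; auto.
Qed.

(** * The substitution lemma for typing and the relocation of values *)

Lemma ren_ty_id A : ren_ty (fun n => n) (fun n => n) A = A.
Proof. rewrite ren_ty_subst. apply subst_ty_id. Qed.

Lemma relocatable_ren_inv rl rt A : relocatable (ren_ty rl rt A) -> relocatable A.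
Proof. induction A; simpl; tauto. Qed.

(** [sw_relocatable] speaks of all indices, also those out of scope, because [relocatable] keeps no
    track of scopes. *)
Record subst_wf (G G' : ctx) (sl : nat -> loc) (st : nat -> ty) : Prop := {
  sw_loc : forall n, n < ctx_locs G -> wf_loc (ctx_locs G') (sl n);
  sw_ty : forall n, n < ctx_tys G -> wf_ty (ctx_locs G') (ctx_tys G') (st n);
  sw_relocatable : forall n, relocatable (st n) }.

(** [Q] selects variables by their types. Its two uses are all variables at one location, and the
    variables of relocatable type at every location. *)
Definition env_at P G G' sl st s (Q : ty -> Prop) (l : loc) : Prop :=
  forall n B, nth_error (ctx_vars G) n = Some B -> Q B ->
    typing P G' l (Val (s n)) (subst_ty sl st B).

Lemma subst_wf_add_ty G G' sl st :
  subst_wf G G' sl st -> subst_wf (add_ty G) (add_ty G') sl (up_ty st).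
Proof.
  intros [Hl Ht Hr]. split; simpl; auto.
  - intros [|n] Hn; simpl; [lia|].
    eapply wf_ty_ren; [apply Ht; lia | auto | intros; lia].
  - apply relocatable_up_ty; auto.
Qed.

Lemma subst_wf_add_var G G' sl st A B :
  subst_wf G G' sl st -> subst_wf (add_var A G) (add_var B G') sl st.
Proof. intros [Hl Ht Hr]. split; auto. Qed.

Lemma env_at_add_var P G G' sl st s Q l A :
  env_at P G G' sl st s Q l ->
  env_at P (add_var A G) (add_var (subst_ty sl st A) G') sl st (up_tm s) Q l.
Proof.
  intros H [|n] B HB HQ; simpl in *.
  - apply ty_var. simpl. congruence.
  - rewrite <- (ren_ty_id (subst_ty sl st B)).
    apply (typing_ren P G' l (s n)); simpl; auto.
    intros; rewrite ren_ty_id; auto.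
Qed.

Lemma env_at_add_ty P G G' sl st s l :
  env_at P G G' sl st s relocatable l ->
  env_at P (add_ty G) (add_ty G') sl (up_ty st) (fun n => shift_ty_val (s n))
    relocatable l.
Proof.
  intros H n B HB HQ. simpl in HB. rewrite nth_error_map in HB.
  destruct (nth_error (ctx_vars G) n) as [C|] eqn:HC; inversion HB; subst.
  rewrite subst_ty_up_ren.
  apply (typing_ren P G' l (s n)); simpl; auto.
  - apply H; auto. eapply relocatable_ren_inv; eauto.
  - intros; lia.
  - intros m D HD. rewrite nth_error_map, HD. reflexivity.
Qed.

(* Values whose typing does not depend on the location, provided that the free
   variables of relocatable type do not. *)
Definition movable (M : tm) (A : ty) : Prop :=
  match M with
  | Val (Unit _) => True
  | Val _ => relocatable A
  | _ => False
  end.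

(* The body of a type abstraction is used at every location, although the
   substituted values may be typed at one location only.  Since it is of the
   form [Unit V'] with [V'] of relocatable type, only variables of relocatable
   type occur in it, so it suffices that those can be moved. *)
Lemma typing_subst P G l M A :
  typing P G l M A -> tabs_unit_tm M -> forall G' sl st s l',
  subst_wf G G' sl st ->
  (forall l0, env_at P G G' sl st s relocatable l0) ->
  (l' = subst_loc sl l /\ env_at P G G' sl st s (fun _ => True) l' \/
   movable M A) ->
  typing P G' l' (subst_tm sl st s M) (subst_ty sl st A).
Proof.
  intros H.
  apply (typing_typings_ind P
    (fun G l M A => tabs_unit_tm M -> forall G' sl st s l',
       subst_wf G G' sl st ->
       (forall l0, env_at P G G' sl st s relocatable l0) ->
       (l' = subst_loc sl l /\ env_at P G G' sl st s (fun _ => True) l' \/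
        movable M A) ->
       typing P G' l' (subst_tm sl st s M) (subst_ty sl st A))
    (fun G l Ws Bs => Forall tabs_unit_val Ws -> forall G' sl st s l',
       subst_wf G G' sl st ->
       (forall l0, env_at P G G' sl st s relocatable l0) ->
       Forall relocatable Bs ->
       typings P G' l' (map (subst_val sl st s) Ws) (map (subst_ty sl st) Bs)));
    try exact H; clear; cbn [subst_tm subst_val subst_ty movable relocatable].
  - intros G l n A Hn _ G' sl st s l' _ Hre [[_ Hfull]|Hmv].
    + apply Hfull; auto.
    + apply Hre; auto.
  - intros G l M N A B _ IHM _ IHN [HtM HtN] G' sl st s l' Hwf Hre [[-> Hfull]|[]].
    eapply ty_let; [apply IHM; auto|].
    apply IHN; auto using env_at_add_var, subst_wf_add_var.
  - intros G l Ws f Ls As Bs A HLs HAs HF _ IH Ht G' sl st s l' Hwf Hre _.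
    apply (tabs_unit_Clo Ws (CName f Ls As)) in Ht. destruct Hwf as [Hl Hty Hr].
    (* The captured values have relocatable types, so the closure can be typed at any [l'], by the
       second alternative of the induction hypotheses. *)
    pose proof (code_typing_relocatable _ _ _ _ HF) as HBs.
    apply ty_clo with (Bs := map (subst_ty sl st) Bs).
    + apply Forall_map. eapply Forall_impl; [|exact HLs].
      intros; eapply wf_loc_subst; eauto.
    + apply Forall_map. eapply Forall_impl; [|exact HAs].
      intros; eapply wf_ty_subst; eauto.
    + exact (code_typing_subst P sl st _ _ _ Hr HF).
    + apply IH; auto. split; auto.
  - intros G l i V A1 A2 _ IH Ht G' sl st s l' Hwf Hre [Hfull|[]].
    destruct i; [eapply ty_proj1 | eapply ty_proj2]; eapply IH; eauto.
  - intros G l V W A B _ IHV _ IHW [HtV HtW] G' sl st s l' Hwf Hre Hmv.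
    apply ty_pair; [apply IHV | apply IHW]; auto;
      (destruct Hmv as [|[]]; [left; assumption | right]).
    + destruct V; simpl; auto.
    + destruct W; simpl; auto.
  - intros G l V A _ IH Ht G' sl st s l' Hwf Hre _.
    apply tabs_unit_TLam in Ht as (V' & -> & Ht).
    (* The derivation at [client], a location that is in scope everywhere, serves every target
       location [l0], because [Unit V'] is movable. *)
    apply ty_tabs. intros l0 _. apply (IH client I); simpl; auto.
    + apply subst_wf_add_ty; auto.
    + intros l1; apply env_at_add_ty; auto.
  - intros G l V A B _ IH HB HBr Ht G' sl st s l' Hwf Hre [Hfull|[]].
    rewrite subst_ty_inst_ty. destruct Hwf. apply ty_tapp.
    + apply IH; auto. split; auto.
    + eapply wf_ty_subst; eauto.
    + apply relocatable_subst; auto.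
  - intros G l V A l1 _ IH Hl1 Ht G' sl st s l' Hwf Hre [Hfull|[]].
    rewrite subst_ty_inst_loc. destruct Hwf. apply ty_lapp.
    + apply IH; auto. split; auto.
    + eapply wf_loc_subst; eauto.
  - intros G l V A _ IH HA Ht G' sl st s l' Hwf Hre _.
    apply ty_unit.
    + apply IH; auto. right. destruct V; simpl; auto.
    + destruct Hwf; apply relocatable_subst; auto.
  - intros G l M N A B _ IHM _ IHN [HtM HtN] G' sl st s l' Hwf Hre [[-> Hfull]|[]].
    eapply ty_bind; [apply IHM; auto|].
    apply IHN; auto using env_at_add_var, subst_wf_add_var.
  - intros G l V W A B _ IHV _ IHW [HtV HtW] G' sl st s l' Hwf Hre [[-> Hfull]|[]].
    eapply ty_app; [apply IHV | apply IHW]; auto.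
  - intros G l l1 V W A B Hl1 _ IHV _ IHW HA [HtV HtW] G' sl st s l' Hwf Hre
      [[-> Hfull]|[]].
    eapply ty_gen; [|apply IHV | apply IHW|]; auto; destruct Hwf.
    + eapply wf_loc_subst; eauto.
    + apply relocatable_subst; auto.
  - intros G V W A B _ IHV _ IHW HA [HtV HtW] G' sl st s l' Hwf Hre
      [[-> Hfull]|[]].
    eapply ty_req; [apply IHV | apply IHW|]; auto; destruct Hwf.
    apply relocatable_subst; auto.
  - intros G V W A B _ IHV _ IHW HA [HtV HtW] G' sl st s l' Hwf Hre
      [[-> Hfull]|[]].
    eapply ty_call; [apply IHV | apply IHW|]; auto; destruct Hwf.
    apply relocatable_subst; auto.
  - intros. apply tys_nil.
  - intros G l W Ws B Bs _ IHW _ IHWs Ht G' sl st s l' Hwf Hre HBs.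
    inversion Ht; inversion HBs; subst.
    apply tys_cons; [|apply IHWs; auto].
    apply IHW; auto. right. destruct W; simpl; auto.
Qed.

(* A movable term has no free variables but those of relocatable type, hence the
   last conjunct. *)
Lemma relocation P G l M A rl r :
  typing P G l M A -> Forall (fun B => ~ relocatable B) (ctx_vars G) ->
  tabs_unit_tm M -> movable M A ->
  comp_tm client rl r M = comp_tm server rl r M /\
  (forall l', typing P G l' M A) /\
  (forall sl st s s', subst_tm sl st s M = subst_tm sl st s' M).
Proof.
  intros H.
  (* Compilation depends on the location only at [Gen], whose type [TMon _] is not relocatable. The
     cases that survive [contradiction] are those of variables, closures, pairs, type abstractions,
     units and lists of values. *)
  eapply (typing_typings_ind P
    (fun G l M A => Forall (fun B => ~ relocatable B) (ctx_vars G) ->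
       tabs_unit_tm M -> movable M A ->
       comp_tm client rl r M = comp_tm server rl r M /\
       (forall l', typing P G l' M A) /\
       (forall sl st s s', subst_tm sl st s M = subst_tm sl st s' M))
    (fun G l Ws Bs => Forall (fun B => ~ relocatable B) (ctx_vars G) ->
       Forall tabs_unit_val Ws -> Forall relocatable Bs ->
       map (comp_val client rl r) Ws = map (comp_val server rl r) Ws /\
       (forall l', typings P G l' Ws Bs) /\
       (forall sl st s s',
          map (subst_val sl st s) Ws = map (subst_val sl st s') Ws)));
    try exact H; clear;
    cbn [movable relocatable comp_tm comp_val subst_tm subst_val];
    try contradiction.
  - intros G l n A Hn HG _ HA. apply nth_error_In in Hn.
    rewrite Forall_forall in HG. destruct (HG A Hn HA).
  - intros G l Ws f Ls As Bs A HLs HAs HF _ IH HG Ht _.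
    apply (tabs_unit_Clo Ws (CName f Ls As)) in Ht.
    destruct (IH HG Ht (code_typing_relocatable _ _ _ _ HF)) as (-> & HWs & Hs).
    repeat split.
    + intros l'. eapply ty_clo; eauto.
    + intros. rewrite (Hs sl st s s'). reflexivity.
  - intros G l V W A B _ IHV _ IHW HG [HtV HtW] [HA HB].
    destruct IHV as (-> & HV & HsV); auto; [destruct V; simpl; auto|].
    destruct IHW as (-> & HW & HsW); auto; [destruct W; simpl; auto|].
    repeat split.
    + intros l'. apply ty_pair; auto.
    + intros. specialize (HsV sl st s s'). specialize (HsW sl st s s').
      simpl in *. congruence.
  - intros G l V A HV IH HG Ht _.
    apply tabs_unit_TLam in Ht as (V' & -> & Ht).
    destruct (IH client I) as (E & _ & Hs); simpl; auto.
    { apply Forall_map. revert HG. apply Forall_impl. intros B HB HB'.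
      apply HB. eapply relocatable_ren_inv; eauto. }
    repeat split.
    + simpl in E. congruence.
    + intros; apply ty_tabs; auto.
    + intros sl st s s'.
      specialize (Hs sl (up_ty st) (fun n => shift_ty_val (s n))
                    (fun n => shift_ty_val (s' n))).
      simpl in *. congruence.
  - intros G l V A _ IH HA HG Ht _.
    destruct IH as (-> & HV & Hs); auto; [destruct V; simpl; auto|].
    repeat split.
    + intros l'. apply ty_unit; auto.
    + intros. specialize (Hs sl st s s'). simpl in *. congruence.
  - repeat split. intros; apply tys_nil.
  - intros G l W Ws B Bs _ IHW _ IHWs HG Ht HBs. simpl.
    inversion Ht; inversion HBs; subst.
    destruct IHW as (E & HW & HsW); auto; [destruct W; simpl; auto|].
    destruct IHWs as (-> & HWs & HsWs); auto. simpl in E. rewrite E.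
    repeat split.
    + intros l'. apply tys_cons; auto.
    + intros. specialize (HsW sl st s s'). simpl in HsW.
      rewrite (HsWs sl st s s'). congruence.
Qed.

(** * Substitution in the untyped calculus *)

Section UntypedInd.
Variable Q : Untyped.tm -> Prop.
Hypotheses
  (HVar : forall n, Q (Untyped.Var n))
  (HPair : forall v w, Q v -> Q w -> Q (Untyped.Pair v w))
  (HCon : forall c vs, Forall Q vs -> Q (Untyped.Con c vs))
  (HUnit : forall v, Q v -> Q (Untyped.Unit v))
  (HDo : forall m n, Q m -> Q n -> Q (Untyped.Do m n))
  (HLet : forall m n, Q m -> Q n -> Q (Untyped.Let m n))
  (HProj : forall i v, Q v -> Q (Untyped.Proj i v))
  (HApp : forall v w, Q v -> Q w -> Q (Untyped.App v w))
  (HPrim : forall p vs, Forall Q vs -> Q (Untyped.Prim p vs))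
  (HCase : forall v alts, Q v -> Forall (fun b => Q (snd b)) alts ->
     Q (Untyped.Case v alts))
  (HLoop : Q Untyped.Loop).

Fixpoint untyped_ind (m : Untyped.tm) : Q m :=
  let all := fix all (vs : list Untyped.tm) : Forall Q vs :=
    match vs with
    | [] => Forall_nil Q
    | v :: vs => Forall_cons v (untyped_ind v) (all vs)
    end in
  match m with
  | Untyped.Var n => HVar n
  | Untyped.Pair v w => HPair v w (untyped_ind v) (untyped_ind w)
  | Untyped.Con c vs => HCon c vs (all vs)
  | Untyped.Unit v => HUnit v (untyped_ind v)
  | Untyped.Do m n => HDo m n (untyped_ind m) (untyped_ind n)
  | Untyped.Let m n => HLet m n (untyped_ind m) (untyped_ind n)
  | Untyped.Proj i v => HProj i v (untyped_ind v)
  | Untyped.App v w => HApp v w (untyped_ind v) (untyped_ind w)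
  | Untyped.Prim p vs => HPrim p vs (all vs)
  | Untyped.Case v alts =>
      HCase v alts (untyped_ind v)
        ((fix all_alts (alts : list (Untyped.con * nat * Untyped.tm)) :
              Forall (fun b => Q (snd b)) alts :=
            match alts with
            | [] => Forall_nil _
            | b :: alts => Forall_cons b (untyped_ind (snd b)) (all_alts alts)
            end) alts)
  | Untyped.Loop => HLoop
  end.
End UntypedInd.

Lemma up_comp_ren s r :
  Untyped.up (fun n => s (r n)) = fun n => Untyped.up s (up_ren r n).
Proof. apply functional_extensionality; intros [|n]; reflexivity. Qed.

Lemma up_n_comp_ren k s r :
  Untyped.up_n k (fun n => s (r n)) =
  fun n => Untyped.up_n k s (Untyped.up_ren_n k r n).
Proof. induction k; simpl; auto. rewrite IHk. apply up_comp_ren. Qed.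

Lemma up_ren_n_comp k r r' :
  Untyped.up_ren_n k (fun n => r (r' n)) =
  fun n => Untyped.up_ren_n k r (Untyped.up_ren_n k r' n).
Proof. induction k; simpl; auto. rewrite IHk. apply up_ren_comp. Qed.

Lemma untyped_subst_ren m : forall s r,
  Untyped.subst s (Untyped.ren r m) = Untyped.subst (fun n => s (r n)) m.
Proof.
  induction m using untyped_ind; intros s r; simpl;
    rewrite ?IHm, ?IHm1, ?IHm2, ?map_map, <- ?up_comp_ren; auto; f_equal;
    try (apply map_ext_Forall; revert H; apply Forall_impl; auto).
  intros [[c k] n] IH; simpl in *. rewrite IH, (up_n_comp_ren k s r); reflexivity.
Qed.

Lemma untyped_ren_comp m : forall r r',
  Untyped.ren r (Untyped.ren r' m) = Untyped.ren (fun n => r (r' n)) m.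
Proof.
  induction m using untyped_ind; intros r r'; simpl;
    rewrite ?IHm, ?IHm1, ?IHm2, ?map_map, <- ?up_ren_comp; auto; f_equal;
    try (apply map_ext_Forall; revert H; apply Forall_impl; auto).
  intros [[c k] n] IH; simpl in *. rewrite IH, (up_ren_n_comp k r r'); reflexivity.
Qed.

Lemma up_ren_subst r s :
  (fun n => Untyped.ren (up_ren r) (Untyped.up s n)) =
  Untyped.up (fun n => Untyped.ren r (s n)).
Proof.
  apply functional_extensionality; intros [|n]; simpl; auto.
  rewrite !untyped_ren_comp; reflexivity.
Qed.

Lemma up_n_ren_subst k r s :
  (fun n => Untyped.ren (Untyped.up_ren_n k r) (Untyped.up_n k s n)) =
  Untyped.up_n k (fun n => Untyped.ren r (s n)).
Proof. induction k; simpl; auto. rewrite up_ren_subst, IHk; reflexivity. Qed.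

Lemma untyped_ren_subst m : forall r s,
  Untyped.ren r (Untyped.subst s m) =
  Untyped.subst (fun n => Untyped.ren r (s n)) m.
Proof.
  induction m using untyped_ind; intros r s; simpl;
    rewrite ?IHm, ?IHm1, ?IHm2, ?map_map, ?up_ren_subst; auto; f_equal;
    try (apply map_ext_Forall; revert H; apply Forall_impl; auto).
  intros [[c k] n] IH; simpl in *. rewrite IH, up_n_ren_subst; reflexivity.
Qed.

Lemma up_subst s s' :
  (fun n => Untyped.subst (Untyped.up s) (Untyped.up s' n)) =
  Untyped.up (fun n => Untyped.subst s (s' n)).
Proof.
  apply functional_extensionality; intros [|n]; simpl; auto.
  rewrite untyped_subst_ren, untyped_ren_subst; reflexivity.
Qed.

Lemma up_n_subst k s s' :
  (fun n => Untyped.subst (Untyped.up_n k s) (Untyped.up_n k s' n)) =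
  Untyped.up_n k (fun n => Untyped.subst s (s' n)).
Proof. induction k; simpl; auto. rewrite up_subst, IHk; reflexivity. Qed.

Lemma untyped_subst_comp m : forall s s',
  Untyped.subst s (Untyped.subst s' m) =
  Untyped.subst (fun n => Untyped.subst s (s' n)) m.
Proof.
  induction m using untyped_ind; intros s s'; simpl;
    rewrite ?IHm, ?IHm1, ?IHm2, ?map_map, ?up_subst; auto; f_equal;
    try (apply map_ext_Forall; revert H; apply Forall_impl; auto).
  intros [[c k] n] IH; simpl in *. rewrite IH, up_n_subst; reflexivity.
Qed.

Lemma up_Var : Untyped.up Untyped.Var = Untyped.Var.
Proof. apply functional_extensionality; intros [|n]; reflexivity. Qed.

Lemma up_n_Var k : Untyped.up_n k Untyped.Var = Untyped.Var.
Proof. induction k; simpl; auto. rewrite IHk; apply up_Var. Qed.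

Lemma map_id_Forall {X : Type} (f : X -> X) xs :
  Forall (fun x => f x = x) xs -> map f xs = xs.
Proof. induction 1; simpl; congruence. Qed.

Lemma untyped_subst_id m : Untyped.subst Untyped.Var m = m.
Proof.
  induction m using untyped_ind; simpl; rewrite ?up_Var; f_equal; auto;
    apply map_id_Forall; auto.
  revert H; apply Forall_impl. intros [[c k] n] IH; simpl in *.
  rewrite up_n_Var, IH; reflexivity.
Qed.

(** * Compilation and substitution *)

Lemma comp_loc_ren rl rl' l :
  comp_loc rl (ren_loc rl' l) = comp_loc (fun n => rl (rl' n)) l.
Proof. destruct l as [[]|]; reflexivity. Qed.

Lemma ren_comp_loc p rl l :
  Untyped.ren p (comp_loc rl l) = comp_loc (fun n => p (rl n)) l.
Proof. destruct l as [[]|]; reflexivity. Qed.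

Lemma comp_ren a :
  (forall V rl r rl' rt r', comp_val a rl r (ren_val rl' rt r' V) =
     comp_val a (fun n => rl (rl' n)) (fun n => r (r' n)) V) /\
  (forall M rl r rl' rt r', comp_tm a rl r (ren_tm rl' rt r' M) =
     comp_tm a (fun n => rl (rl' n)) (fun n => r (r' n)) M).
Proof.
  apply val_tm_ind; simpl; intros; auto;
    try (rewrite ?H, ?H0, ?comp_loc_ren, <- ?up_ren_comp; reflexivity).
  - destruct F as [f Ls As]; simpl. rewrite !map_map. f_equal. f_equal.
    + apply map_ext; intros; apply comp_loc_ren.
    + apply map_ext_Forall; revert H; apply Forall_impl; auto.
  - specialize (H rl r rl' (up_ren rt) r').
    destruct V; simpl in *; try exact H. congruence.
Qed.

Lemma ren_comp a :
  (forall V p rl r, Untyped.ren p (comp_val a rl r V) =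
     comp_val a (fun n => p (rl n)) (fun n => p (r n)) V) /\
  (forall M p rl r, Untyped.ren p (comp_tm a rl r M) =
     comp_tm a (fun n => p (rl n)) (fun n => p (r n)) M).
Proof.
  apply val_tm_ind; simpl; intros; auto;
    try (rewrite ?H, ?H0, ?ren_comp_loc, <- ?up_ren_comp; reflexivity).
  - destruct F as [f Ls As]; simpl. rewrite map_app, !map_map. f_equal. f_equal.
    + apply map_ext; intros; apply ren_comp_loc.
    + apply map_ext_Forall; revert H; apply Forall_impl; auto.
  - specialize (H p rl r). destruct V; simpl in *; try exact H. congruence.
  - rewrite <- H, <- H0, <- (ren_comp_loc p rl). destruct a; reflexivity.
Qed.

Lemma subst_comp_loc s rl rl' sl nl l :
  (forall n, n < nl -> s (rl n) = comp_loc rl' (sl n)) -> wf_loc nl l ->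
  comp_loc rl' (subst_loc sl l) = Untyped.subst s (comp_loc rl l).
Proof. destruct l as [[]|n]; simpl; auto. symmetry; auto. Qed.

Lemma subst_comp_remote t v w :
  Untyped.subst t (comp_remote v w) =
  comp_remote (Untyped.subst t v) (Untyped.subst t w).
Proof. reflexivity. Qed.

Lemma subst_comp_gen t a l v w :
  Untyped.subst t (comp_gen a l v w) =
  comp_gen a (Untyped.subst t l) (Untyped.subst t v) (Untyped.subst t w).
Proof. destruct a; reflexivity. Qed.

Lemma comp_up_loc (t : nat -> Untyped.tm) rl rl' sl nl :
  (forall n, n < nl -> t (rl n) = comp_loc rl' (sl n)) ->
  forall n, n < nl ->
    Untyped.up t (S (rl n)) = comp_loc (fun n => S (rl' n)) (sl n).
Proof. intros H n Hn. simpl. rewrite H by auto. apply ren_comp_loc. Qed.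

Lemma comp_up_tm (t : nat -> Untyped.tm) a r rl' r' s k :
  (forall n, n < k -> t (r n) = comp_val a rl' r' (s n)) ->
  forall n, n < S k ->
    Untyped.up t (up_ren r n) =
    comp_val a (fun n => S (rl' n)) (up_ren r') (up_tm s n).
Proof.
  intros H [|n] Hn; simpl; auto. rewrite H by lia.
  rewrite (proj1 (comp_ren a)). simpl. apply ren_comp.
Qed.

(* By induction on typing, which bounds the indices of the free variables: a
   substitution instance need only be correct below these bounds, as [rl] and
   [r] may overlap beyond them. *)
Lemma comp_subst P a G l M A :
  typing P G l M A -> tabs_unit_tm M -> forall rl r rl' r' sl st s t,
  (forall n, n < ctx_locs G -> t (rl n) = comp_loc rl' (sl n)) ->
  (forall n, n < length (ctx_vars G) -> t (r n) = comp_val a rl' r' (s n)) ->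
  comp_tm a rl' r' (subst_tm sl st s M) = Untyped.subst t (comp_tm a rl r M).
Proof.
  intros H.
  eapply (typing_typings_ind P
    (fun G l M A => tabs_unit_tm M -> forall rl r rl' r' sl st s t,
       (forall n, n < ctx_locs G -> t (rl n) = comp_loc rl' (sl n)) ->
       (forall n, n < length (ctx_vars G) ->
          t (r n) = comp_val a rl' r' (s n)) ->
       comp_tm a rl' r' (subst_tm sl st s M) =
       Untyped.subst t (comp_tm a rl r M))
    (fun G l Ws Bs => Forall tabs_unit_val Ws -> forall rl r rl' r' sl st s t,
       (forall n, n < ctx_locs G -> t (rl n) = comp_loc rl' (sl n)) ->
       (forall n, n < length (ctx_vars G) ->
          t (r n) = comp_val a rl' r' (s n)) ->
       map (comp_val a rl' r') (map (subst_val sl st s) Ws) =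
       map (Untyped.subst t) (map (comp_val a rl r) Ws)));
    try exact H; clear;
    cbn [comp_tm comp_val subst_tm subst_val Untyped.subst].
  - intros G l n A Hn _ rl r rl' r' sl st s t _ Hs. symmetry. apply Hs.
    apply nth_error_Some. congruence.
  - intros G l M N A B _ IHM _ IHN [HtM HtN] rl r rl' r' sl st s t Hl Hs.
    f_equal; [apply IHM; auto|]. apply IHN; [exact HtN | |].
    + apply comp_up_loc; auto.
    + apply comp_up_tm; auto.
  - intros G l Ws f Ls As Bs A HLs _ _ _ IH Ht rl r rl' r' sl st s t Hl Hs.
    apply (tabs_unit_Clo Ws (CName f Ls As)) in Ht. simpl.
    rewrite map_app. f_equal. f_equal; [|apply IH; auto].
    rewrite !map_map. apply map_ext_Forall. revert HLs. apply Forall_impl.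
    intros l1; apply subst_comp_loc; auto.
  - intros G l i V A1 A2 _ IH Ht rl r rl' r' sl st s t Hl Hs.
    f_equal. apply IH; auto.
  - intros G l V W A B _ IHV _ IHW [HtV HtW] rl r rl' r' sl st s t Hl Hs.
    f_equal; [apply IHV | apply IHW]; auto.
  - intros G l V A _ IH Ht rl r rl' r' sl st s t Hl Hs.
    apply tabs_unit_TLam in Ht as (V' & -> & Ht). simpl.
    specialize (IH client I Ht rl r rl' r' sl (up_ty st)
                  (fun n => shift_ty_val (s n)) t Hl).
    simpl in IH. enough (E : forall v w, Untyped.Unit v = Untyped.Unit w -> v = w).
    + apply E, IH. rewrite length_map. intros n Hn. unfold shift_ty_val.
      rewrite (proj1 (comp_ren a)). auto.
    + congruence.
  - intros G l V A B _ IH _ _ Ht rl r rl' r' sl st s t Hl Hs.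
    f_equal. apply IH; auto.
  - intros G l V A l1 _ IH Hl1 Ht rl r rl' r' sl st s t Hl Hs.
    f_equal; [apply IH; auto | eapply subst_comp_loc; eauto].
  - intros G l V A _ IH _ Ht rl r rl' r' sl st s t Hl Hs.
    f_equal. apply IH; auto.
  - intros G l M N A B _ IHM _ IHN [HtM HtN] rl r rl' r' sl st s t Hl Hs.
    f_equal; [apply IHM; auto|]. apply IHN; [exact HtN | |].
    + apply comp_up_loc; auto.
    + apply comp_up_tm; auto.
  - intros G l V W A B _ IHV _ IHW [HtV HtW] rl r rl' r' sl st s t Hl Hs.
    f_equal; [apply IHV | apply IHW]; auto.
  - intros G l l1 V W A B Hl1 _ IHV _ IHW _ [HtV HtW] rl r rl' r' sl st s t Hl Hs.
    rewrite subst_comp_gen. f_equal; [|apply IHV | apply IHW]; auto.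
    eapply subst_comp_loc; eauto.
  - intros G V W A B _ IHV _ IHW _ [HtV HtW] rl r rl' r' sl st s t Hl Hs.
    rewrite subst_comp_remote. f_equal; [apply IHV | apply IHW]; auto.
  - intros G V W A B _ IHV _ IHW _ [HtV HtW] rl r rl' r' sl st s t Hl Hs.
    rewrite subst_comp_remote. f_equal; [apply IHV | apply IHW]; auto.
  - reflexivity.
  - intros G l W Ws B Bs _ IHW _ IHWs Ht rl r rl' r' sl st s t Hl Hs.
    inversion Ht; subst. simpl. f_equal; [apply IHW | apply IHWs]; auto.
Qed.

Lemma comp_value a V rl r : Untyped.value (comp_val a rl r V).
Proof.
  revert V rl r.
  enough (H : (forall V rl r, Untyped.value (comp_val a rl r V)) /\
              (forall M : tm, True)) by apply H.
  apply val_tm_ind; simpl; intros; auto; try (constructor; auto; fail).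
  - destruct F as [f Ls As]. constructor. apply Forall_app; split.
    + apply Forall_map, Forall_forall. intros [[]|] _; repeat constructor.
    + apply Forall_map. revert H; apply Forall_impl; auto.
  - specialize (H rl r). destruct V; auto. inversion H; auto.
  - destruct a; simpl; constructor; destruct l as [[]|]; repeat constructor.
Qed.

(** * Composition of substitutions in terms *)

Lemma up_ty_ren st rt :
  (fun n => up_ty st (up_ren rt n)) = up_ty (fun n => st (rt n)).
Proof. apply functional_extensionality; intros [|n]; reflexivity. Qed.

Lemma ren_up_ty rl rt st :
  (fun n => ren_ty rl (up_ren rt) (up_ty st n)) =
  up_ty (fun n => ren_ty rl rt (st n)).
Proof.
  apply functional_extensionality; intros [|n]; simpl; auto.
  rewrite !ren_ty_comp; reflexivity.
Qed.

Lemma subst_up_ty sl st st' :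
  (fun n => subst_ty sl (up_ty st) (up_ty st' n)) =
  up_ty (fun n => subst_ty sl st (st' n)).
Proof.
  apply functional_extensionality; intros [|n]; simpl; auto.
  apply subst_ty_up_ren.
Qed.

Lemma ren_cname_comp rl rt rl' rt' F :
  ren_cname rl rt (ren_cname rl' rt' F) =
  ren_cname (fun n => rl (rl' n)) (fun n => rt (rt' n)) F.
Proof.
  destruct F; simpl. rewrite !map_map. f_equal; apply map_ext; intros.
  - destruct a; reflexivity.
  - apply ren_ty_comp.
Qed.

Lemma subst_ren_cname sl st rl rt F :
  subst_cname sl st (ren_cname rl rt F) =
  subst_cname (fun n => sl (rl n)) (fun n => st (rt n)) F.
Proof.
  destruct F; simpl. rewrite !map_map. f_equal; apply map_ext; intros.
  - destruct a; reflexivity.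
  - apply subst_ren_ty.
Qed.

Lemma ren_subst_cname rl rt sl st F :
  ren_cname rl rt (subst_cname sl st F) =
  subst_cname (fun n => ren_loc rl (sl n)) (fun n => ren_ty rl rt (st n)) F.
Proof.
  destruct F; simpl. rewrite !map_map. f_equal; apply map_ext; intros.
  - destruct a; reflexivity.
  - apply ren_subst_ty.
Qed.

Lemma subst_cname_comp sl st sl' st' F :
  subst_cname sl st (subst_cname sl' st' F) =
  subst_cname (fun n => subst_loc sl (sl' n)) (fun n => subst_ty sl st (st' n)) F.
Proof.
  destruct F; simpl. rewrite !map_map. f_equal; apply map_ext; intros.
  - apply subst_loc_comp.
  - apply subst_ty_comp.
Qed.

Lemma ren_tm_comp :
  (forall V rl rt r rl' rt' r',
     ren_val rl rt r (ren_val rl' rt' r' V) =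
     ren_val (fun n => rl (rl' n)) (fun n => rt (rt' n)) (fun n => r (r' n)) V) /\
  (forall M rl rt r rl' rt' r',
     ren_tm rl rt r (ren_tm rl' rt' r' M) =
     ren_tm (fun n => rl (rl' n)) (fun n => rt (rt' n)) (fun n => r (r' n)) M).
Proof.
  apply val_tm_ind; simpl; intros; auto;
    try (rewrite ?H, ?H0, ?ren_ty_comp, <- ?up_ren_comp; reflexivity).
  - rewrite ren_cname_comp, map_map. f_equal.
    apply map_ext_Forall; revert H; apply Forall_impl; auto.
  - rewrite H, H0. destruct l; reflexivity.
  - rewrite H. destruct l; reflexivity.
Qed.

Lemma subst_ren_tm :
  (forall V sl st s rl rt r,
     subst_val sl st s (ren_val rl rt r V) =
     subst_val (fun n => sl (rl n)) (fun n => st (rt n)) (fun n => s (r n)) V) /\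
  (forall M sl st s rl rt r,
     subst_tm sl st s (ren_tm rl rt r M) =
     subst_tm (fun n => sl (rl n)) (fun n => st (rt n)) (fun n => s (r n)) M).
Proof.
  assert (Hup : forall s r,
    (fun n => up_tm s (up_ren r n)) = up_tm (fun n => s (r n))).
  { intros; apply functional_extensionality; intros [|n]; reflexivity. }
  apply val_tm_ind; simpl; intros; auto;
    try (rewrite ?H, ?H0, ?subst_ren_ty, ?Hup, ?up_ty_ren; reflexivity).
  - rewrite subst_ren_cname, map_map. f_equal.
    apply map_ext_Forall; revert H; apply Forall_impl; auto.
  - rewrite H, H0. destruct l; reflexivity.
  - rewrite H. destruct l; reflexivity.
Qed.

Lemma ren_up_tm rl rt r s :
  (fun n => ren_val rl rt (up_ren r) (up_tm s n)) =
  up_tm (fun n => ren_val rl rt r (s n)).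
Proof.
  apply functional_extensionality; intros [|n]; simpl; auto.
  rewrite !(proj1 ren_tm_comp); reflexivity.
Qed.

Lemma ren_subst_tm :
  (forall V rl rt r sl st s,
     ren_val rl rt r (subst_val sl st s V) =
     subst_val (fun n => ren_loc rl (sl n)) (fun n => ren_ty rl rt (st n))
       (fun n => ren_val rl rt r (s n)) V) /\
  (forall M rl rt r sl st s,
     ren_tm rl rt r (subst_tm sl st s M) =
     subst_tm (fun n => ren_loc rl (sl n)) (fun n => ren_ty rl rt (st n))
       (fun n => ren_val rl rt r (s n)) M).
Proof.
  apply val_tm_ind; simpl; intros; auto;
    try (rewrite ?H, ?H0, ?ren_subst_ty, ?ren_up_tm; reflexivity).
  - rewrite ren_subst_cname, map_map. f_equal.
    apply map_ext_Forall; revert H; apply Forall_impl; auto.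
  - rewrite H, ren_up_ty. do 2 f_equal. apply functional_extensionality.
    intros n. unfold shift_ty_val. rewrite !(proj1 ren_tm_comp); reflexivity.
  - rewrite H, H0. destruct l; reflexivity.
  - rewrite H. destruct l; reflexivity.
Qed.

Lemma subst_up_tm sl st s s' :
  (fun n => subst_val sl st (up_tm s) (up_tm s' n)) =
  up_tm (fun n => subst_val sl st s (s' n)).
Proof.
  apply functional_extensionality; intros [|n]; simpl; auto.
  rewrite (proj1 subst_ren_tm), (proj1 ren_subst_tm). simpl.
  f_equal; apply functional_extensionality; intros m.
  - rewrite ren_loc_id; reflexivity.
  - rewrite ren_ty_id; reflexivity.
Qed.

Lemma subst_tm_comp :
  (forall V sl st s sl' st' s',
     subst_val sl st s (subst_val sl' st' s' V) =
     subst_val (fun n => subst_loc sl (sl' n)) (fun n => subst_ty sl st (st' n))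
       (fun n => subst_val sl st s (s' n)) V) /\
  (forall M sl st s sl' st' s',
     subst_tm sl st s (subst_tm sl' st' s' M) =
     subst_tm (fun n => subst_loc sl (sl' n)) (fun n => subst_ty sl st (st' n))
       (fun n => subst_val sl st s (s' n)) M).
Proof.
  apply val_tm_ind; simpl; intros; auto;
    try (rewrite ?H, ?H0, ?subst_ty_comp, ?subst_loc_comp, ?subst_up_tm;
         reflexivity).
  - rewrite subst_cname_comp, map_map. f_equal.
    apply map_ext_Forall; revert H; apply Forall_impl; auto.
  - rewrite H, subst_up_ty. do 2 f_equal. apply functional_extensionality.
    intros n. unfold shift_ty_val.
    rewrite (proj1 subst_ren_tm), (proj1 ren_subst_tm). simpl.
    f_equal; apply functional_extensionality; intros m.
    rewrite ren_loc_id; reflexivity.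
Qed.

Lemma up_ty_id : up_ty TVar = TVar.
Proof. apply functional_extensionality; intros [|n]; reflexivity. Qed.

Lemma up_tm_id : up_tm Var = Var.
Proof. apply functional_extensionality; intros [|n]; reflexivity. Qed.

Lemma subst_tm_id :
  (forall V, subst_val LVar TVar Var V = V) /\
  (forall M, subst_tm LVar TVar Var M = M).
Proof.
  apply val_tm_ind; simpl; intros;
    rewrite ?up_ty_id, ?up_tm_id, ?subst_loc_id, ?subst_ty_id; try congruence.
  - f_equal; [apply map_id_Forall; auto|]. destruct F as [f Ls As]; simpl.
    rewrite (map_ext _ _ subst_loc_id), (map_ext _ _ subst_ty_id), !map_id.
    reflexivity.
  - f_equal. exact H.
Qed.

Lemma ren_tm_id :
  (forall V, ren_val (fun n => n) (fun n => n) (fun n => n) V = V) /\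
  (forall M, ren_tm (fun n => n) (fun n => n) (fun n => n) M = M).
Proof.
  apply val_tm_ind; simpl; intros;
    rewrite ?up_ren_id, ?ren_loc_id, ?ren_ty_id; try congruence.
  f_equal; [apply map_id_Forall; auto|]. destruct F as [f Ls As]; simpl.
  rewrite (map_ext _ _ ren_loc_id), (map_ext _ _ ren_ty_id), !map_id.
  reflexivity.
Qed.

(** Typing stands in for a scoping judgement: the context bounds the free term variables. *)
Lemma subst_tm_ext P G l M A :
  typing P G l M A -> forall sl st s s',
  (forall n, n < length (ctx_vars G) -> s n = s' n) ->
  subst_tm sl st s M = subst_tm sl st s' M.
Proof.
  intros H.
  eapply (typing_typings_ind P
    (fun G l M A => forall sl st s s',
       (forall n, n < length (ctx_vars G) -> s n = s' n) ->
       subst_tm sl st s M = subst_tm sl st s' M)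
    (fun G l Ws Bs => forall sl st s s',
       (forall n, n < length (ctx_vars G) -> s n = s' n) ->
       map (subst_val sl st s) Ws = map (subst_val sl st s') Ws));
    try exact H; clear.
  - intros G l n A Hn sl st s s' Hs. simpl. rewrite Hs; auto.
    apply nth_error_Some. congruence.
  - intros G l M N A B _ IHM _ IHN sl st s s' Hs. simpl. f_equal; auto.
    apply IHN. intros [|n] Hn; simpl; auto. rewrite Hs; auto. simpl in Hn; lia.
  - intros G l Ws f Ls As Bs A _ _ _ _ IH sl st s s' Hs. simpl.
    rewrite (IH sl st s s'); auto.
  - intros G l i V A1 A2 _ IH sl st s s' Hs. specialize (IH sl st s s' Hs).
    simpl in *. congruence.
  - intros G l V W A B _ IHV _ IHW sl st s s' Hs.
    specialize (IHV sl st s s' Hs). specialize (IHW sl st s s' Hs).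
    simpl in *. congruence.
  - intros G l V A _ IH sl st s s' Hs. simpl. do 2 f_equal.
    assert (E : subst_tm sl (up_ty st) (fun n => shift_ty_val (s n)) (Val V) =
                subst_tm sl (up_ty st) (fun n => shift_ty_val (s' n)) (Val V)).
    { apply (IH client I). simpl. rewrite length_map. intros n Hn.
      rewrite Hs; auto. }
    simpl in E. congruence.
  - intros G l V A B _ IH _ _ sl st s s' Hs. specialize (IH sl st s s' Hs).
    simpl in *. congruence.
  - intros G l V A l' _ IH _ sl st s s' Hs. specialize (IH sl st s s' Hs).
    simpl in *. congruence.
  - intros G l V A _ IH _ sl st s s' Hs. specialize (IH sl st s s' Hs).
    simpl in *. congruence.
  - intros G l M N A B _ IHM _ IHN sl st s s' Hs. simpl. do 2 f_equal; auto.
    apply IHN. intros [|n] Hn; simpl; auto. rewrite Hs; auto. simpl in Hn; lia.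
  - intros G l V W A B _ IHV _ IHW sl st s s' Hs.
    specialize (IHV sl st s s' Hs). specialize (IHW sl st s s' Hs).
    simpl in *. congruence.
  - intros G l l' V W A B _ _ IHV _ IHW _ sl st s s' Hs.
    specialize (IHV sl st s s' Hs). specialize (IHW sl st s s' Hs).
    simpl in *. congruence.
  - intros G V W A B _ IHV _ IHW _ sl st s s' Hs.
    specialize (IHV sl st s s' Hs). specialize (IHW sl st s s' Hs).
    simpl in *. congruence.
  - intros G V W A B _ IHV _ IHW _ sl st s s' Hs.
    specialize (IHV sl st s s' Hs). specialize (IHW sl st s s' Hs).
    simpl in *. congruence.
  - reflexivity.
  - intros G l W Ws B Bs _ IHW _ IHWs sl st s s' Hs.
    specialize (IHW sl st s s' Hs). specialize (IHWs sl st s s' Hs).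
    simpl in *. congruence.
Qed.

(** * Closed terms and code instances *)

Definition ok (P : split) (a : location) (M : tm) (A : ty) : Prop :=
  typing P empty_ctx a M A /\ tabs_unit_tm M.

Lemma movable_val V A : relocatable A -> movable (Val V) A.
Proof. destruct V; simpl; auto. Qed.

Lemma ok_move P a b V A :
  ok P a (Val V) A -> relocatable A ->
  ok P b (Val V) A /\
  comp_closed a (Val V) = comp_closed b (Val V).
Proof.
  intros [HV Ht] HA.
  destruct (relocation P _ _ _ _ (fun n => n) (fun n => n) HV (Forall_nil _) Ht
              (movable_val V A HA)) as (E & Hl & _).
  split; [split; auto|]. unfold comp_closed. destruct a, b; congruence.
Qed.

Lemma typing_inst_Var P G G' l M A sl st :
  typing P G l M A -> tabs_unit_tm M -> subst_wf G G' sl st ->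
  ctx_vars G' = map (subst_ty sl st) (ctx_vars G) ->
  typing P G' (subst_loc sl l) (subst_tm sl st Var M) (subst_ty sl st A).
Proof.
  intros HM Ht Hwf HG.
  assert (Henv : forall Q l0, env_at P G G' sl st Var Q l0).
  { intros Q l0 n B HB _. apply ty_var. rewrite HG, nth_error_map, HB.
    reflexivity. }
  eapply typing_subst; eauto.
Qed.

(** [typing_subst] asks that values for variables of relocatable type be typed at every location.
    Here they are typed at [a] only, and [relocation] moves them; this is where the types in [Us]
    must not be relocatable. *)
Lemma typing_inst P a Us nl nt Ts l M A sl st s :
  typing P (Ctx nl nt Ts) l M A -> tabs_unit_tm M ->
  subst_wf (Ctx nl nt Ts) (Ctx 0 0 Us) sl st -> subst_loc sl l = LConst a ->
  Forall (fun B => ~ relocatable B) Us ->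
  (forall n, tabs_unit_val (s n)) ->
  (forall n B, nth_error Ts n = Some B ->
     typing P (Ctx 0 0 Us) a (Val (s n)) (subst_ty sl st B)) ->
  typing P (Ctx 0 0 Us) a (subst_tm sl st s M) (subst_ty sl st A).
Proof.
  intros HM Ht Hwf Hl HUs Hts Hs.
  eapply typing_subst; eauto.
  - intros l0 n B HB HBr.
    refine (proj1 (proj2 (relocation P _ _ _ _ (fun n => n) (fun n => n)
                            (Hs n B HB) HUs (Hts n) (movable_val _ _ _))) l0).
    destruct Hwf. apply relocatable_subst; auto.
  - left. split; auto. intros n B HB _. auto.
Qed.

Lemma subst_wf_id Ts Us : subst_wf (Ctx 0 0 Ts) (Ctx 0 0 Us) LVar TVar.
Proof. split; simpl; auto; intros; lia. Qed.

Lemma ok_weaken P a V A Us :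
  ok P a (Val V) A -> typing P (Ctx 0 0 Us) a (Val V) A.
Proof.
  intros [HV _].
  rewrite <- (proj1 ren_tm_id V), <- (ren_ty_id A).
  apply (typing_ren P empty_ctx a (Val V)); auto.
  intros [|n] B HB; discriminate.
Qed.

Lemma ok_subst P a M A sl st s s' :
  ok P a M A -> subst_tm sl st s M = subst_tm sl st s' M.
Proof.
  intros [HM _]. eapply subst_tm_ext; eauto. simpl; intros; lia.
Qed.

Lemma ok_subst_id P a V A s :
  ok P a (Val V) A -> subst_val LVar TVar s V = V.
Proof.
  intros HV. pose proof (ok_subst P a (Val V) A LVar TVar s Var HV) as E.
  simpl in E. rewrite (proj1 subst_tm_id) in E. congruence.
Qed.

Lemma typings_nth P G l Ws Bs :
  typings P G l Ws Bs ->
  length Ws = length Bs /\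
  forall n B, nth_error Bs n = Some B ->
    exists W, nth_error Ws n = Some W /\ typing P G l (Val W) B.
Proof.
  induction 1 as [G l|G l W Ws B Bs HW HWs [IHl IH]]; simpl.
  - split; auto. intros [|n] B HB; discriminate.
  - split; auto. intros [|n] C HC; simpl in *; eauto.
    inversion HC; subst; eauto.
Qed.

Lemma NoDup_names (L : funmap) b b' :
  NoDup (map b_name L) -> In b L -> In b' L -> b_name b = b_name b' -> b = b'.
Proof.
  induction L as [|c L IH]; simpl; intros Hnd Hb Hb' E; [tauto|].
  inversion Hnd as [|x xs Hx Hxs]; subst.
  destruct Hb as [->|Hb], Hb' as [->|Hb']; auto.
  - destruct Hx. rewrite E. apply in_map; auto.
  - destruct Hx. rewrite <- E. apply in_map; auto.
Qed.

Lemma wf_loc_const l : wf_loc 0 l -> exists a, l = LConst a.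
Proof. destruct l; simpl; [eauto | lia]. Qed.

Lemma sapp_app {X : Type} (xs ys : list X) s n :
  sapp (xs ++ ys) s n = sapp xs (sapp ys s) n.
Proof. unfold sapp. rewrite fold_right_app. reflexivity. Qed.

(* The inner substitution instantiates the location variables only, as [fetch]
   does; compiled code receives them with the rest of its environment. *)
Lemma subst_loc_env (v : Untyped.tm) ls ws k m :
  length ls = k -> Forall (fun l => forall t, Untyped.subst t l = l) ls ->
  Untyped.subst (scons v (sapp (ls ++ ws) Untyped.Var))
    (Untyped.subst (scons (Untyped.Var 0)
       (sapp ls (fun n => Untyped.Var (S (k + n))))) m) =
  Untyped.subst (scons v (sapp (ls ++ ws) Untyped.Var)) m.
Proof.
  intros <- Hls. rewrite untyped_subst_comp. f_equal.
  apply functional_extensionality. intros [|n]; simpl; auto.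
  destruct (nth_error ls n) as [l|] eqn:Hn.
  - rewrite sapp_app, !(sapp_nth _ _ _ _ Hn).
    rewrite Forall_forall in Hls. apply Hls. eapply nth_error_In; eauto.
  - apply nth_error_None in Hn. replace n with (length ls + (n - length ls)) by lia.
    rewrite sapp_add. reflexivity.
Qed.

Lemma closed_locs rl Ls :
  Forall (wf_loc 0) Ls ->
  Forall (fun l => forall t, Untyped.subst t l = l) (map (comp_loc rl) Ls).
Proof.
  intros H. apply Forall_map. revert H. apply Forall_impl. intros l Hl.
  apply wf_loc_const in Hl as [[] ->]; reflexivity.
Qed.

Lemma sapp_comp_locs rl Ls s n :
  Forall (wf_loc 0) Ls -> n < length Ls ->
  sapp (map (comp_loc (fun n => n)) Ls) s n = comp_loc rl (sapp Ls LVar n).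
Proof.
  intros H Hn. destruct (nth_error Ls n) as [l|] eqn:E;
    [|apply nth_error_None in E; lia].
  rewrite (sapp_nth _ _ _ _ E).
  erewrite sapp_nth by (rewrite nth_error_map, E; reflexivity).
  apply nth_error_In in E. rewrite Forall_forall in H.
  apply H, wf_loc_const in E as [[] ->]; reflexivity.
Qed.

Section CodeInst.
Variables (P : split) (Phi : program).
Hypotheses (Hwf : well_formed P Phi) (Htabs : tabs_unit_program Phi).

Lemma phi_in_split a b :
  In b (phi Phi a) -> In b (own_client P ++ own_server P ++ common P).
Proof.
  destruct Hwf as [_ Hc Hs _]. rewrite !in_app_iff.
  destruct a; simpl; intros H;
    [apply (Permutation_in _ Hc) in H | apply (Permutation_in _ Hs) in H];
    rewrite in_app_iff in H; tauto.
Qed.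

Lemma map_at_in_split l b :
  In b (map_at P l) -> In b (own_client P ++ own_server P ++ common P).
Proof. rewrite !in_app_iff. destruct l as [[]|]; simpl; tauto. Qed.

Lemma phi_tabs a b : In b (phi Phi a) -> tabs_unit_binding b.
Proof.
  destruct Htabs as [Hc Hs]. rewrite Forall_forall in Hc, Hs.
  destruct a; simpl; auto.
Qed.

Lemma comp_funmap_in a f T c :
  In (Bind f T c) (phi Phi a) ->
  In (f, comp_code a c) (comp_funmap a (phi Phi a)).
Proof. intros H. exact (in_map _ _ _ H). Qed.

Lemma subst_wf_code nl nt Bs Us Ls As :
  length Ls = nl -> length As = nt -> Forall (wf_loc 0) Ls ->
  Forall (wf_ty 0 0) As -> Forall relocatable As ->
  subst_wf (Ctx nl nt Bs) (Ctx 0 0 Us) (sapp Ls LVar) (sapp As TVar).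
Proof.
  intros <- <- HLs HAs Hr. split; simpl.
  - intros n Hn. apply Forall_sapp; auto.
  - intros n Hn. apply Forall_sapp; auto.
  - apply relocatable_sapp; auto.
Qed.

(** One compiled body [m] serves all instances of the code, since it receives the locations at run
    time. It therefore agrees with the compilation of the instance [M] only after the location
    arguments have been supplied, by any [t] whose block begins with them. *)
Lemma code_inst_lam a f Ls As nz M Bs D l C :
  fetch (phi Phi a) (CName f Ls As) nz (Lam M) ->
  code_typing P (CName f Ls As) Bs (TArr D l C) ->
  Forall (wf_loc 0) Ls -> Forall (wf_ty 0 0) As ->
  typing P (Ctx 0 0 (D :: Bs)) l M C /\ tabs_unit_tm M /\
  exists m,
    In (f, Untyped.Code (length Ls + nz) m) (comp_funmap a (phi Phi a)) /\
    forall v ws,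
      let t := scons v (sapp (map (comp_loc (fun n => n)) Ls ++ ws)
                          Untyped.Var) in
      Untyped.subst t m =
      Untyped.subst t
        (comp_tm a S (scons 0 (fun i => S (length Ls + i))) M).
Proof.
  intros HF HT HLs HAs.
  inversion HF as [f0 T nl nt nz0 c Ls0 As0 Hin HlL HlA]; subst.
  destruct c as [M0|]; [|discriminate]. simpl in *.
  match goal with H : Lam _ = Lam _ |- _ => injection H as <- end.
  inversion HT as
    [f1 nl1 nt1 Bs1 D1 l1 C1 M1 Ls1 As1 Hin1 Hwf1 HM1 HlL1 HlA1 HAr HBr|]; subst.
  (* [fetch] consults the map of the program, [code_typing] a map of the split. As names are
     distinct, both find the same binding, so the derivation is about the body that is executed. *)
  assert (E : Bind f T (Code (length Ls) (length As) nz (Lam M0)) =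
              Bind f (CodeTy (length Ls) (length As) Bs1 (TArr D1 l1 C1))
                (Code (length Ls) (length As) (length Bs1) (Lam M1))).
  { apply (NoDup_names _ _ _ (wf_distinct _ _ Hwf)); auto.
    - eapply phi_in_split; eauto.
    - eapply map_at_in_split; eauto. }
  injection E as -> -> ->.
  pose proof (phi_tabs _ _ Hin) as Ht. simpl in Ht.
  split; [|split].
  - eapply typing_inst_Var; eauto. apply subst_wf_code; auto.
  - apply tabs_unit_subst; simpl; auto.
  - eexists. split; [exact (comp_funmap_in _ _ _ _ Hin)|]. intros v ws.
    simpl. symmetry.
    rewrite (comp_subst P a _ _ _ _ HM1 Ht S (scons 0 (fun i => S (length Ls + i)))
               S _ (sapp Ls LVar) (sapp As TVar) Var
               (scons (Untyped.Var 0)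
                 (sapp (map (comp_loc (fun n => n)) Ls)
                   (fun n => Untyped.Var (S (length Ls + n)))))); simpl.
    + apply subst_loc_env; auto using closed_locs, length_map.
    + intros n Hn. apply sapp_comp_locs; auto.
    + intros [|n] Hn; simpl; auto.
      rewrite <- (length_map (comp_loc (fun n => n)) Ls), sapp_add.
      rewrite length_map; reflexivity.
Qed.

Lemma code_inst_llam a f Ls As nz V Bs D :
  fetch (phi Phi a) (CName f Ls As) nz (LLam V) ->
  code_typing P (CName f Ls As) Bs (TLAll D) ->
  Forall (wf_loc 0) Ls -> Forall (wf_ty 0 0) As ->
  typing P (Ctx 1 0 (map shift_loc_ty Bs)) a (Val V) D /\ tabs_unit_val V /\
  exists m,
    In (f, Untyped.Code (length Ls + nz) m) (comp_funmap a (phi Phi a)) /\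
    forall v ws,
      let t := scons v (sapp (map (comp_loc (fun n => n)) Ls ++ ws)
                          Untyped.Var) in
      Untyped.subst t m =
      Untyped.subst t
        (comp_val a (fun l => l) (fun i => S (length Ls + i)) V).
Proof.
  intros HF HT HLs HAs.
  inversion HF as [f0 T nl nt nz0 c Ls0 As0 Hin HlL HlA]; subst.
  destruct c as [|V0]; [discriminate|]. simpl in *.
  match goal with H : LLam _ = LLam _ |- _ => injection H as <- end.
  inversion HT as
    [|f1 nl1 nt1 Bs1 D1 V1 Ls1 As1 Hin1 Hwf1 HV1 HlL1 HlA1 HAr HBr]; subst.
  assert (E : Bind f T (Code (length Ls) (length As) nz (LLam V0)) =
              Bind f (CodeTy (length Ls) (length As) Bs1 (TLAll D1))
                (Code (length Ls) (length As) (length Bs1) (LLam V1))).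
  { apply (NoDup_names _ _ _ (wf_distinct _ _ Hwf)); auto.
    - eapply phi_in_split; eauto.
    (* Any location variable denotes [common P]. *)
    - apply (map_at_in_split (LVar 0)); auto. }
  injection E as -> -> ->.
  pose proof (phi_tabs _ _ Hin) as Ht. simpl in Ht. specialize (HV1 a I).
  split; [|split].
  - eapply (typing_inst_Var P _ (Ctx 1 0 _) a (Val V1)); eauto.
    + pose proof (subst_wf_code _ _ Bs1 [] Ls As eq_refl eq_refl HLs HAs HAr)
        as [Hl Hty Hr]. split; simpl in *.
      * intros [|n] Hn; simpl; [lia|]. assert (Hn' : n < length Ls) by lia.
        apply Hl, wf_loc_const in Hn' as [b ->]. exact I.
      * intros n Hn. apply wf_ty_ren with (nl := 0) (nt := 0); auto.
        intros; lia.
      * intros n. apply relocatable_ren; auto.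
    + simpl. rewrite !map_map. apply map_ext. intros B. unfold shift_loc_ty.
      rewrite subst_ren_ty, ren_subst_ty. reflexivity.
  - apply tabs_unit_subst; simpl; auto.
  - eexists. split; [exact (comp_funmap_in _ _ _ _ Hin)|]. intros v ws.
    simpl. symmetry.
    pose proof (comp_subst P a _ _ _ _ HV1 Ht
      (fun l => l) (fun i => S (length Ls + i))
      (fun l => l) (fun i => S (length Ls + i))
      (up_loc (sapp Ls LVar)) (fun n => shift_loc_ty (sapp As TVar n)) Var
      (scons (Untyped.Var 0)
         (sapp (map (comp_loc (fun n => n)) Ls)
            (fun n => Untyped.Var (S (length Ls + n)))))) as E.
    simpl in E. rewrite E.
    + apply subst_loc_env; auto using closed_locs, length_map.
    + intros [|n] Hn; simpl; auto. rewrite comp_loc_ren.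
      apply sapp_comp_locs; auto. lia.
    + intros n Hn.
      rewrite <- (length_map (comp_loc (fun n => n)) Ls), sapp_add.
      rewrite length_map; reflexivity.
Qed.
End CodeInst.

Lemma typing_inst_id P (a : location) Us Ts M A s :
  typing P (Ctx 0 0 Ts) a M A -> tabs_unit_tm M ->
  Forall (fun B => ~ relocatable B) Us ->
  (forall n, tabs_unit_val (s n)) ->
  (forall n B, nth_error Ts n = Some B ->
     typing P (Ctx 0 0 Us) a (Val (s n)) B) ->
  typing P (Ctx 0 0 Us) a (subst_tm LVar TVar s M) A.
Proof.
  intros HM Ht HUs Hts Hs. rewrite <- (subst_ty_id A).
  eapply typing_inst; eauto using subst_wf_id.
  intros n B HB. rewrite subst_ty_id. auto.
Qed.

Lemma tabs_scons_Var V :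
  tabs_unit_val V -> forall n, tabs_unit_val (scons V Var n).
Proof. intros H [|n]; simpl; auto. Qed.

Lemma tabs_sapp_Var Ws :
  Forall tabs_unit_val Ws -> forall n, tabs_unit_val (sapp Ws Var n).
Proof. intros H n. apply Forall_sapp; simpl; auto. Qed.

Lemma ok_inst P a V N A B :
  ok P a (Val V) A -> typing P (Ctx 0 0 [A]) a N B -> tabs_unit_tm N ->
  ok P a (subst_tm LVar TVar (scons V Var) N) B.
Proof.
  intros [HV HtV] HN HtN. split.
  - eapply typing_inst_id; eauto using tabs_scons_Var.
    intros [|[|n]] C HC; inversion HC; subst. exact HV.
  - apply tabs_unit_subst; auto using tabs_scons_Var.
Qed.

Lemma comp_inst P (a : location) V N A B :
  typing P (Ctx 0 0 [A]) a N B -> tabs_unit_tm N ->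
  comp_closed a (subst_tm LVar TVar (scons V Var) N) =
  Untyped.subst (scons (comp_closed a (Val V)) Untyped.Var)
    (comp_tm a S (up_ren (fun n => n)) N).
Proof.
  intros HN HtN. eapply comp_subst; [exact HN | exact HtN | |]; simpl.
  { intros n Hn; lia. }
  intros [|n] Hn; [reflexivity | lia].
Qed.

Lemma comp_loc_value rl l : Untyped.value (comp_loc rl l).
Proof. destruct l as [[]|]; repeat constructor. Qed.

(** * Subject reduction and simulation of local steps *)

Section Local.
Variables (P : split) (Phi : program).
Hypotheses (Hwf : well_formed P Phi) (Htabs : tabs_unit_program Phi).

(** The equality is the case of type application, which costs no untyped step: the [Unit] that the
    compilation of [TLam] drops is the one that the compilation of [TApp] adds. *)
Lemma local_step_sound a M M' A :
  ok P a M A -> local_step (phi Phi a) M M' ->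
  ok P a M' A /\
  (comp_closed a M = comp_closed a M' \/
   Untyped.local_step (comp_funmap a (phi Phi a))
     (comp_closed a M) (comp_closed a M')).
Proof.
  intros [HM Ht] Hst. inversion Hst; subst; clear Hst.
  - inversion HM; subst. destruct Ht as [HtV HtN].
    split; [eapply ok_inst; [split; eassumption | eassumption | assumption]|]. right.
    erewrite comp_inst by eauto. apply Untyped.ls_let, comp_value.
  - inversion HM; subst. destruct Ht as [HtV HtN].
    match goal with H : typing _ _ _ (Val (Unit _)) _ |- _ =>
      inversion H; subst end.
    split; [eapply ok_inst; [split; eassumption | eassumption | assumption]|]. right.
    erewrite comp_inst by eauto. apply Untyped.ls_do, comp_value.
  - inversion HM; subst. destruct Ht as [HtV HtW].
    match goal with H : typing _ _ _ (Val (Pair _ _)) _ |- _ =>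
      inversion H; subst end.
    split; [split; auto|]. right. apply Untyped.ls_proj1; apply comp_value.
  - inversion HM; subst. destruct Ht as [HtV HtW].
    match goal with H : typing _ _ _ (Val (Pair _ _)) _ |- _ =>
      inversion H; subst end.
    split; [split; auto|]. right. apply Untyped.ls_proj2; apply comp_value.
  - inversion HM as [| | | | | | |G l V' A1 B HV HB HBr| | | | | | |]; subst.
    inversion HV as [| | | | | |G l V' A1' HV'| | | | | | | |]; subst.
    specialize (HV' a I).
    assert (Hok : ok P a (subst_tm LVar (scons A0 TVar) Var (Val V))
                    (subst_ty LVar (scons A0 TVar) A1)).
    { apply tabs_unit_TLam in Ht as (V' & -> & Ht). split.
      - apply (typing_inst P a [] 0 1 [] a (Val (Unit V'))); simpl; auto.
        + split; simpl; intros; try lia.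
          * replace n with 0 by lia. exact HB.
          * destruct n; simpl; auto.
        + intros [|n] C HC; discriminate.
      - apply (proj1 tabs_unit_subst (Unit V')); simpl; auto. }
    split; [exact Hok|]. left.
    pose proof (comp_subst P a _ _ _ _ HV'
      (ltac:(apply tabs_unit_TLam in Ht as (V' & -> & Ht); exact Ht))
      (fun n => n) (fun n => n) (fun n => n) (fun n => n)
      LVar (scons A0 TVar) Var Untyped.Var) as E.
    simpl in E. unfold comp_closed. simpl. rewrite E by (simpl; intros; lia).
    rewrite untyped_subst_id.
    apply tabs_unit_TLam in Ht as (V' & -> & Ht). reflexivity.
  - inversion HM as [| | | | | | | | | | |G l V' W A1 B HV HW| | |]; subst.
    destruct Ht as [HtC HtV].
    inversion HV as [| |G l Ws' f Ls As Bs T HLs HAs HF HWs| | | | | | | | | | | |];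
      subst.
    apply (tabs_unit_Clo Ws (CName f Ls As)) in HtC.
    match goal with H : fetch _ _ _ _ |- _ => rename H into Hfetch end.
    destruct (code_inst_lam P Phi Hwf Htabs _ _ _ _ _ _ _ _ _ _
                Hfetch HF HLs HAs) as (HM0 & Ht0 & m & Hin & Hm).
    apply typings_nth in HWs as [Hlen HWs].
    split.
    + split.
      * eapply typing_inst_id; [exact HM0 | exact Ht0 | constructor | |].
        -- intros [|n]; simpl; auto using tabs_sapp_Var.
        -- intros [|n] C HC; simpl in HC |- *.
           ++ inversion HC; subst. exact HW.
           ++ apply HWs in HC as (W & HWn & HW').
              rewrite (sapp_nth _ _ _ _ HWn). exact HW'.
      * apply tabs_unit_subst; auto.
        intros [|n]; simpl; auto using tabs_sapp_Var.
    + right.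
      pose proof (comp_subst P a _ _ _ _ HM0 Ht0
        S (scons 0 (fun i => S (length Ls + i))) (fun n => n) (fun n => n)
        LVar TVar (scons V (sapp Ws Var))
        (scons (comp_closed a (Val V))
           (sapp (map (comp_loc (fun n => n)) Ls ++
                  map (comp_val a (fun n => n) (fun n => n)) Ws) Untyped.Var)))
        as E.
      unfold comp_closed at 2. rewrite E, <- Hm; simpl.
      * apply Untyped.ls_app.
        -- apply Forall_app; split; apply Forall_map, Forall_forall;
             intros; [apply comp_loc_value | apply comp_value].
        -- apply comp_value.
        -- rewrite length_app, !length_map. exact Hin.
      * intros; lia.
      * intros [|n] Hn; simpl; auto.
        rewrite sapp_app, <- (length_map (comp_loc (fun n => n)) Ls), sapp_add.
        symmetry.
        rewrite (sapp_map (comp_val a (fun n => n) (fun n => n))).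
        apply sapp_ext. rewrite length_map, Hlen. lia.
  - inversion HM as [| | | | | | | |G l V' A1 l' HV Hl| | | | | |]; subst.
    inversion HV as [| |G l Ws' f Ls As Bs T HLs HAs HF HWs| | | | | | | | | | | |];
      subst.
    apply (tabs_unit_Clo Ws (CName f Ls As)) in Ht.
    match goal with H : fetch _ _ _ _ |- _ => rename H into Hfetch end.
    destruct (code_inst_llam P Phi Hwf Htabs _ _ _ _ _ _ _ _
                Hfetch HF HLs HAs) as (HV0 & Ht0 & m & Hin & Hm).
    apply typings_nth in HWs as [Hlen HWs].
    split.
    + split.
      * apply (typing_inst P a [] 1 0 (map shift_loc_ty Bs) a (Val V));
          auto using tabs_sapp_Var.
        -- split; simpl; intros; try lia; auto.
           replace n with 0 by lia. exact I.
        -- intros n C HC. rewrite nth_error_map in HC.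
           destruct (nth_error Bs n) as [C'|] eqn:HC'; inversion HC; subst.
           unfold shift_loc_ty. rewrite subst_ren_ty. simpl.
           change (subst_ty (fun n => LVar n)) with (subst_ty LVar).
           change (subst_ty LVar (fun n => TVar n)) with (subst_ty LVar TVar).
           rewrite subst_ty_id.
           apply HWs in HC' as (W & HWn & HW').
           rewrite (sapp_nth _ _ _ _ HWn). exact HW'.
      * apply (proj1 tabs_unit_subst V); auto using tabs_sapp_Var.
    + right.
      pose proof (comp_subst P a _ _ _ _ HV0 Ht0
        (fun l => l) (fun i => S (length Ls + i)) (fun n => n) (fun n => n)
        (scons (LConst b) LVar) TVar (sapp Ws Var)
        (scons (comp_loc (fun n => n) b)
           (sapp (map (comp_loc (fun n => n)) Ls ++
                  map (comp_val a (fun n => n) (fun n => n)) Ws) Untyped.Var)))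
        as E.
      simpl in E. unfold comp_closed at 2. simpl. rewrite E, <- Hm; simpl.
      * apply Untyped.ls_app.
        -- apply Forall_app; split; apply Forall_map, Forall_forall;
             intros; [apply comp_loc_value | apply comp_value].
        -- apply (comp_loc_value (fun n => n) b).
        -- rewrite length_app, !length_map. exact Hin.
      * intros [|n] Hn; [reflexivity | lia].
      * rewrite length_map. intros n Hn; simpl.
        rewrite sapp_app, <- (length_map (comp_loc (fun n => n)) Ls), sapp_add.
        symmetry.
        rewrite (sapp_map (comp_val a (fun n => n) (fun n => n))).
        apply sapp_ext. rewrite length_map, Hlen. lia.
Qed.
End Local.

(** * Evaluation that delays the computations bound by let *)

(** The excluded values include [Do (Unit V) M], which has a local step but belongs to [run]. A
    [Let] is left to [eval_let]. *)
Definition reducible (M : tm) : Prop :=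
  match M with Val _ | Let _ _ => False | _ => True end.

(** Computations of type [TMon _] are among the results and are performed by [run] alone. This
    separation is what delays them: a [Let] binds the unperformed computation. *)
Inductive eval (Phi : program) (a : location) : tm -> val -> Prop :=
| eval_val V : eval Phi a (Val V) V
| eval_let M N V W :
    eval Phi a M V -> eval Phi a (subst_tm LVar TVar (scons V Var) N) W ->
    eval Phi a (Let M N) W
| eval_red M M' V :
    reducible M -> local_step (phi Phi a) M M' -> eval Phi a M' V ->
    eval Phi a M V.

(* Running [V] at [a] applies [V1] to [W1] at [b], where [a = b] is possible for
   [Gen]. *)
Inductive remote : location -> val -> location -> val -> val -> Prop :=
| remote_req V1 W1 : remote client (Req V1 W1) server V1 W1
| remote_call V1 W1 : remote server (Call V1 W1) client V1 W1
| remote_gen a (b : location) V1 W1 : remote a (Gen b V1 W1) b V1 W1.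

Inductive run (Phi : program) : location -> val -> val -> Prop :=
| run_unit a U : run Phi a (Unit U) U
| run_do a M N V U W U' :
    eval Phi a M V -> run Phi a V U ->
    eval Phi a (subst_tm LVar TVar (scons U Var) N) W -> run Phi a W U' ->
    run Phi a (Do M N) U'
| run_remote a V b V1 W1 W U :
    remote a V b V1 W1 -> eval Phi b (App V1 W1) W -> run Phi b W U ->
    run Phi a V U.

Lemma typing_remote P Us a V b V1 W1 A :
  remote a V b V1 W1 -> typing P (Ctx 0 0 Us) a (Val V) A -> tabs_unit_val V ->
  exists B C, A = TMon C /\ relocatable B /\
    typing P (Ctx 0 0 Us) a (Val V1) (TClo (TArr B b (TMon C))) /\
    tabs_unit_val V1 /\ typing P (Ctx 0 0 Us) a (Val W1) B /\ tabs_unit_val W1.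
Proof.
  intros Hrem HV Ht. inversion Hrem; subst; inversion HV; subst; simpl in Ht;
    do 2 eexists; intuition eauto.
Qed.

(** The substitution leaves locations alone, so the form of a remote computation is visible before
    it, unless the whole computation has been substituted for a variable. *)
Lemma remote_unsubst a s V b V1 W1 :
  remote a (subst_val LVar TVar s V) b V1 W1 ->
  (exists n, V = Var n) \/ exists V' W', remote a V b V' W'.
Proof.
  destruct V as [n| | | | | |V W|V W|l V W]; simpl; intros H;
    inversion H; subst; eauto using remote_req, remote_call.
  destruct l; simpl in *; subst; [|discriminate].
  right. do 2 eexists.
  match goal with H : LConst _ = LConst _ |- _ => injection H as <- end.
  apply remote_gen.
Qed.

(** A closure type is always relocatable and the argument type is so by typing, hence both parts can
    be moved to [b] without changing their compilation. *)
Lemma ok_remote P a V b V1 W1 A :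
  remote a V b V1 W1 -> ok P a (Val V) A ->
  exists C, A = TMon C /\ ok P b (App V1 W1) (TMon C) /\
    comp_closed b (App V1 W1) =
    Untyped.App (comp_closed a (Val V1)) (comp_closed a (Val W1)).
Proof.
  intros Hrem [HV Ht].
  destruct (typing_remote P [] a V b V1 W1 A Hrem HV Ht)
    as (B & C & -> & HB & HV1 & Ht1 & HW1 & Ht2).
  destruct (ok_move P a b V1 _ (conj HV1 Ht1) I) as [[HV1' _] E1].
  destruct (ok_move P a b W1 _ (conj HW1 Ht2) HB) as [[HW1' _] E2].
  exists C. split; auto. split.
  - split; [eapply ty_app; eauto | split; auto].
  - rewrite E1, E2. reflexivity.
Qed.

Lemma ok_let P a M N B :
  ok P a (Let M N) B ->
  exists A, ok P a M A /\ typing P (Ctx 0 0 [A]) a N B /\ tabs_unit_tm N.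
Proof.
  intros [HM [Ht1 Ht2]]. inversion HM; subst. exists A. split; [split|]; auto.
Qed.

Lemma ok_do P a M N B :
  ok P a (Val (Do M N)) B ->
  exists A C, B = TMon C /\ ok P a M (TMon A) /\
    typing P (Ctx 0 0 [A]) a N (TMon C) /\ tabs_unit_tm N.
Proof.
  intros [HM [Ht1 Ht2]]. inversion HM; subst.
  do 2 eexists. split; [reflexivity|]. split; [split|]; eauto.
Qed.

Lemma subst_inst s V N :
  subst_tm LVar TVar s (subst_tm LVar TVar (scons V Var) N) =
  subst_tm LVar TVar (scons (subst_val LVar TVar s V) Var)
    (subst_tm LVar TVar (up_tm s) N).
Proof.
  rewrite !(proj2 subst_tm_comp). f_equal.
  apply functional_extensionality; intros [|n]; simpl; auto.
  rewrite (proj1 subst_ren_tm). symmetry. apply (proj1 subst_tm_id).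
Qed.

(** * Transfer of evaluations between related environments *)

Section Evaluation.
Variables (P : split) (Phi : program).
Hypotheses (Hwf : well_formed P Phi) (Htabs : tabs_unit_program Phi).

Lemma eval_ok a M V A : eval Phi a M V -> ok P a M A -> ok P a (Val V) A.
Proof.
  intros H; revert A; induction H; intros A HM; auto.
  - apply ok_let in HM as (B & HM & HN & HtN).
    apply IHeval2. eapply ok_inst; eauto.
  - apply IHeval. eapply local_step_sound; eauto.
Qed.

(** Each run ends in a [Unit], whose typing makes the result relocatable. This is what lets the
    result of a remote run move back to [a]. *)
Lemma run_ok a V U A :
  run Phi a V U -> ok P a (Val V) (TMon A) -> ok P a (Val U) A /\ relocatable A.
Proof.
  intros H; revert A; induction H; intros A HV.
  - destruct HV as [HV Ht]. inversion HV; subst. split; [split|]; auto.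
  - apply ok_do in HV as (B & C & [= <-] & HM & HN & HtN).
    apply IHrun2. eapply eval_ok; eauto. eapply ok_inst; eauto.
    apply IHrun1. eapply eval_ok; eauto.
  - destruct (ok_remote _ _ _ _ _ _ _ H HV) as (C & [= <-] & Happ & _).
    destruct (IHrun A) as [HU HA]; [eapply eval_ok; eauto|].
    split; auto. apply (ok_move P b a U A); auto.
Qed.

(* [s'] replaces computations of [s] by others that have at least the same
   results: the delayed form of computations that [s] has already performed. *)
Record simenv (a : location) (Ts : list ty) (s s' : nat -> val) : Prop := {
  se_mon : forall n B, nth_error Ts n = Some B -> exists C, B = TMon C;
  se_l : forall n B, nth_error Ts n = Some B -> ok P a (Val (s n)) B;
  se_r : forall n B, nth_error Ts n = Some B -> ok P a (Val (s' n)) B;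
  se_run : forall n B U, nth_error Ts n = Some B ->
    run Phi a (s n) U -> run Phi a (s' n) U;
  se_tabs_l : forall n, tabs_unit_val (s n);
  se_tabs_r : forall n, tabs_unit_val (s' n) }.

Lemma simenv_nonrelocatable a Ts s s' :
  simenv a Ts s s' -> Forall (fun B => ~ relocatable B) Ts.
Proof.
  intros [Hmon _ _ _ _ _]. apply Forall_forall. intros B HB.
  apply In_nth_error in HB as [n HB]. destruct (Hmon n B HB) as [C ->]. simpl. auto.
Qed.

Section Transfer.
Variables (a : location) (Ts : list ty) (s s' : nat -> val).
Hypothesis Hs : simenv a Ts s s'.

Lemma ok_subst_l M A :
  typing P (Ctx 0 0 Ts) a M A -> tabs_unit_tm M ->
  ok P a (subst_tm LVar TVar s M) A.
Proof.
  intros HM Ht. destruct Hs. split.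
  - eapply typing_inst_id; eauto. intros n B HB. apply se_l0; auto.
  - apply tabs_unit_subst; auto.
Qed.

Lemma subst_relocatable V A :
  typing P (Ctx 0 0 Ts) a (Val V) A -> tabs_unit_val V -> relocatable A ->
  subst_val LVar TVar s V = subst_val LVar TVar s' V.
Proof.
  intros HV Ht HA.
  destruct (relocation P _ _ _ _ (fun n => n) (fun n => n) HV
              (simenv_nonrelocatable _ _ _ _ Hs) Ht (movable_val V A HA))
    as (_ & _ & E).
  specialize (E LVar TVar s s'). simpl in E. congruence.
Qed.

(** If both substitutions give the same closed term, then they also give the same result [V], which
    is closed and so serves as its own preimage [V0]. *)
Lemma eval_transfer_eq M A V :
  typing P (Ctx 0 0 Ts) a M A -> tabs_unit_tm M ->
  subst_tm LVar TVar s M = subst_tm LVar TVar s' M ->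
  eval Phi a (subst_tm LVar TVar s M) V ->
  exists V0, typing P (Ctx 0 0 Ts) a (Val V0) A /\ tabs_unit_val V0 /\
    V = subst_val LVar TVar s V0 /\
    eval Phi a (subst_tm LVar TVar s' M) (subst_val LVar TVar s' V0).
Proof.
  intros HM Ht E Hev.
  assert (HV : ok P a (Val V) A) by (eapply eval_ok; eauto using ok_subst_l).
  exists V. rewrite !(ok_subst_id _ _ _ _ _ HV), <- E.
  repeat split; auto using ok_weaken. apply HV.
Qed.

Lemma var_mon n A :
  typing P (Ctx 0 0 Ts) a (Val (Var n)) A -> exists C, A = TMon C.
Proof. intros H. inversion H; subst. eapply se_mon; eauto. Qed.

(** Evaluation treats the variables of [Ts] uniformly: they stand for computations, and no rule of
    [eval] takes one apart. Hence the result is an instance of an open value [V0], and the same [V0]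
    works for the other substitution. *)
Lemma eval_transfer M1 V1 :
  eval Phi a M1 V1 -> forall M A,
  typing P (Ctx 0 0 Ts) a M A -> tabs_unit_tm M ->
  M1 = subst_tm LVar TVar s M ->
  exists V0, typing P (Ctx 0 0 Ts) a (Val V0) A /\ tabs_unit_val V0 /\
    V1 = subst_val LVar TVar s V0 /\
    eval Phi a (subst_tm LVar TVar s' M) (subst_val LVar TVar s' V0).
Proof.
  pose proof (simenv_nonrelocatable _ _ _ _ Hs) as HTs.
  induction 1 as [V1|M1 N1 V1 W1 HM1 IHM HN1 IHN|M1 M1' V1 Hred Hst HM1' IH];
    intros M A HM Ht E.
  - destruct M; try discriminate. injection E as ->.
    exists V. repeat split; auto. simpl. apply eval_val.
  - destruct M as [|M N| | | |]; try discriminate. injection E as -> ->.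
    inversion HM; subst. destruct Ht as [HtM HtN].
    edestruct IHM as (V0 & HV0 & HtV0 & -> & Hev0); eauto.
    edestruct (IHN (subst_tm LVar TVar (scons V0 Var) N))
      as (W0 & HW0 & HtW0 & -> & Hev1).
    + apply (typing_inst_id P a Ts (A0 :: Ts) N A); auto.
      * apply tabs_scons_Var; auto.
      * intros [|n] B HB; simpl in HB |- *; [|apply ty_var; auto].
        inversion HB; subst. exact HV0.
    + apply tabs_unit_subst; auto using tabs_scons_Var.
    + symmetry. apply subst_inst.
    + exists W0. repeat split; auto. simpl. eapply eval_let; eauto.
      rewrite <- subst_inst. exact Hev1.
  - destruct M as [V|M N|i V|V W|V B|V l]; subst M1; try contradiction.
    + simpl in Hst.
      assert (HV : exists A1 A2, typing P (Ctx 0 0 Ts) a (Val V) (TProd A1 A2) /\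
                A = match i with pr1 => A1 | pr2 => A2 end)
        by (inversion HM; subst; eauto).
      assert (HW : exists W1 W2, subst_val LVar TVar s V = Pair W1 W2 /\
                M1' = Val (match i with pr1 => W1 | pr2 => W2 end))
        by (inversion Hst; subst; eauto).
      destruct HV as (A1 & A2 & HV & ->), HW as (W1 & W2 & E & ->).
      (* A variable has a type [TMon _], so a value of product type is a pair already before
         substitution. *)
      destruct V; try discriminate.
      { apply var_mon in HV as [C HC]. discriminate. }
      simpl in E. injection E as <- <-. inversion HV; subst. destruct Ht.
      destruct (IH (Val (match i with pr1 => V2 | pr2 => V3 end))
                  (match i with pr1 => A1 | pr2 => A2 end))
        as (V0 & HV0 & HtV0 & -> & Hev); try (destruct i; assumption || reflexivity).
      exists V0. repeat split; auto. simpl.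
      eapply eval_red; [exact I | | exact Hev].
      destruct i; [apply ls_proj1 | apply ls_proj2].
    + inversion HM as [| | | | | | | | | | |G l V' W' A1 B HV HW| | |]; subst.
      destruct Ht as [HtV HtW].
      (* Closure types are relocatable, so both substitutions yield the same closed closure. Only
         the argument [W] can contain replaced computations. *)
      pose proof (subst_relocatable _ _ HV HtV I) as EV.
      pose proof (ok_subst_l _ _ HV HtV) as [HC HtC].
      simpl in Hst, HC, HtC |- *. rewrite <- EV.
      inversion Hst as [| | | | |Ws F V' M Hfetch E1 E2|]; subst.
      rewrite <- E1 in HC, HtC.
      inversion HC as [| |G l Ws' f Ls As Bs T HLs HAs HF HWs| | | | | | | | | | | |];
        subst.
      apply (tabs_unit_Clo Ws (CName f Ls As)) in HtC.
      destruct (code_inst_lam P Phi Hwf Htabs _ _ _ _ _ _ _ _ _ _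
                  Hfetch HF HLs HAs) as (HM0 & Ht0 & _).
      apply typings_nth in HWs as [Hlen HWs].
      assert (Hcl : forall n B, nth_error Bs n = Some B ->
                ok P a (Val (sapp Ws Var n)) B).
      { intros n B HB. split; [|apply tabs_sapp_Var; auto].
        apply HWs in HB as (W0 & HWn & HW0).
        rewrite (sapp_nth _ _ _ _ HWn). exact HW0. }
      assert (Eb : forall t,
        subst_tm LVar TVar t (subst_tm LVar TVar (scons W (sapp Ws Var)) M) =
        subst_tm LVar TVar
          (scons (subst_val LVar TVar t W) (sapp Ws Var)) M).
      { intros t. rewrite (proj2 subst_tm_comp).
        eapply (subst_tm_ext P _ _ _ _ HM0). intros [|n] Hn; simpl; auto.
        simpl in Hn. destruct (nth_error Bs n) as [B'|] eqn:HB;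
          [|apply nth_error_None in HB; lia].
        eapply ok_subst_id; eauto. }
      destruct (IH (subst_tm LVar TVar (scons W (sapp Ws Var)) M) A)
        as (V0 & HV0 & HtV0 & -> & Hev).
      * eapply typing_inst_id; [exact HM0 | exact Ht0 | exact HTs | |].
        -- intros [|n]; simpl; auto using tabs_sapp_Var.
        -- intros [|n] B HB; simpl in HB |- *; [|apply ok_weaken; auto].
           inversion HB; subst. exact HW.
      * apply tabs_unit_subst; auto.
        intros [|n]; simpl; auto using tabs_sapp_Var.
      * symmetry. apply Eb.
      * exists V0. repeat split; auto.
        eapply eval_red; [exact I | | exact Hev]. rewrite Eb.
        apply ls_app. exact Hfetch.
    (* In type and location applications the head has the relocatable type [TAll _] or [TClo _], so
       the whole term is the same under both substitutions. *)
    + eapply eval_transfer_eq; eauto.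
      * inversion HM; subst.
        match goal with H : typing _ _ _ (Val V) _ |- _ =>
          pose proof (subst_relocatable _ _ H Ht I) as EV end.
        simpl. congruence.
      * eapply eval_red; eauto.
    + eapply eval_transfer_eq; eauto.
      * inversion HM; subst.
        match goal with H : typing _ _ _ (Val V) _ |- _ =>
          pose proof (subst_relocatable _ _ H Ht I) as EV end.
        simpl. congruence.
      * eapply eval_red; eauto.
Qed.

(** If [V] is a variable, this is [se_run]. Otherwise the two runs proceed in parallel: an
    intermediate result is relocatable, hence closed and common to both, and so are the function and
    the argument of a remote call. *)
Lemma run_transfer V1 U :
  run Phi a V1 U -> forall V A,
  typing P (Ctx 0 0 Ts) a (Val V) (TMon A) -> tabs_unit_val V ->
  V1 = subst_val LVar TVar s V -> run Phi a (subst_val LVar TVar s' V) U.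
Proof.
  pose proof (simenv_nonrelocatable _ _ _ _ Hs) as HTs.
  intros H. remember a as a0 eqn:Ha in H.
  induction H as [a0 U|a0 M1 N1 X U1 Y U HM1 HX IHX HN1 HY IHY
                 |a0 V1 b W1 W2 X U Hrem Happ HX _];
    subst a0; intros V A HV Ht E.
  - destruct V as [n| | | |V| | | |]; try discriminate.
    { inversion HV; subst. eapply se_run; eauto. simpl in E. rewrite <- E. apply run_unit. }
    simpl in E |- *. injection E as ->. inversion HV; subst.
    erewrite subst_relocatable; eauto. apply run_unit.
  - destruct V as [n| | | | |M N| | |]; try discriminate.
    { inversion HV; subst. eapply se_run; eauto. simpl in E. rewrite <- E.
      eapply run_do; eauto. }
    simpl in E |- *. injection E as -> ->. inversion HV; subst.
    destruct Ht as [HtM HtN].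
    destruct (eval_transfer _ _ HM1 M (TMon A0))
      as (X0 & HX0 & HtX0 & -> & Hev0); auto.
    assert (HU1 : ok P a (Val U1) A0).
    { eapply run_ok; eauto. apply (ok_subst_l (Val X0)); auto. }
    pose proof (ok_subst_id P a U1 A0 s HU1) as EU.
    pose proof (ok_subst_id P a U1 A0 s' HU1) as EU'.
    destruct (eval_transfer _ _ HN1 (subst_tm LVar TVar (scons U1 Var) N) (TMon A))
      as (Y0 & HY0 & HtY0 & -> & Hev1).
    + apply (typing_inst_id P a Ts (A0 :: Ts) N (TMon A)); auto.
      * apply tabs_scons_Var, HU1.
      * intros [|n] B HB; simpl in HB |- *; [|apply ty_var; auto].
        inversion HB; subst. apply ok_weaken; auto.
    + apply tabs_unit_subst; auto. apply tabs_scons_Var, HU1.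
    + rewrite subst_inst, EU. reflexivity.
    + rewrite subst_inst, EU' in Hev1. eapply run_do; eauto.
  - subst V1. destruct (remote_unsubst _ _ _ _ _ _ Hrem) as [[n ->]|(V' & W' & HR)].
    { inversion HV; subst. eapply se_run; eauto. eapply run_remote; eauto. }
    destruct (typing_remote P Ts a V b V' W' _ HR HV Ht)
      as (B & C & _ & HB & HV' & HtV' & HW' & HtW').
    assert (E : subst_val LVar TVar s V = subst_val LVar TVar s' V).
    { pose proof (subst_relocatable _ _ HV' HtV' I).
      pose proof (subst_relocatable _ _ HW' HtW' HB).
      clear - HR H H0. inversion HR; subst; simpl; congruence. }
    rewrite <- E. eapply run_remote; eauto.
Qed.
End Transfer.

(** Two instances of one open value, instead of a relation by recursion on values: in a type that is
    not relocatable, such as a product, the computations to be replaced can sit deep inside the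
    value. *)
Definition sim (a : location) (A : ty) (V1 V2 : val) : Prop :=
  exists Ts s s' V,
    simenv a Ts s s' /\ typing P (Ctx 0 0 Ts) a (Val V) A /\ tabs_unit_val V /\
    V1 = subst_val LVar TVar s V /\ V2 = subst_val LVar TVar s' V.

(** In use, [M1] is what [M2] has become by a step, so evaluations are carried against the direction
    of reduction. *)
Definition expands (a : location) (A : ty) (M1 M2 : tm) : Prop :=
  forall V1, eval Phi a M1 V1 -> exists V2, eval Phi a M2 V2 /\ sim a A V1 V2.

Lemma sim_run a A V1 V2 U :
  sim a (TMon A) V1 V2 -> run Phi a V1 U -> run Phi a V2 U.
Proof.
  intros (Ts & s & s' & V & Hs & HV & Ht & -> & ->) Hrun.
  eapply run_transfer; eauto.
Qed.

Lemma expands_eq a A M1 M2 :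
  ok P a M1 A -> (forall V, eval Phi a M1 V -> eval Phi a M2 V) ->
  expands a A M1 M2.
Proof.
  intros HM H V1 HV1. exists V1. split; auto.
  apply (eval_ok _ _ _ A) in HV1 as HV; auto.
  exists [], Var, Var, V1. rewrite (proj1 subst_tm_id).
  split; [constructor|]; try (intros [|n]; discriminate); simpl; auto.
  destruct HV; auto.
Qed.

(** The computations are hidden behind a single variable, so that nothing but their results is
    compared. *)
Lemma sim_run_incl a A V1 V2 :
  ok P a (Val V1) (TMon A) -> ok P a (Val V2) (TMon A) ->
  (forall U, run Phi a V1 U -> run Phi a V2 U) -> sim a (TMon A) V1 V2.
Proof.
  intros HV1 HV2 H.
  exists [TMon A], (scons V1 Var), (scons V2 Var), (Var 0).
  split; [constructor|].
  - intros [|[|n]] B HB; inversion HB; eauto.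
  - intros [|[|n]] B HB; inversion HB; subst; auto.
  - intros [|[|n]] B HB; inversion HB; subst; auto.
  - intros [|[|n]] B U HB; inversion HB; subst. apply H.
  - apply tabs_scons_Var, HV1.
  - apply tabs_scons_Var, HV2.
  - repeat split. apply ty_var. reflexivity.
Qed.

Lemma expands_mon a A M1 V2 :
  ok P a M1 (TMon A) -> ok P a (Val V2) (TMon A) ->
  (forall V U, eval Phi a M1 V -> run Phi a V U -> run Phi a V2 U) ->
  expands a (TMon A) M1 (Val V2).
Proof.
  intros HM HV2 H V1 HV1. exists V2. split; [apply eval_val|].
  apply sim_run_incl; eauto using eval_ok.
Qed.

(** Here related values enter a continuation that may copy, drop or pair them; [eval_transfer] is
    stated for open terms for this purpose. *)
Lemma expands_let a A B M1 M2 N :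
  expands a A M1 M2 -> typing P (Ctx 0 0 [A]) a N B -> tabs_unit_tm N ->
  expands a B (Let M1 N) (Let M2 N).
Proof.
  intros HM HN HtN W1 HW1. inversion HW1 as [|M N' V1 W HV1 HN1|]; subst;
    [|contradiction].
  destruct (HM V1 HV1) as (V2 & HV2 & Ts & s & s' & V & Hs & HV & Ht & -> & ->).
  assert (E : forall t,
    subst_tm LVar TVar t (subst_tm LVar TVar (scons V Var) N) =
    subst_tm LVar TVar (scons (subst_val LVar TVar t V) Var) N).
  { intros t. rewrite (proj2 subst_tm_comp).
    eapply (subst_tm_ext P _ _ _ _ HN). intros [|n] Hn; simpl in *; auto. lia. }
  destruct (eval_transfer a Ts s s' Hs _ _ HN1
              (subst_tm LVar TVar (scons V Var) N) B)
    as (W & HW & HtW & -> & HW2).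
  - apply (typing_inst_id P a Ts [A] N B); auto using tabs_scons_Var.
    + eapply simenv_nonrelocatable; eauto.
    + intros [|[|n]] C HC; inversion HC; subst. exact HV.
  - apply tabs_unit_subst; auto using tabs_scons_Var.
  - symmetry. apply E.
  - rewrite E in HW2. eexists. split; [eapply eval_let; eauto|].
    exists Ts, s, s', W. auto.
Qed.

Lemma expands_do a A B M1 M2 N :
  expands a (TMon A) M1 M2 ->
  ok P a (Val (Do M1 N)) (TMon B) -> ok P a (Val (Do M2 N)) (TMon B) ->
  expands a (TMon B) (Val (Do M1 N)) (Val (Do M2 N)).
Proof.
  intros HM H1 H2. apply expands_mon; auto. intros V U HV HU.
  inversion HV; subst; [|contradiction].
  inversion HU as [|a0 M N' X U1 Y U' HX HU1 HY HU'|]; subst;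
    [|match goal with H : remote _ _ _ _ _ |- _ => inversion H end].
  destruct (HM X HX) as (X2 & HX2 & Hsim).
  eapply run_do; eauto. eapply sim_run; eauto.
Qed.

Lemma expands_plug_let a e M B :
  ok P a (plug_let e M) B ->
  exists A, ok P a M A /\
    forall M', ok P a M' A ->
      ok P a (plug_let e M') B /\
      (expands a A M' M -> expands a B (plug_let e M') (plug_let e M)).
Proof.
  revert B. induction e as [|e IH N]; simpl; intros B HM.
  - exists B. auto.
  - apply ok_let in HM as (A & HM & HN & HtN).
    destruct (IH A HM) as (C & HC & H). exists C. split; auto.
    intros M' HM'. destruct (H M' HM') as [HM1 Hexp]. split.
    + destruct HM1. split; [eapply ty_let; eauto | split; auto].
    + intros He. eapply expands_let; eauto.
Qed.

Lemma expands_plug a E M B :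
  ok P a (plug E M) B ->
  exists A, ok P a M A /\
    forall M', ok P a M' A ->
      ok P a (plug E M') B /\
      (expands a A M' M -> expands a B (plug E M') (plug E M)).
Proof.
  revert B. induction E as [e|E IH N]; simpl; intros B HM.
  - apply expands_plug_let. exact HM.
  - pose proof HM as HM0. apply ok_do in HM as (A & D & -> & HM & HN & HtN).
    destruct (IH _ HM) as (C & HC & H). exists C. split; auto.
    intros M' HM'. destruct (H M' HM') as [HM1 Hexp].
    assert (HM2 : ok P a (Val (Do (plug E M') N)) (TMon D)).
    { destruct HM1. split; [eapply ty_bind; eauto | split; auto]. }
    split; auto. intros He. eapply expands_do; eauto.
Qed.

(* Small-step evaluation with arbitrary contexts, except that a remote call is
   one big step; the stacks disappear. *)
Inductive ev : location -> tm -> val -> Prop :=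
| ev_unit a U : ev a (Val (Unit U)) U
| ev_local a E M M' U :
    local_step (phi Phi a) M M' -> ev a (plug E M') U -> ev a (plug E M) U
| ev_gen_local a E V W U :
    ev a (plug E (App V W)) U -> ev a (plug E (Val (Gen a V W))) U
| ev_gen_remote a b E R V W U :
    remote a R b V W -> ev a (plug E (Val R)) U ->
    ev a (plug E (Val (Gen b V W))) U
| ev_remote a b E R V W U U' :
    remote a R b V W -> ev b (App V W) U -> ev a (plug E (Val (Unit U))) U' ->
    ev a (plug E (Val R)) U'.

Lemma remote_inj a R b V W b' V' W' :
  remote a R b V W -> remote a R b' V' W' -> b = b' /\ V = V' /\ W = W'.
Proof. intros H H'. inversion H; subst; inversion H'; auto. Qed.

Lemma ok_step_expands a M M' A :
  ok P a M A -> local_step (phi Phi a) M M' -> expands a A M' M.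
Proof.
  intros HM Hst. destruct (local_step_sound P Phi Hwf Htabs _ _ _ _ HM Hst) as [HM' _].
  destruct M as [V|M N| | | |];
    try (apply expands_eq; auto; intros; eapply eval_red; eauto; exact I).
  (* A [Do] that steps is a value and evaluates to itself, so it can be compared with its reduct
     only by the results of running both. *)
  - inversion Hst; subst. pose proof HM as HM0.
    apply ok_do in HM0 as (B & C & -> & _). apply expands_mon; auto.
    intros V U HV HU. eapply run_do; eauto using eval_val, run_unit.
  - inversion Hst; subst. apply expands_eq; auto.
    intros; eapply eval_let; eauto using eval_val.
Qed.

Lemma ev_eval a M U A :
  ev a M U -> ok P a M (TMon A) ->
  exists V, eval Phi a M V /\ run Phi a V U.
Proof.
  intros H; revert A.
  (* The common part of all rules but [ev_unit]: expansion of the content of the hole lifts through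
     [E], and at type [TMon A] every result of a value of the reduct is a result of the related
     value of the whole term. *)
  assert (Hplug : forall a E M M' U A,
    ok P a (plug E M) (TMon A) ->
    (forall B, ok P a M B -> ok P a M' B /\ expands a B M' M) ->
    (forall A, ok P a (plug E M') (TMon A) ->
       exists V, eval Phi a (plug E M') V /\ run Phi a V U) ->
    exists V, eval Phi a (plug E M) V /\ run Phi a V U).
  { clear H a M U. intros a E M M' U A HM H IH.
    destruct (expands_plug _ _ _ _ HM) as (B & HB & Hexp).
    destruct (H B HB) as [HM' He]. destruct (Hexp M' HM') as [HE Hx].
    destruct (IH A HE) as (V & HV & HU).
    destruct (Hx He V HV) as (V2 & HV2 & Hsim).
    exists V2. split; auto. eapply sim_run; eauto. }
  induction H as [a U|a E M M' U Hst _ IH|a E V W U _ IH|a b E R V W U Hrem _ IH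
                 |a b E R V W U U' Hrem _ IH1 _ IH2]; intros A HM.
  - eauto using eval_val, run_unit.
  - apply (Hplug a E M M' U A HM); auto. intros B HB. split.
    + eapply local_step_sound; eauto.
    + apply ok_step_expands; auto.
  - apply (Hplug a E _ (App V W) U A HM); auto. intros B HB.
    destruct (ok_remote P a _ _ _ _ _ (remote_gen a a V W) HB) as (C & -> & HC & _).
    split; auto. apply expands_mon; auto. intros X U' HX HU'.
    eapply run_remote; eauto. apply remote_gen.
  - apply (Hplug a E _ (Val R) U A HM); auto. intros B HB.
    destruct (typing_remote P [] a _ _ _ _ B (remote_gen a b V W)
                (proj1 HB) (proj2 HB))
      as (D & C & -> & HD & HV & HtV & HW & HtW).
    assert (HR : ok P a (Val R) (TMon C)).
    { inversion Hrem; subst; auto;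
        (split; [|split; auto]);
        [eapply ty_req | eapply ty_call]; eauto. }
    split; auto. apply expands_mon; auto. intros X U' HX HU'.
    inversion HX; subst; [|contradiction].
    inversion HU' as [| |a0 V0 b' V1 W1 Y U1 Hrem' HY HU1]; subst;
      try (inversion Hrem; fail).
    destruct (remote_inj _ _ _ _ _ _ _ _ Hrem Hrem') as (<- & <- & <-).
    eapply run_remote; eauto. apply remote_gen.
  - apply (Hplug a E _ (Val (Unit U)) U' A HM); auto. intros B HB.
    destruct (ok_remote P a _ _ _ _ _ Hrem HB) as (C & -> & HC & _).
    destruct (IH1 C HC) as (X & HX & HU).
    assert (HUC : ok P b (Val U) C /\ relocatable C)
      by (eapply run_ok; eauto using eval_ok).
    destruct HUC as [HUC HCr].
    destruct (ok_move P b a U C HUC HCr) as [[HUa HtU] _].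
    assert (HUn : ok P a (Val (Unit U)) (TMon C))
      by (split; auto; apply ty_unit; auto).
    split; auto. apply expands_mon; auto. intros Y U1 HY HU1.
    inversion HY; subst; [|contradiction].
    inversion HU1; subst;
      [|match goal with H : remote _ (Unit _) _ _ _ |- _ => inversion H end].
    eapply run_remote; eauto.
Qed.
End Evaluation.

(** * Elimination of the stacks *)

Section Runs.
Variable Phi : program.

(* The stacks turn the result returned from an active location into the final [Vf]. *)
Inductive cont_ev (Vf : val) : location -> val -> stack -> stack -> Prop :=
| cont_done : cont_ev Vf client Vf [] []
| cont_server_end U U' :
    ev Phi client (Val (Unit U)) U' -> cont_ev Vf client U' [] [] ->
    cont_ev Vf server U [] []
| cont_to_server U U' E Dc Ds :
    ev Phi server (plug E (Val (Unit U))) U' -> cont_ev Vf server U' Dc Ds ->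
    cont_ev Vf client U Dc (E :: Ds)
| cont_to_client U U' E Dc Ds :
    ev Phi client (plug E (Val (Unit U))) U' -> cont_ev Vf client U' Dc Ds ->
    cont_ev Vf server U (E :: Dc) Ds.

Definition config_ev (Vf : val) (k : config) : Prop :=
  match k with
  | AtClient M Dc Ds => exists U, ev Phi client M U /\ cont_ev Vf client U Dc Ds
  | AtServer Dc M Ds => exists U, ev Phi server M U /\ cont_ev Vf server U Dc Ds
  end.

Lemma step_config_ev Vf k k' :
  step Phi k k' -> config_ev Vf k' -> config_ev Vf k.
Proof.
  intros Hst. inversion Hst; subst; simpl; intros (U & HU & Hk).
  - eexists. split; [eapply ev_local; eauto | eauto].
  - eexists. split; [eapply ev_local; eauto | eauto].
  (* The context pushed by the request is the first to be resumed on its side; its evaluation, read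
     off from [cont_ev], is the last premise of [ev_remote]. *)
  - inversion Hk; subst. eexists. split; [|eassumption].
    eapply ev_remote; eauto. apply remote_req.
  - inversion Hk; subst. eexists. split; [|eassumption].
    eapply ev_remote; eauto. apply remote_call.
  - eexists. split; [apply ev_unit|]. eapply cont_to_server; eauto.
  - eexists. split; [apply ev_unit|]. eapply cont_to_client; eauto.
  - eexists. split; [apply ev_unit|]. eapply cont_server_end; eauto.
  - eexists. split; [apply ev_gen_local|]; eauto.
  - eexists. split; [eapply ev_gen_remote; eauto; apply remote_req | eauto].
  - eexists. split; [eapply ev_gen_remote; eauto; apply remote_call | eauto].
  - eexists. split; [apply ev_gen_local|]; eauto.
Qed.

Lemma steps_ev M V :
  steps Phi (AtClient M [] []) (AtClient (Val (Unit V)) [] []) ->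
  ev Phi client M V.
Proof.
  intros H.
  assert (Hk : config_ev V (AtClient M [] [])).
  { apply clos_rt_rt1n in H.
    remember (AtClient (Val (Unit V)) [] []) as k' eqn:Ek'.
    induction H as [k|k1 k2 k3 Hst _ IH]; subst.
    - exists V. split; [apply ev_unit | apply cont_done].
    - eapply step_config_ev; eauto. }
  destruct Hk as (U & HU & Hk). inversion Hk; subst. exact HU.
Qed.
End Runs.

(** * Simulation by the compiled program *)

Definition cfg (a : location) (m n : Untyped.tm) : Untyped.config :=
  match a with
  | client => Untyped.Config m n
  | server => Untyped.Config n m
  end.

Definition other (a : location) : location :=
  match a with client => server | server => client end.

(** [unfold_loop] compares instances of one term, so the context is recast as a term with variable 0
    in the hole. The continuations of its frames are renamed by [up_ren S] to avoid that variable
    below their own binder. *)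
Lemma plug_as_subst e :
  exists m, forall v,
    Untyped.subst (scons v Untyped.Var) m = Untyped.plug e v.
Proof.
  assert (E : forall v n,
    Untyped.subst (Untyped.up (scons v Untyped.Var)) (Untyped.ren (up_ren S) n) = n).
  { intros v n. rewrite untyped_subst_ren. etransitivity;
      [|apply untyped_subst_id]. f_equal.
    apply functional_extensionality; intros [|k]; reflexivity. }
  induction e as [e|e [m IH] n].
  - induction e as [|e [m IH] n].
    + exists (Untyped.Var 0). reflexivity.
    + exists (Untyped.Let m (Untyped.ren (up_ren S) n)). intros v; simpl in *.
      rewrite IH, E; reflexivity.
  - exists (Untyped.Do m (Untyped.ren (up_ren S) n)). intros v; simpl.
    rewrite IH, E; reflexivity.
Qed.

Lemma loop_eq_plug e :
  Untyped.loop_eq (Untyped.plug e Untyped.Loop)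
    (Untyped.plug e Untyped.loop_body).
Proof.
  destruct (plug_as_subst e) as [m Hm]. rewrite <- !Hm.
  apply rst_step, Untyped.unfold_loop_intro.
Qed.

(** Let frames are the innermost frames of a context, so one more can be added at the hole of any
    context. This is not so for [Do]. *)
Lemma plug_let_inside e n :
  exists e', forall m,
    Untyped.plug e' m = Untyped.plug e (Untyped.Let m n).
Proof.
  induction e as [e|e [e' IH] n'].
  - enough (H : exists e', forall m,
        Untyped.plug_let e' m = Untyped.plug_let e (Untyped.Let m n)).
    { destruct H as [e' He']. exists (Untyped.ELetCtx e'). exact He'. }
    induction e as [|e [e' IH] n'].
    + exists (Untyped.ELet Untyped.EHole n). reflexivity.
    + exists (Untyped.ELet e' n'). intros m; simpl. rewrite IH; reflexivity.
  - exists (Untyped.EDo e' n'). intros m; simpl. rewrite IH; reflexivity.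
Qed.

(* A callback runs below the computation that waits for a reply.  As a [Do] is
   not an evaluation context below [Let], waiting computations must be nested
   in [Do] contexts only. *)
Definition dos (ns : list Untyped.tm) : Untyped.ectx :=
  fold_right (fun n e => Untyped.EDo e n) (Untyped.ELetCtx Untyped.EHole) ns.

Lemma plug_dos_snoc ns n m :
  Untyped.plug (dos (ns ++ [n])) m = Untyped.plug (dos ns) (Untyped.Do m n).
Proof. induction ns; simpl; congruence. Qed.

(** Together with [dispatch], this names the parts of [loop_body] that remain after a message has
    been received. *)
Definition reply : Untyped.tm :=
  Untyped.do_send (Untyped.Con Untyped.Ret [Untyped.Var 0]) Untyped.Loop.

Definition dispatch : list (Untyped.con * nat * Untyped.tm) :=
  [(Untyped.Apply, 2,
    Untyped.Do (Untyped.App (Untyped.Var 0) (Untyped.Var 1)) reply);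
   (Untyped.Ret, 1, Untyped.Unit (Untyped.Var 0))].

Lemma location_eq_or_other a b : b = a \/ b = other a.
Proof. destruct a, b; auto. Qed.

Lemma ls_case_nil funs c alts m :
  In (c, 0, m) alts ->
  Untyped.local_step funs (Untyped.Case (Untyped.Con c []) alts) m.
Proof.
  intros H. rewrite <- (untyped_subst_id m).
  exact (Untyped.ls_case funs c [] alts m (Forall_nil _) H).
Qed.

Lemma comp_gen_here funs a rl v w :
  Untyped.local_step funs (comp_gen a (comp_loc rl a) v w) (Untyped.App v w).
Proof. destruct a; apply ls_case_nil; simpl; auto. Qed.

Lemma comp_gen_other funs a rl v w :
  Untyped.local_step funs (comp_gen a (comp_loc rl (other a)) v w)
    (comp_remote v w).
Proof. destruct a; apply ls_case_nil; simpl; auto. Qed.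

Section Simulation.
Variables (P : split) (Phi : program).
Hypotheses (Hwf : well_formed P Phi) (Htabs : tabs_unit_program Phi).

Let usteps := Untyped.steps (comp_program Phi).

Lemma usteps_trans k1 k2 k3 : usteps k1 k2 -> usteps k2 k3 -> usteps k1 k3.
Proof. apply rt_trans. Qed.

(** A local step requires the other thread to wait in a [receive]. So its [Loop] is unfolded before
    the step and folded again afterwards, both by the identification of configurations. *)
Lemma usteps_local a e1 e2 m m' :
  Untyped.local_step (comp_funmap a (phi Phi a)) m m' ->
  usteps (cfg a (Untyped.plug e1 m) (Untyped.plug e2 Untyped.Loop))
         (cfg a (Untyped.plug e1 m') (Untyped.plug e2 Untyped.Loop)).
Proof.
  intros H. apply rt_step.
  exists (cfg a (Untyped.plug e1 m) (Untyped.plug e2 Untyped.loop_body)),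
         (cfg a (Untyped.plug e1 m') (Untyped.plug e2 Untyped.loop_body)).
  pose proof (loop_eq_plug e2). split; [|split].
  - destruct a; split; simpl; auto; apply rst_refl.
  - destruct a; simpl; [apply Untyped.st_local_client | apply Untyped.st_local_server];
      exact H.
  - destruct a; split; simpl; try apply rst_refl; apply rst_sym; auto.
Qed.

(** The roles are exchanged: the sender is left with [Loop] and becomes the waiting thread, which is
    the invariant form of all configurations below. *)
Lemma usteps_send a e1 e2 v :
  Untyped.value v ->
  usteps (cfg a (Untyped.plug e1 (Untyped.do_send v Untyped.Loop))
                (Untyped.plug e2 Untyped.Loop))
         (cfg (other a) (Untyped.plug e2 (Untyped.Case v dispatch))
                        (Untyped.plug e1 Untyped.Loop)).
Proof.
  intros H. apply rt_step.
  exists (cfg a (Untyped.plug e1 (Untyped.do_send v Untyped.Loop))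
                (Untyped.plug e2 Untyped.loop_body)),
         (cfg (other a) (Untyped.plug e2 (Untyped.Case v dispatch))
                        (Untyped.plug e1 Untyped.Loop)).
  pose proof (loop_eq_plug e2). split; [|split].
  - destruct a; split; simpl; auto; apply rst_refl.
  - destruct a; simpl;
      [ apply (Untyped.st_to_server _ e1 e2 v Untyped.Loop
                 (Untyped.Case (Untyped.Var 0) dispatch))
      | apply (Untyped.st_to_client _ e2 e1 v
                 (Untyped.Case (Untyped.Var 0) dispatch) Untyped.Loop) ];
      exact H.
  - split; apply rst_refl.
Qed.

Lemma usteps_call a e1 e2 v w :
  Untyped.value v -> Untyped.value w ->
  usteps (cfg a (Untyped.plug e1 (comp_remote v w))
                (Untyped.plug e2 Untyped.Loop))
         (cfg (other a) (Untyped.plug e2 (Untyped.Do (Untyped.App v w) reply))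
                        (Untyped.plug e1 Untyped.Loop)).
Proof.
  intros Hv Hw. eapply usteps_trans.
  - apply usteps_send. repeat constructor; auto.
  - apply usteps_local.
    apply (Untyped.ls_case _ Untyped.Apply [v; w] dispatch
             (Untyped.Do (Untyped.App (Untyped.Var 0) (Untyped.Var 1)) reply));
      simpl; auto.
Qed.

Lemma usteps_return a e1 e2 u :
  Untyped.value u ->
  usteps (cfg a (Untyped.plug e1 (Untyped.Do (Untyped.Unit u) reply))
                (Untyped.plug e2 Untyped.Loop))
         (cfg (other a) (Untyped.plug e2 (Untyped.Unit u))
                        (Untyped.plug e1 Untyped.Loop)).
Proof.
  intros Hu. eapply usteps_trans; [|eapply usteps_trans].
  - apply usteps_local. apply Untyped.ls_do, Hu.
  - apply (usteps_send a e1 e2 (Untyped.Con Untyped.Ret [u])).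
    repeat constructor; auto.
  - apply usteps_local.
    apply (Untyped.ls_case _ Untyped.Ret [u] dispatch
             (Untyped.Unit (Untyped.Var 0))); simpl; auto.
Qed.

(** No message is sent during [eval], so any context [e1] is allowed, in particular the let frames
    that arise on the way. *)
Lemma eval_usteps a M V A e1 e2 :
  eval Phi a M V -> ok P a M A ->
  usteps (cfg a (Untyped.plug e1 (comp_closed a M))
                (Untyped.plug e2 Untyped.Loop))
         (cfg a (Untyped.plug e1 (comp_closed a (Val V)))
                (Untyped.plug e2 Untyped.Loop)).
Proof.
  intros H; revert A e1. induction H as [V|M N V W HM IHM HN IHN|M M' V _ Hst _ IH];
    intros A e1 Hok.
  - apply rt_refl.
  - apply ok_let in Hok as (B & HMB & HNA & HtN).
    unfold comp_closed at 1. simpl.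
    change (fun l => S l) with S.
    destruct (plug_let_inside e1 (comp_tm a S (up_ren (fun n => n)) N)) as [e He].
    rewrite <- He. eapply usteps_trans; [eapply IHM; eauto|]. rewrite He.
    assert (HV : ok P a (Val V) B) by (eapply eval_ok; eauto).
    eapply usteps_trans.
    + apply usteps_local with
        (m' := comp_closed a (subst_tm LVar TVar (scons V Var) N)).
      erewrite comp_inst by eauto. apply Untyped.ls_let, comp_value.
    + eapply IHN. eapply ok_inst; eauto.
  - destruct (local_step_sound P Phi Hwf Htabs _ _ _ _ Hok Hst)
      as [Hok' [-> | Hloc]]; [eauto|].
    eapply usteps_trans; [apply usteps_local; exact Hloc | eauto].
Qed.

(** The induction is over all [ns1] and [ns2]: a [Do] adds its continuation to the active side,
    while a call adds [reply] to the waiting side, which then becomes the active one. Both additions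
    are [Do] frames, so either side can always be extended again. *)
Lemma run_usteps a V U A :
  run Phi a V U -> ok P a (Val V) (TMon A) -> forall ns1 ns2,
  usteps (cfg a (Untyped.plug (dos ns1) (comp_closed a (Val V)))
                (Untyped.plug (dos ns2) Untyped.Loop))
         (cfg a (Untyped.plug (dos ns1) (comp_closed a (Val (Unit U))))
                (Untyped.plug (dos ns2) Untyped.Loop)).
Proof.
  intros H; revert A.
  induction H as [a U|a M N V U W U' HM HV IHV HN HW IHW
                 |a V b V1 W1 W U Hrem Happ HW IHW]; intros A Hok ns1 ns2.
  - apply rt_refl.
  - apply ok_do in Hok as (B & C & [= <-] & HMB & HNA & HtN).
    assert (HVB : ok P a (Val V) (TMon B)) by (eapply eval_ok; eauto).
    destruct (run_ok P Phi Hwf Htabs _ _ _ _ HV HVB) as [HU _].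
    assert (HNU := ok_inst P a U N B (TMon A) HU HNA HtN).
    unfold comp_closed at 1. simpl. change (fun l => S l) with S.
    rewrite <- plug_dos_snoc. eapply usteps_trans; [eapply eval_usteps; eauto|].
    eapply usteps_trans; [eapply IHV; eauto|]. rewrite plug_dos_snoc.
    eapply usteps_trans.
    { apply usteps_local with
        (m' := comp_closed a (subst_tm LVar TVar (scons U Var) N)).
      erewrite comp_inst by eauto. apply Untyped.ls_do, comp_value. }
    eapply usteps_trans; [eapply eval_usteps; eauto|].
    eapply IHW. eapply eval_ok; eauto.
  - destruct (ok_remote _ _ _ _ _ _ _ Hrem Hok) as (C & [= <-] & HappC & E).
    assert (HWC : ok P b (Val W) (TMon A)) by (eapply eval_ok; eauto).
    destruct (run_ok P Phi Hwf Htabs _ _ _ _ HW HWC) as [HU HA].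
    destruct (ok_move P b a U A HU HA) as [_ EU].
    set (v := comp_closed a (Val V1)) in *. set (w := comp_closed a (Val W1)) in *.
    assert (Hv : Untyped.value v) by apply comp_value.
    assert (Hw : Untyped.value w) by apply comp_value.
    assert (Hremote : b = other a ->
      usteps (cfg a (Untyped.plug (dos ns1) (comp_remote v w))
                (Untyped.plug (dos ns2) Untyped.Loop))
         (cfg a (Untyped.plug (dos ns1) (comp_closed a (Val (Unit U))))
                (Untyped.plug (dos ns2) Untyped.Loop))).
    { intros ->. eapply usteps_trans; [apply usteps_call; auto|].
      rewrite <- E, <- plug_dos_snoc.
      eapply usteps_trans; [eapply eval_usteps; eauto|].
      eapply usteps_trans; [eapply IHW; eauto|]. rewrite plug_dos_snoc.
      change (comp_closed (other a) (Val (Unit U))) with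
        (Untyped.Unit (comp_closed (other a) (Val U))). rewrite EU.
      change (comp_closed a (Val (Unit U))) with
        (Untyped.Unit (comp_closed a (Val U))).
      (* The return exchanges the roles a second time, back to [a] as the active side. *)
      replace (cfg a) with (cfg (other (other a))) by (destruct a; reflexivity).
      apply usteps_return, comp_value. }
    destruct Hrem as [V1 W1|V1 W1|a b V1 W1]; auto.
    change (comp_closed a (Val (Gen b V1 W1)))
      with (comp_gen a (comp_loc (fun n => n) b) v w).
    destruct (location_eq_or_other a b) as [->| ->].
    + eapply usteps_trans; [apply usteps_local, comp_gen_here|].
      rewrite <- E. eapply usteps_trans; [eapply eval_usteps; eauto|].
      eapply IHW; eauto.
    + eapply usteps_trans; [apply usteps_local, comp_gen_other|]. auto.
Qed.
End Simulation.

Theorem theorem5p1 (Phi : Poly.program) (P : Poly.split)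
    (M : Poly.tm) (A : Poly.ty) (V : Poly.val)
    (Hwf : Poly.well_formed P Phi)
    (HM : Poly.typing P Poly.empty_ctx (Poly.LConst client) M (Poly.TMon A))
    (Htabs : Poly.tabs_unit_program Phi /\ Poly.tabs_unit_tm M)
    (Hrun : Poly.steps Phi (Poly.AtClient M [] [])
                           (Poly.AtClient (Poly.Val (Poly.Unit V)) [] [])) :
  Untyped.steps (comp_program Phi)
    (Untyped.Config (comp_closed client M) Untyped.Loop)
    (Untyped.Config (comp_closed client (Poly.Val (Poly.Unit V)))
                    Untyped.Loop).
Proof.
  destruct Htabs as [HPhi Ht]. assert (Hok : ok P client M (TMon A)) by (split; auto).
  apply steps_ev in Hrun.
  destruct (ev_eval P Phi Hwf HPhi _ _ _ _ Hrun Hok) as (W & HW & HV).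
  apply rt_trans with (Untyped.Config (comp_closed client (Val W)) Untyped.Loop).
  - exact (eval_usteps P Phi Hwf HPhi client M W _ (dos []) (dos []) HW Hok).
  - refine (run_usteps P Phi Hwf HPhi client W V A HV _ [] []).
    eapply eval_ok; eauto.
Qed.
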